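(* Let $n\ge 2$ and let $M^n\hookrightarrow\mathbb{R}^{n+1}$ be a complete, connected, properly embedded translating soliton. For $r>0$ let $$\mathcal{C}(r):=\{x\in\mathbb{R}^{n+1} : \langle x,\mathbf{e}_1\rangle^2+\langle x,\mathbf{e}_n\rangle^2\le r^2\}.$$ Assume that, for some $r>0$, $M$ is $C^1$-asymptotic to two half-hyperplanes outside $\mathcal{C}(r)$. Then $M$ coincides with a hyperplane parallel to $\mathbf{e}_{n+1}$.
   Context: Let $\mathbf{e}_1,\dots,\mathbf{e}_{n+1}$ be the standard basis of $\mathbb{R}^{n+1}$ and $\langle\cdot,\cdot\rangle$ the Euclidean inner product. Translating soliton: an oriented smooth hypersurface $M$ in $\mathbb{R}^{n+1}$ such that $t\mapsto M+t\,\mathbf{e}_{n+1}$ is a mean curvature flow; equivalently, $\vec{\mathbf{H}}=\mathbf{e}_{n+1}^{\perp}$, where $\vec{\mathbf{H}}$ is the (Euclidean) mean curvature vector field of $M$ (trace of the second fundamental form) and $\perp$ denotes projection onto the normal bundle of $M$. It is called complete if it is complete as a hypersurface of $\mathbb{R}^{n+1}$ with the Euclidean metric. A hyperplane is parallel to $\mathbf{e}_{n+1}$ if $\mathbf{e}_{n+1}$ is tangent to it (i.e. lies in its direction space). Asymptotic to a half-hyperplane: let $\mathcal{H}$ be an open half-hyperplane in $\mathbb{R}^{n+1}$ and $w$ the unit inward pointing normal of $\partial\mathcal{H}$ (tangent to $\mathcal{H}$). For $\delta>0$ set $\mathcal{H}(\delta):=\{p+tw : p\in\partial\mathcal{H},\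 t>\delta\}$. A smooth hypersurface $M$ is $C^k$-asymptotic to $\mathcal{H}$ if $M$ can be represented as the graph $\{x+\varphi(x)\nu : x\in\mathcal H\}$ ($\nu$ a unit normal to the hyperplane containing $\mathcal{H}$) of a $C^k$ function $\varphi:\mathcal{H}\to\mathbb{R}$ such that for every $\epsilon>0$ there exists $\delta>0$ such that, for all $j\in\{1,\dots,k\}$, $$\sup_{\mathcal{H}(\delta)}|\varphi|<\epsilon\quad\text{and}\quad \sup_{\mathcal{H}(\delta)}|D^j\varphi|<\epsilon.$$ Asymptotic to two half-hyperplanes outside a cylinder: given a solid cylinder $\mathcal{C}$ (a set isometric to $D(r)\times\mathbb{R}^{n-1}$, with $D(r)$ the disk of radius $r$ in $\mathbb{R}^2$), a smooth hypersurface $M$ is $C^k$-asymptotic to two half-hyperplanes $\mathcal{H}_1$ and $\mathcal{H}_2$ outside $\mathcal{C}$ if (i) $\mathcal{C}$ contains the boundaries $\partial\mathcal{H}_1$ and $\partial\mathcal{H}_2$; and (ii) $M\setminus\mathcal{C}$ consists of two connected components $M_1$ and $M_2$ that are $C^k$-asymptotic to $\mathcal{H}_1$ and $\mathcal{H}_2$, respectively. *)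

(* Defs.v *)
From HB Require Import structures.
From mathcomp Require Import all_boot all_order all_algebra.
From mathcomp Require Import all_classical all_reals all_analysis.

Set Implicit Arguments.
Unset Strict Implicit.
Unset Printing Implicit Defensive.

Import Order.TTheory GRing.Theory Num.Theory.
Import numFieldNormedType.Exports.

Local Open Scope classical_set_scope.
Local Open Scope ring_scope.

(* The library norm on 'rV[R]_m is the sup norm, which induces the right
   topology; metric notions below use the Euclidean norm enorm instead. *)
Definition dot (R : realType) (m : nat) (u v : 'rV[R]_m) : R :=
  \sum_(i < m) u 0 i * v 0 i.

Definition enorm (R : realType) (m : nat) (u : 'rV[R]_m) : R :=
  Num.sqrt (dot u u).

Definition stdvec (R : realType) (m : nat) (i : 'I_m) : 'rV[R]_m :=
  delta_mx 0 i.

(* iter_derive [:: v1; ...; vj] f x = D_v1 (... (D_vj f)) x *)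
Definition iter_derive (R : realType) (V W : normedModType R)
    (vs : seq V) (f : V -> W) : V -> W :=
  foldr (fun (v : V) (g : V -> W) (x : V) => 'D_v g x) f vs.

(* C^k regularity on A, for A relatively open in an affine subspace with
   direction space T: all iterated directional derivatives of order <= k along
   T exist and are continuous on A. For such A, the derivatives at points of A
   along T depend only on the values of f on A. *)
Definition Ck_on (R : realType) (V W : normedModType R) (k : nat)
    (A T : set V) (f : V -> W) : Prop :=
  forall vs : seq V, (forall v, v \in vs -> T v) -> (size vs <= k)%N ->
    {within A, continuous (iter_derive vs f)} /\
    ((size vs < k)%N ->
      forall x v, A x -> T v -> derivable (iter_derive vs f) x v).

Definition smooth_on (R : realType) (V W : normedModType R)
    (A : set V) (f : V -> W) : Prop :=
  forall k : nat, Ck_on k A setT f.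

Section Hypersurface.
Variables (R : realType) (n : nat).
Local Notation E := 'rV[R]_n.+1.

Definition partial (F : 'rV[R]_n -> E) (i : 'I_n) : 'rV[R]_n -> E :=
  fun u => 'D_(stdvec R i) F u.

(* F restricted to the open set W is a smooth embedding onto a relatively open
   subset of M: an injective immersion that is open as a map into M. *)
Definition local_parametrization (M : set E) (W : set 'rV[R]_n)
    (F : 'rV[R]_n -> E) : Prop :=
  [/\ open W,
      smooth_on W F,
      {in W &, injective F},
      (forall u, W u -> row_free (\matrix_(i < n) partial F i u)) &
      (forall V : set 'rV[R]_n, open V -> V `<=` W ->
         exists2 U : set E, open U & F @` V = M `&` U)].

Definition smooth_hypersurface (M : set E) : Prop :=
  forall p, M p -> exists (W : set 'rV[R]_n) (F : 'rV[R]_n -> E) u,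
    [/\ local_parametrization M W F, W u & F u = p].

(* A continuous unit normal field on M; off M the values of N are junk. *)
Definition orientation (M : set E) (N : E -> E) : Prop :=
  [/\ {within M, continuous N},
      (forall p, M p -> enorm (N p) = 1) &
      (forall W F, local_parametrization M W F ->
         forall u v, W u -> dot (N (F u)) ('D_v F u) = 0)].

Definition normal_part (nu v : E) : E := dot v nu *: nu.

Definition first_form (F : 'rV[R]_n -> E) (u : 'rV[R]_n) : 'M[R]_n :=
  \matrix_(i, j) dot (partial F i u) (partial F j u).

(* The coefficient A(d_i, d_j) of the vector-valued second fundamental form. *)
Definition second_form (F : 'rV[R]_n -> E) (nu : E) (u : 'rV[R]_n)
    (i j : 'I_n) : E :=
  normal_part nu (partial (partial F j) i u).

(* The trace of the second fundamental form with respect to the metric. *)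
Definition mean_curvature_vector (F : 'rV[R]_n -> E) (nu : E)
    (u : 'rV[R]_n) : E :=
  \sum_(i < n) \sum_(j < n)
    invmx (first_form F u) i j *: second_form F nu u i j.

Definition translating_soliton (M : set E) : Prop :=
  smooth_hypersurface M /\
  exists2 N : E -> E, orientation M N &
    forall W F, local_parametrization M W F -> forall u, W u ->
      mean_curvature_vector F (N (F u)) u =
      normal_part (N (F u)) (stdvec R ord_max).

(* The inclusion of M is a proper map. *)
Definition properly_embedded (M : set E) : Prop :=
  forall K : set E, compact K -> compact (M `&` K).

(* C^1 curves [0, 1] -> M, as restrictions of C^1 maps R -> E. *)
Definition curve_in (M : set E) (x y : E) (c : R -> E) : Prop :=
  [/\ (forall t, derivable c t 1),
      continuous (derive1 c),
      (forall t, 0 <= t <= 1 -> M (c t)),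
      c 0 = x & c 1 = y].

Definition curve_length (c : R -> E) : \bar R :=
  (\int[lebesgue_measure]_(t in `[0%R, 1%R]) (enorm (derive1 c t))%:E)%E.

(* The Riemannian distance of M; +oo when no curve joins x to y in M. *)
Definition intrinsic_dist (M : set E) (x y : E) : \bar R :=
  ereal_inf [set curve_length c | c in curve_in M x y].

Definition complete_hypersurface (M : set E) : Prop :=
  forall s : nat -> E, (forall k, M (s k)) ->
    (forall eps : R, 0 < eps -> exists K, forall i j, (K <= i)%N -> (K <= j)%N ->
       (intrinsic_dist M (s i) (s j) < eps%:E)%E) ->
    exists2 l, M l & forall eps : R, 0 < eps -> exists K, forall i, (K <= i)%N ->
      (intrinsic_dist M (s i) l < eps%:E)%E.

(* An open half-hyperplane: a point hh_pt of its boundary, a unit normal hh_nu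
   to the hyperplane containing it, and the unit inward normal hh_w of its
   boundary inside that hyperplane. *)
Record half_hyperplane := HalfHyperplane {
  hh_pt : E;
  hh_nu : E;
  hh_w : E;
  hh_nu_unit : enorm hh_nu = 1;
  hh_w_unit : enorm hh_w = 1;
  hh_orth : dot hh_nu hh_w = 0 }.

Definition hh_boundary (H : half_hyperplane) : set E :=
  [set x | dot (x - hh_pt H) (hh_nu H) = 0 /\ dot (x - hh_pt H) (hh_w H) = 0].

Definition hh_beyond (H : half_hyperplane) (delta : R) : set E :=
  [set x | exists p t, [/\ hh_boundary H p, delta < t & x = p + t *: hh_w H]].

Definition hh_set (H : half_hyperplane) : set E := hh_beyond H 0.

Definition hh_dir (H : half_hyperplane) : set E :=
  [set v | dot v (hh_nu H) = 0].

(* |D^j phi|(x): the norm of D^j phi(x) as a j-linear form on the direction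
   space of the hyperplane containing H. *)
Definition Dnorm (H : half_hyperplane) (j : nat) (phi : E -> R) (x : E) :
    \bar R :=
  ereal_sup [set `|iter_derive vs phi x|%:E | vs in
    [set vs : seq E | size vs = j /\
       forall v, v \in vs -> hh_dir H v /\ enorm v = 1]].

(* Only the values of phi on hh_set H matter. Suprema are taken in \bar R, so
   that an unbounded function has supremum +oo. *)
Definition asymptotic_to (k : nat) (M : set E) (H : half_hyperplane) : Prop :=
  exists phi : E -> R,
    [/\ Ck_on k (hh_set H) (hh_dir H) phi,
        M = [set x + phi x *: hh_nu H | x in hh_set H] &
        forall eps : R, 0 < eps -> exists2 delta : R, 0 < delta &
          forall j, (1 <= j <= k)%N ->
            (ereal_sup [set `|phi x|%:E | x in hh_beyond H delta]
               < eps%:E)%E /\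
            (ereal_sup [set Dnorm H j phi x | x in hh_beyond H delta]
               < eps%:E)%E].

Definition asymptotic_outside (k : nat) (C M : set E)
    (H1 H2 : half_hyperplane) : Prop :=
  [/\ hh_boundary H1 `<=` C,
      hh_boundary H2 `<=` C &
      exists M1 M2 : set E,
        [/\ M1 <> M2,
            [set connected_component (M `\` C) x | x in M `\` C] =
              [set M1; M2],
            asymptotic_to k M1 H1 &
            asymptotic_to k M2 H2]].

(* e_1, e_n and e_(n+1) have indices 0, n-1 and n respectively. *)
Definition cylinder (r : R) : set E :=
  [set x | dot x (stdvec R ord0) ^+ 2 + dot x (stdvec R (inord n.-1)) ^+ 2
             <= r ^+ 2].

Definition vertical_hyperplane (P : set E) : Prop :=
  exists p nu : E,
    [/\ enorm nu = 1, dot (stdvec R ord_max) nu = 0 &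
        P = [set x | dot (x - p) nu = 0]].

End Hypersurface.

(* Main.v *)
Require Import Defs.
From mathcomp Require Import all_boot all_order all_algebra.
From mathcomp Require Import all_classical all_reals all_analysis.
From mathcomp Require Import perm ring lra.
Import Order.TTheory GRing.Theory Num.Theory.
Import numFieldNormedType.Exports.
Local Open Scope classical_set_scope.
Local Open Scope ring_scope.

Set Implicit Arguments.
Unset Strict Implicit.
Unset Printing Implicit Defensive.

(** Let C be the cylinder and Y the direction of its axis, of dimension n - 1.
    Each end M_i is a graph over a whole open half-hyperplane whose boundary,
    parallel to Y, lies in C. A point of C in the closure of M_i has to lie over
    this boundary and on the boundary of C, and by the intermediate value
    theorem all such points lie on one line l_i parallel to Y (a line meaning a
    translate of Y). As M is connected, one end reaches C, and then M contains
    an open piece of l_1. This is lemma [ends].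

    Choose a unit vector nu in the plane of the cross sections such that
    <x, nu> takes the same value c on l_1 and l_2. Off the two lines, the part
    of M in C is open in M. The maximum principle, applied to a small
    perturbation of <x, nu> that is convex in the cross section and concave
    along Y, shows that M meets C within the hyperplane T of equation
    <x, nu> = c, which is parallel to e_(n+1): this is [max_principle].

    If M has a point in C off the two lines, M therefore contains an open piece
    of T. Otherwise M stays outside the interior of C and touches its boundary
    along l_1. As a graph G over the tangent hyperplane of C, it has zero second
    order jet along l_1: the function and its gradient vanish because M is on
    one side of C, the second derivatives because of symmetry and of the
    equation. Hence the restriction of G to one side of l_1, extended by zero,
    is of class C2 and satisfies the same differential inequality as G; by
    unique continuation it vanishes, and M contains an open piece of the tangent
    hyperplane: this is [flat_outside].

    Both times M contains an open piece of a hyperplane parallel to e_(n+1).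
    Over such a hyperplane, M is locally the graph of a function G with
    (Lap G)^2 <= K |DG|^2 ([local_graph]), and unique continuation for this
    inequality ([weak_uc]) makes the set of points near which M lies in the
    hyperplane open and closed ([flat_everywhere]).

    Unique continuation is proved from a Carleman estimate with a quadratic
    weight ([carleman_estimate]), in which Riemann sums over finer and finer
    grids replace integrals: the estimate only needs that the sums of the
    derivatives of a compactly supported C1 function tend to zero. *)

(** * Functions of class C1 on row vectors *)

Section line.
Variables (R : realType) (V : normedModType R).

Lemma is_derive_line (f : V -> R) (z v : V) (s d : R) :
  is_derive (z + s *: v) v f d -> is_derive s 1 (fun s => f (z + s *: v)) d.
Proof.
have E : (fun h => h^-1 *: ((fun s : R => f (z + s *: v)) (h *: 1 + s) - f (z + s *: v))) =
  (fun h => h^-1 *: (f (h *: v + (z + s *: v)) - f (z + s *: v))).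
  apply/funext => h; congr (_ *: (f _ - _)).
  by rewrite [h *: 1]mulr1 scalerDl addrCA.
move=> [fd fe]; split; first by rewrite /derivable E.
by rewrite -fe /derive E.
Qed.

Lemma line_is_derive (f : V -> R) (z v : V) (d : R) :
  is_derive (0 : R) (1 : R) (fun s : R => f (z + s *: v)) d -> is_derive z v f d.
Proof.
have E : (fun h => h^-1 *: ((fun s : R => f (z + s *: v)) (h *: 1 + 0) - f (z + 0 *: v))) =
  (fun h => h^-1 *: (f (h *: v + z) - f z)).
  apply/funext => h; congr (_ *: (f _ - f _)).
    by rewrite [h *: 1]mulr1 addr0 addrC.
  by rewrite scale0r addr0.
move=> [fd fe]; split; first by rewrite /derivable -E.
by rewrite -fe /derive -E.
Qed.

Lemma is_derive_dirZ (f : V -> R) (z v : V) (a d : R) :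
  is_derive z v f d -> is_derive z (a *: v) f (a * d).
Proof.
move=> fd; apply: line_is_derive.
have -> : (fun s : R => f (z + s *: (a *: v))) =
    (fun s => f (z + s *: v)) \o (fun s : R => s * a).
  by apply/funext => s /=; rewrite scalerA.
rewrite mulrC; apply: (@is_derive1_comp R _ _ 0 d a).
  by rewrite mul0r; apply: is_derive_line; rewrite scale0r addr0.
apply: is_derive_eq; last by rewrite scaler0 add0r [LHS]mulr1.
Qed.

Lemma le_line (f : V -> R) (z v : V) (d : R -> R) (m eps : R) :
  (forall s : R, 0 <= s <= 1 -> is_derive (z + s *: v) v f (d s)) ->
  (forall s : R, 0 <= s <= 1 -> `|d s - m| <= eps) ->
  `|f (z + v) - f z - m| <= eps.
Proof.
move=> fd dm.
have fl (s : R) : 0 <= s <= 1 -> is_derive s 1 (fun s : R => f (z + s *: v)) (d s).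
  by move=> s01; apply: is_derive_line; apply: fd.
have cf : {within `[0, 1], continuous (fun s : R => f (z + s *: v))}.
  by apply: derivable_within_continuous => x; rewrite in_itv/= => /fl[].
have fl' (s : R) : s \in `]0, 1[ -> is_derive s 1 (fun s : R => f (z + s *: v)) (d s).
  by rewrite in_itv/= => /andP[s0 s1]; apply: fl; rewrite !ltW.
have [s] := MVT_segment ler01 fl' cf.
by rewrite in_itv/= subr0 mulr1 scale0r scale1r addr0 => /dm h ->.
Qed.

End line.

#[global] Instance rV_nbhs_filter (R : realType) n (x : 'rV[R]_n) :
  ProperFilter (nbhs x).
Proof. exact: nbhs_pfilter. Qed.

(** The partial derivatives df are functions that are in turn differentiated:
    class C2 is C1at for f and for every df i, and the rules below compute the
    derivatives explicitly. *)
Definition C1at (R : realType) n (f : 'rV[R]_n -> R)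
    (df : 'I_n -> 'rV[R]_n -> R) (x : 'rV[R]_n) :=
  [/\ f y @[y --> x] --> f x,
      (forall i, is_derive x (stdvec R i) f (df i x)) &
      forall i, df i y @[y --> x] --> df i x].

Lemma is_derive_affine (R : realType) (a b s : R) :
  is_derive s (1 : R) (fun s : R => a + b * s) b.
Proof.
have h := is_deriveD (is_derive_cst (a : R) s (1 : R))
  (is_deriveZ b (is_derive_id s (1 : R))).
by apply: (is_derive_eq h); rewrite [b *: 1]mulr1 add0r.
Qed.

Section C1.
Variables (R : realType) (n : nat).
Local Notation V := 'rV[R]_n.
Implicit Types (f g : V -> R) (df dg : 'I_n -> V -> R) (x y z : V).

Lemma C1at_near_eq f df g dg x :
  (\near x, f x = g x) -> (forall i, \near x, df i x = dg i x) ->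
  C1at f df x -> C1at g dg x.
Proof.
move=> fg dfg [cf Df cdf].
have tr (h k : V -> R) : (\near x, h x = k x) -> h y @[y --> x] --> h x ->
    k y @[y --> x] --> k x.
  move=> hk; have hkx : h x = k x by exact: nbhs_singleton hk.
  rewrite -hkx => hc.
  exact: (cvg_trans (near_eq_cvg hk) hc).
split; first exact: tr cf.
- move=> i; rewrite -(nbhs_singleton (dfg i)).
  exact: near_eq_is_derive (Df i).
- by move=> i; apply: tr (cdf i).
Qed.

Lemma C1at_ext f df g dg x : f =1 g -> df =2 dg -> C1at f df x -> C1at g dg x.
Proof.
move=> fg dfg; apply: C1at_near_eq => [|i]; near=> y; first exact: fg.
exact: dfg.
Unshelve. all: by end_near.
Qed.

Lemma C1at_cst (c : R) x : C1at (fun _ => c) (fun _ _ => 0) x.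
Proof.
by split=> *; [exact: cvg_cst|exact: is_derive_cst|exact: cvg_cst].
Qed.

Lemma C1at_coord (k : 'I_n) x :
  C1at (fun x => x 0 k) (fun i _ => (i == k)%:R) x.
Proof.
split=> [|i|i]; first exact: coord_continuous; last exact: cvg_cst.
apply: line_is_derive; rewrite (_ : (fun s : R => _) =
  (fun s : R => x 0 k + (i == k)%:R * s)).
  exact: is_derive_affine.
by apply/funext => s; rewrite !mxE eqxx/= mulrC eq_sym.
Qed.

Lemma C1atD f df g dg x : C1at f df x -> C1at g dg x ->
  C1at (fun x => f x + g x) (fun i x => df i x + dg i x) x.
Proof.
move=> [cf Df cdf] [cg Dg cdg]; split=> [|i|i].
- exact: cvgD.
- exact: (is_deriveD (Df i) (Dg i)).
- exact: cvgD.
Qed.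

Lemma C1atN f df x : C1at f df x -> C1at (fun x => - f x) (fun i x => - df i x) x.
Proof.
move=> [cf Df cdf]; split=> [|i|i].
- exact: cvgN.
- exact: (is_deriveN (Df i)).
- exact: cvgN.
Qed.

Lemma C1atB f df g dg x : C1at f df x -> C1at g dg x ->
  C1at (fun x => f x - g x) (fun i x => df i x - dg i x) x.
Proof. by move=> fC gC; apply: C1atD => //; apply: C1atN. Qed.

Lemma C1atM f df g dg x : C1at f df x -> C1at g dg x ->
  C1at (fun x => f x * g x) (fun i x => df i x * g x + f x * dg i x) x.
Proof.
move=> [cf Df cdf] [cg Dg cdg]; split=> [|i|i].
- exact: cvgM.
- apply: (is_derive_eq (is_deriveM (Df i) (Dg i))).
  by rewrite /= addrC; congr (_ + _); rewrite [LHS]mulrC.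
- by apply: cvgD; apply: cvgM.
Qed.

Lemma C1atZ (c : R) f df x : C1at f df x ->
  C1at (fun x => c * f x) (fun i x => c * df i x) x.
Proof.
move=> fC; apply: C1at_ext (C1atM (C1at_cst c x) fC) => // i y /=.
by rewrite mul0r add0r.
Qed.

Lemma C1at_sum (I : Type) (r : seq I) (P : pred I)
    (F : I -> V -> R) (dF : I -> 'I_n -> V -> R) x :
  (forall k, P k -> C1at (F k) (dF k) x) ->
  C1at (fun x => \sum_(k <- r | P k) F k x)
       (fun i x => \sum_(k <- r | P k) dF k i x) x.
Proof.
move=> FC; elim: r => [|k r IH].
  by apply: C1at_ext (C1at_cst 0 x) => [y|i y]; rewrite big_nil.
case Pk : (P k).
  by apply: C1at_ext (C1atD (FC k Pk) IH) => [y|i y]; rewrite big_cons Pk.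
by apply: C1at_ext IH => [y|i y]; rewrite big_cons Pk.
Qed.

Lemma C1at_comp1 (p dp : R -> R) f df x : C1at f df x ->
  is_derive (f x) 1 p (dp (f x)) -> {for f x, continuous dp} ->
  C1at (fun x => p (f x)) (fun i x => dp (f x) * df i x) x.
Proof.
move=> [cf Df cdf] Dp cdp; split=> [|i|i].
- apply: continuous_comp => //.
  by apply/differentiable_continuous/derivable1_diffP; case: Dp.
- apply: line_is_derive; rewrite mulrC.
  have /is_derive_line Dl : is_derive (x + 0 *: stdvec R i) (stdvec R i) f (df i x).
    by rewrite scale0r addr0.
  rewrite -[fun s : R => _]/(p \o (fun s : R => f (x + s *: stdvec R i))).
  rewrite mulrC; apply: is_derive1_comp => //.
  by rewrite scale0r addr0.
- apply: cvgM => //; exact: continuous_comp.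
Qed.

Lemma C1atV f df x : f x != 0 -> C1at f df x ->
  C1at (fun x => (f x)^-1) (fun i x => - (f x) ^- 2 * df i x) x.
Proof.
move=> fx fC; apply: (C1at_comp1 (p := fun t => t^-1) (dp := fun t => - t ^- 2)) => //.
  apply: (is_derive_eq (is_deriveV (f := id) fx (is_derive_id (f x) (1 : R)))).
  exact: mulr1.
apply: cvgN; apply: cvgV; first by rewrite expf_neq0.
exact: exprn_continuous.
Qed.

End C1.

Section strict.
Variables (R : realType) (n : nat).
Local Notation V := 'rV[R]_n.
Implicit Types (f g : V -> R) (df dg : 'I_n -> V -> R) (x y z : V).

Lemma coord_le_norm x i : `|x 0 i| <= `|x|.
Proof.
rewrite [leRHS]/Num.Def.normr/= mx_normrE.
exact: (le_trans _ (le_bigmax _ (fun ij : 'I_1 * 'I_n => `|x ij.1 ij.2|) (0, i))).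
Qed.

Lemma norm_le_coord x (c : R) : 0 <= c -> (forall i, `|x 0 i| <= c) -> `|x| <= c.
Proof.
move=> c0 xc; rewrite [leLHS]/Num.Def.normr/= mx_normrE.
apply: bigmax_le => // -[i j] _ /=; rewrite (ord1 i); exact: xc.
Qed.

Lemma nearP x (P : V -> Prop) : (\forall y \near x, P y) <->
  exists2 d : R, 0 < d & forall y, `|y - x| < d -> P y.
Proof.
split=> [/nbhs_normP[d /= d0 dP]|[d d0 dP]].
  by exists d => // y yd; apply: dP; rewrite /ball_/= distrC.
by apply/nbhs_normP; exists d => // y; rewrite /ball_/= distrC; exact: dP.
Qed.

Lemma near_all (I : finType) x (P : I -> V -> Prop) :
  (forall i, \forall y \near x, P i y) -> \forall y \near x, forall i, P i y.
Proof. by move=> H; exact: filter_forall H. Qed.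

Lemma cvg_rVP f x : f y @[y --> x] --> f x <-> forall eps : R, 0 < eps ->
  exists2 d : R, 0 < d & forall y, `|y - x| < d -> `|f y - f x| < eps.
Proof.
split=> [/cvgrPdist_lt h e e0|h].
  have /nearP[d d0 dP] := h e e0.
  by exists d => // y /dP; rewrite distrC.
apply/cvgrPdist_lt => e e0; apply/nearP; have [d d0 dP] := h e e0.
by exists d => // y /dP; rewrite distrC.
Qed.

Lemma cvg_sum_rV (I : Type) (r : seq I) (F : I -> V -> R) (l : I -> R) x :
  (forall k, F k y @[y --> x] --> l k) ->
  \sum_(k <- r) F k y @[y --> x] --> \sum_(k <- r) l k.
Proof.
move=> H; elim: r => [|k r IH].
  rewrite big_nil (_ : (fun y => _) = fun=> 0); last by apply/funext => y; rewrite big_nil.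
  exact: cvg_cst.
rewrite big_cons (_ : (fun y => _) = fun y => F k y + \sum_(k <- r) F k y); last first.
  by apply/funext => y; rewrite big_cons.
exact: cvgD.
Qed.

(** Moving one coordinate at a time keeps the path inside the ball of the
    sup norm, so that continuous partial derivatives control the increments
    between any two nearby points: f is strictly differentiable. *)
Lemma C1at_strict f df x : (\forall y \near x, C1at f df y) ->
  forall eps : R, 0 < eps -> exists2 d : R, 0 < d &
  forall y z, `|y - x| < d -> `|z - x| < d ->
    `|f z - f y - \sum_i df i x * (z 0 i - y 0 i)| <= eps * `|z - y|.
Proof.
move=> /[dup] fC1 /nbhs_singleton [_ _ cdf] eps eps0.
pose e' := eps / n.+1%:R.
have e'0 : 0 < e' by rewrite divr_gt0.
have near_df i : \forall y \near x, `|df i y - df i x| < e'.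
  by have /cvgrPdist_lt/(_ _ e'0) := cdf i; apply: filterS => y; rewrite distrC.
have /nearP[d d0 dP] : \forall y \near x, C1at f df y /\
    forall i, `|df i y - df i x| < e'.
  by apply: (filterI fC1); exact: filter_forall near_df.
exists d => // y z yd zd.
pose w k : V := \row_j (if (j < k)%N then z 0 j else y 0 j).
suff H k : (k <= n)%N ->
    `|f (w k) - f y - \sum_(i < n | (i < k)%N) df i x * (z 0 i - y 0 i)| <=
    k%:R * e' * `|z - y|.
  have wn : w n = z by apply/rowP => j; rewrite mxE ltn_ord.
  have := H n (leqnn n); rewrite wn (eq_bigl (fun=> true))// => [h|i].
    apply: (le_trans h).
    rewrite ler_wpM2r// /e' mulrCA ger_pMr// ler_pdivrMr// mul1r ler_nat//.
  by rewrite ltn_ord.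
have w0 : w 0%N = y by apply/rowP => j; rewrite mxE ltn0.
elim: k => [_|k IH kn].
  by rewrite w0 subrr sub0r big_pred0// normrN normr0 !mul0r.
pose K := Ordinal kn.
have wS : w k.+1 = w k + (z 0 K - y 0 K) *: stdvec R K.
  apply/rowP => j; rewrite !mxE eqxx/= ltnS leq_eqVlt.
  have [jK|jK] := eqVneq (j : nat) k.
    have -> : j = K by apply: val_inj.
    by rewrite eqxx/= ltnn mulr1 addrC subrK.
  have -> : (j == K) = false by apply/negbTE; apply: contra jK => /eqP ->.
  by rewrite /= mulr0 addr0.
rewrite (bigD1 K)//= wS.
rewrite (eq_bigl (fun i : 'I_n => (i < k)%N)); last first.
  move=> i; rewrite ltnS ltn_neqAle andbC; congr (_ && _).
have -> : f (w k + (z 0 K - y 0 K) *: stdvec R K) - f y -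
   (df K x * (z 0 K - y 0 K) + \sum_(i < n | (i < k)%N) df i x * (z 0 i - y 0 i)) =
   (f (w k + (z 0 K - y 0 K) *: stdvec R K) - f (w k) - (z 0 K - y 0 K) * df K x) +
   (f (w k) - f y - \sum_(i < n | (i < k)%N) df i x * (z 0 i - y 0 i)).
  by ring.
apply: le_trans (ler_normD _ _) _.
rewrite (_ : k.+1%:R * e' * `|z - y| = e' * `|z - y| + k%:R * e' * `|z - y|);
  last by rewrite -natr1; ring.
apply: lerD; last exact: IH (ltnW kn).
have seg s : 0 <= s <= 1 -> `|w k + (s * (z 0 K - y 0 K)) *: stdvec R K - x| < d.
  move=> /andP[s0 s1]; apply: le_lt_trans (_ : Num.max `|y - x| `|z - x| < d); last first.
    by rewrite gt_max yd zd.
  apply: norm_le_coord => [|j]; first by rewrite le_max normr_ge0.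
  rewrite !mxE eqxx/=.
  have [->|jK] := eqVneq j K.
    rewrite /= ltnn mulr1.
    have -> : y 0 K + s * (z 0 K - y 0 K) - x 0 K =
       (1 - s) * (y - x) 0 K + s * (z - x) 0 K by rewrite !mxE; ring.
    apply: le_trans (ler_normD _ _) _; rewrite !normrM ger0_norm ?subr_ge0// (ger0_norm s0).
    have := coord_le_norm (y - x) K; have := coord_le_norm (z - x) K.
    set m := Num.max _ _ => h1 h2.
    have h3 : `|(y - x) 0 K| <= m by rewrite (le_trans h2)// /m le_max lexx.
    have h4 : `|(z - x) 0 K| <= m by rewrite (le_trans h1)// /m le_max lexx orbT.
    rewrite (_ : m = (1 - s) * m + s * m); last by ring.
    by rewrite lerD// ler_wpM2l// subr_ge0.
  rewrite /= mulr0 addr0 le_max; case: ifP => _.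
    by have := coord_le_norm (z - x) j; rewrite !mxE => ->; rewrite orbT.
  by have := coord_le_norm (y - x) j; rewrite !mxE => ->.
rewrite -[e' * _]mulrC.
apply: (@le_line R V f (w k) _ (fun s => (z 0 K - y 0 K) * df K (w k + s *: ((z 0 K - y 0 K) *: stdvec R K)))).
  move=> s s01; apply: is_derive_dirZ.
  by have [|[_ D _] _] := dP (w k + s *: ((z 0 K - y 0 K) *: stdvec R K)); [rewrite scalerA; exact: seg|].
move=> s s01; rewrite -mulrBr normrM.
have [|_ D] := dP (w k + s *: ((z 0 K - y 0 K) *: stdvec R K)); first by rewrite scalerA; exact: seg.
rewrite ler_pM//; last exact: ltW.
by have := coord_le_norm (z - y) K; rewrite !mxE.
Qed.

End strict.

Section derive_eps.
Variables (R : realType) (V : normedModType R).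
Implicit Types (f : V -> R) (x v : V).

Lemma is_derive_of_eps f x v (d : R) :
  (forall eps : R, 0 < eps -> exists2 del : R, 0 < del &
    forall h : R, `|h| < del -> `|f (x + h *: v) - f x - h * d| <= eps * `|h|) ->
  is_derive x v f d.
Proof.
move=> H.
have C : h^-1 *: (f (h *: v + x) - f x) @[h --> 0^'] --> d.
  apply/cvgrPdist_le => e e0; have [r r0 rP] := H e e0.
  near=> h.
  have h0 : h != 0 by near: h; exact: nbhs_dnbhs_neq.
  have hr : `|h| < r by near: h; exact: dnbhs0_lt.
  rewrite distrC (_ : _ - d = h^-1 * (f (x + h *: v) - f x - h * d)); last first.
    by rewrite mulrBr mulKf// [h *: v + x]addrC.
  rewrite normrM normfV mulrC ler_pdivrMr ?normr_gt0//.
  exact: rP.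
by split; [apply/cvg_ex; exists d|exact: cvg_lim].
Unshelve. all: by end_near. Qed.

Lemma eps_of_is_derive f x v (d : R) : is_derive x v f d ->
  forall eps : R, 0 < eps -> exists2 del : R, 0 < del &
    forall h : R, `|h| < del -> `|f (x + h *: v) - f x - h * d| <= eps * `|h|.
Proof.
move=> [Df Dv] e e0.
have C : h^-1 *: (f (h *: v + x) - f x) @[h --> 0^'] --> d by rewrite -Dv.
move/cvgrPdist_le : C => /(_ e e0); rewrite near_withinE => /nbhs_normP[r /= r0 rP].
exists r => // h hr; have [->|h0] := eqVneq h 0.
  by rewrite scale0r addr0 mul0r subr0 subrr normr0 mulr0.
have := rP h; rewrite /ball_/= sub0r normrN => /(_ hr h0).
rewrite distrC (_ : _ - d = h^-1 * (f (x + h *: v) - f x - h * d)); last first.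
  by rewrite mulrBr mulKf// [h *: v + x]addrC.
by rewrite normrM normfV mulrC ler_pdivrMr ?normr_gt0.
Qed.

End derive_eps.

Section C1b.
Variables (R : realType) (n : nat).
Local Notation V := 'rV[R]_n.
Implicit Types (f g : V -> R) (df dg : 'I_n -> V -> R) (x y z : V).

Lemma is_derive_dir f df x v : (\forall y \near x, C1at f df y) ->
  is_derive x v f (\sum_i df i x * v 0 i).
Proof.
move=> fC; apply: is_derive_of_eps => e e0.
have e'0 : 0 < e / (`|v| + 1) by rewrite divr_gt0// ltr_wpDl.
have [d d0 dP] := C1at_strict fC e'0.
exists (d / (`|v| + 1)) => [|h hd]; first by rewrite divr_gt0// ltr_wpDl.
have v1 : 0 < `|v| + 1 by rewrite ltr_wpDl.
have hv : `|h| * `|v| <= `|h| * (`|v| + 1) by rewrite ler_wpM2l// lerDl.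
have := dP x (x + h *: v); rewrite subrr normr0 => /(_ d0).
rewrite addrAC subrr add0r normrZ (le_lt_trans hv) -?ltr_pdivlMr// => /(_ isT).
rewrite mulr_sumr (eq_bigr (fun i => h * (df i x * v 0 i))); last first.
  by move=> i _; rewrite !mxE addrAC subrr add0r mulrCA.
move/le_trans; apply.
rewrite [leLHS](_ : _ = e * `|h| * (`|v| / (`|v| + 1))); last by ring.
rewrite ler_piMr ?mulr_ge0 ?(ltW e0)// ler_pdivrMr// mul1r lerDl//.
Qed.

Definition cutoff (b : V -> bool) f : V -> R := fun y => if b y then f y else 0.

(** Extension by zero across the boundary of b costs no regularity at a point
    where f and its gradient vanish, since |cutoff b f| <= |f|. *)
Lemma C1at_cutoff (b : V -> bool) f df x :
  [\/ (\forall y \near x, b y) /\ C1at f df x, (\forall y \near x, ~~ b y) |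
      [/\ C1at f df x, f x = 0 & forall i, df i x = 0]] ->
  C1at (cutoff b f) (fun i => cutoff b (df i)) x.
Proof.
case=> [[bx fC]|bx|[[cf Df cdf] fx dfx]].
- apply: C1at_near_eq fC => [|i]; apply: filterS bx => y;
  by rewrite /cutoff => ->.
- apply: C1at_near_eq (C1at_cst 0 x) => [|i]; apply: filterS bx => y;
  by rewrite /cutoff => /negbTE ->.
have cut0 (g : V -> R) : g x = 0 -> cutoff b g x = 0.
  by rewrite /cutoff => ->; rewrite if_same.
have cutle (g : V -> R) y : `|cutoff b g y| <= `|g y|.
  by rewrite /cutoff; case: ifP => // _; rewrite normr0.
have cutc (g : V -> R) : g x = 0 -> g y @[y --> x] --> g x ->
    cutoff b g y @[y --> x] --> cutoff b g x.
  move=> gx /cvg_rVP gc; apply/cvg_rVP => e e0.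
  have [d d0 dP] := gc e e0; exists d => // y /dP.
  rewrite cut0// gx !subr0; exact: le_lt_trans.
split=> [|i|i]; [exact: cutc| |exact: cutc].
rewrite cut0//; apply: is_derive_of_eps => e e0.
have := Df i; rewrite dfx => /eps_of_is_derive /(_ e e0)[d d0 dP].
exists d => // h /dP; rewrite cut0// fx mulr0 !subr0; exact: le_trans.
Qed.

End C1b.

(** Strict differentiability of f yields the chain rule, although K is only
    known to have partial derivatives at x. *)
Lemma C1at_comp (R : realType) (m n : nat) (f : 'rV[R]_n -> R) df
    (K : 'rV[R]_m -> 'rV[R]_n) (dK : 'I_n -> 'I_m -> 'rV[R]_m -> R) x :
  (\forall y \near K x, C1at f df y) ->
  (forall j, C1at (fun y => K y 0 j) (dK j) x) ->
  C1at (fun y => f (K y)) (fun i y => \sum_j df j (K y) * dK j i y) x.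
Proof.
move=> /[dup] fC /nbhs_singleton[cf Df cdf] KC.
have Kc : K y @[y --> x] --> K x.
  apply/cvgrPdist_lt => e e0.
  have H j : \forall y \near x, `|K x 0 j - K y 0 j| < e / 2.
    by have [/cvgrPdist_lt/(_ (e / 2))h _ _] := KC j; apply: h; rewrite divr_gt0.
  have [d d0 dP] := (nearP _ _).1 (near_all H).
  apply/nearP; exists d => // y /dP yP.
  apply: (@le_lt_trans _ _ (e / 2)); last by rewrite ltr_pdivrMr// ltr_pMr// ltr1n.
  apply: norm_le_coord => [|j]; first by rewrite divr_ge0// ltW.
  by rewrite !mxE ltW.
split=> [|i|i].
- exact: (cvg_comp _ _ Kc cf).
- apply: is_derive_of_eps => e e0.
  pose C := 1 + \sum_j `|dK j i x|.
  have C0 : 0 < C by rewrite ltr_wpDr// sumr_ge0.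
  have C1 : 0 < 1 + \sum_j `|df j (K x)| by rewrite ltr_wpDr// sumr_ge0.
  pose e1 := e / 2 / C; have e10 : 0 < e1 by rewrite !divr_gt0.
  have [d d0 dP] := C1at_strict fC e10.
  pose e2 := Num.min 1 (e / 2 / (1 + \sum_j `|df j (K x)|)).
  have e20 : 0 < e2 by rewrite lt_min ltr01 !divr_gt0.
  have H j : \forall h \near (0 : R), `|K (x + h *: stdvec R i) 0 j - K x 0 j - h * dK j i x| <= e2 * `|h|.
    have [_ D _] := KC j; have [r r0 rP] := eps_of_is_derive (D i) e20.
    by apply/nbhs_normP; exists r => // h /=; rewrite /ball_/= sub0r normrN; exact: rP.
  have /nbhs_normP[r /= r0 rP] : \forall h \near (0 : R), forall j,
      `|K (x + h *: stdvec R i) 0 j - K x 0 j - h * dK j i x| <= e2 * `|h|.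
    by exact: filter_forall H.
  have rP' h : `|h| < r -> forall j, `|K (x + h *: stdvec R i) 0 j - K x 0 j - h * dK j i x| <= e2 * `|h|.
    by move=> hr; apply: rP; rewrite /ball_/= sub0r normrN.
  have KL h : `|h| < r -> `|K (x + h *: stdvec R i) - K x| <= C * `|h|.
    move=> hr; apply: norm_le_coord => [|j]; first by rewrite mulr_ge0// ltW.
    rewrite !mxE; have := rP' h hr j => h1.
    rewrite -(subrK (h * dK j i x) (K _ 0 j - _)) (le_trans (ler_normD _ _))//.
    rewrite /C mulrDl lerD//; first by rewrite (le_trans h1)// ler_wpM2r// /e2 ge_min lexx.
    rewrite normrM mulrC ler_wpM2r// (bigD1 j)//= lerDl sumr_ge0//.
  exists (Num.min r (d / C)) => [|h]; first by rewrite lt_min r0 divr_gt0.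
  rewrite lt_min => /andP[hr hd].
  have Kd : `|K (x + h *: stdvec R i) - K x| < d.
    by rewrite (le_lt_trans (KL h hr))// mulrC -ltr_pdivlMr.
  have := dP (K x) (K (x + h *: stdvec R i)); rewrite subrr normr0 => /(_ d0 Kd) h1.
  set S := (\sum_j _) in h1.
  rewrite (_ : f _ - f (K x) - _ = (f (K (x + h *: stdvec R i)) - f (K x) - S) +
     \sum_j df j (K x) * (K (x + h *: stdvec R i) 0 j - K x 0 j - h * dK j i x)); last first.
    have -> : \sum_j df j (K x) * (K (x + h *: stdvec R i) 0 j - K x 0 j - h * dK j i x) =
        S - h * \sum_j df j (K x) * dK j i x.
      by rewrite mulr_sumr -sumrB; apply: eq_bigr => j _; ring.
    by ring.
  apply: le_trans (ler_normD _ _) _.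
  rewrite (_ : e * `|h| = e / 2 * `|h| + e / 2 * `|h|); last by field.
  apply: lerD.
    apply: (le_trans h1); rewrite -ler_pdivlMl//.
    apply: (le_trans (KL h hr)).
    by rewrite [leRHS](_ : _ = C * `|h|)// /e1; field; rewrite !gt_eqF.
  apply: (le_trans (ler_norm_sum _ _ _)).
  apply: (@le_trans _ _ (\sum_j `|df j (K x)| * (e2 * `|h|))).
    by apply: ler_sum => j _; rewrite normrM ler_wpM2l// rP'.
  rewrite -mulr_suml mulrA ler_wpM2r//.
  rewrite (@le_trans _ _ ((1 + \sum_j `|df j (K x)|) * e2))//.
    by rewrite ler_wpM2r ?lerDr// ltW.
  by rewrite mulrC -ler_pdivlMr// /e2 ge_min lexx orbT.
- apply: cvg_sum_rV => j; apply: cvgM; last by have [] := KC j.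
  exact: (cvg_comp _ _ Kc (cdf j)).
Qed.

(** * Second derivatives and local maxima *)

Section schwarz.
Variables (R : realType) (n : nat).
Local Notation V := 'rV[R]_n.
Implicit Types (f g : V -> R) (df dg : 'I_n -> V -> R) (x y z : V).

Lemma is_derive_translate f (a z v : V) (d : R) :
  is_derive (z + a) v f d -> is_derive z v (fun y => f (y + a)) d.
Proof.
move=> D; apply: line_is_derive.
rewrite (_ : (fun s : R => _) = (fun s : R => f ((z + a) + s *: v))).
  by apply: is_derive_line; rewrite scale0r addr0.
by apply/funext => s; rewrite addrAC.
Qed.

Lemma stdvec_norm i : `|stdvec R i : V| <= 1.
Proof.
apply: norm_le_coord => // j; rewrite !mxE eqxx/=.
by case: eqP => _; rewrite ?normr1 ?normr0.
Qed.

(** The mean value inequality along the i-th direction; the symmetry of the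
    second difference then makes the second derivatives symmetric. *)
Lemma second_difference f df ddf x i j :
  (\forall y \near x, C1at f df y) ->
  (forall i, \forall y \near x, C1at (df i) (ddf i) y) ->
  forall eps : R, 0 < eps -> exists2 d : R, 0 < d & forall h : R, 0 <= h < d ->
    `|f (x + h *: stdvec R i + h *: stdvec R j) - f (x + h *: stdvec R i)
      - (f (x + h *: stdvec R j) - f x) - h * (h * ddf i j x)| <= eps * h ^+ 2.
Proof.
move=> fC dfC e e0.
have [d d0 dP] := C1at_strict (dfC i) e0.
have [d' d'0 d'P] := (nearP _ _).1 fC.
pose m := Num.min d d'; have m0 : 0 < m by rewrite lt_min d0.
exists (m / 2) => [|h /andP[h0 hm]]; first by rewrite divr_gt0.
pose g y := f (y + h *: stdvec R j) - f y.
pose dg (s : R) := h * (df i (x + s *: (h *: stdvec R i) + h *: stdvec R j)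
                - df i (x + s *: (h *: stdvec R i))).
have se (s : R) k : 0 <= s <= 1 -> `|s *: (h *: stdvec R k) : V| <= h.
  move=> /andP[s0 s1]; rewrite !normrZ (ger0_norm s0) (ger0_norm h0).
  rewrite -[leRHS]mul1r ler_pM ?mulr_ge0// -[leRHS]mulr1 ler_wpM2l//.
  exact: stdvec_norm.
have h01 : 0 <= (1 : R) <= 1.
  by rewrite ler01 lexx.
have B1 (s : R) : 0 <= s <= 1 -> `|x + s *: (h *: stdvec R i) - x| < m.
  move=> s01; rewrite addrAC subrr add0r (le_lt_trans (se _ _ s01))//.
  by rewrite (lt_trans hm)// ltr_pdivrMr// ltr_pMr// ltr1n.
have B2 (s : R) : 0 <= s <= 1 ->
    `|x + s *: (h *: stdvec R i) + h *: stdvec R j - x| < m.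
  move=> s01.
  rewrite -(addrA x) [x + _]addrC addrK (le_lt_trans (ler_normD _ _))//.
  rewrite (_ : m = m / 2 + m / 2); last by field.
  rewrite ltrD//; first exact: le_lt_trans (se _ _ s01) hm.
  by have := se 1 j h01; rewrite scale1r => h2; exact: le_lt_trans hm.
have md : forall t, t < m -> t < d by move=> t; rewrite lt_min => /andP[].
have md' : forall t, t < m -> t < d' by move=> t; rewrite lt_min => /andP[].
apply: (@le_line R _ g x (h *: stdvec R i) dg).
  move=> s s01; apply: is_derive_dirZ; apply: is_deriveB.
    apply: is_derive_translate.
    by have [_ D _] := d'P _ (md' _ (B2 s s01)); exact: D.
  by have [_ D _] := d'P _ (md' _ (B1 s s01)); exact: D.
move=> s s01; rewrite /dg -mulrBr normrM (ger0_norm h0).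
have := dP _ _ (md _ (B1 s s01)) (md _ (B2 s s01)).
rewrite (bigD1 j)//= big1 ?addr0 => [|k kj]; last first.
  by rewrite !mxE eqxx/= (negbTE kj) !mulr0 addr0 subrr mulr0.
rewrite !mxE !eqxx/= mulr1 [X in ddf i j x * X](_ : _ = h); last by ring.
rewrite (addrAC _ (h *: stdvec R j)) subrr add0r mulrC => H1.
rewrite [leRHS](_ : _ = h * (e * h)); last by ring.
rewrite ler_wpM2l// (le_trans H1)// ler_wpM2l ?(ltW e0)//.
by have := se 1 j h01; rewrite scale1r.
Qed.

Lemma C2_sym f df ddf x :
  (\forall y \near x, C1at f df y) ->
  (forall i, \forall y \near x, C1at (df i) (ddf i) y) ->
  forall i j, ddf i j x = ddf j i x.
Proof.
move=> fC dfC i j; apply/eqP; rewrite -subr_eq0; apply/eqP.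
apply/eqP; rewrite -normr_le0; apply/ler_addgt0Pr => e e0; rewrite add0r.
have e2 : 0 < e / 2 by rewrite divr_gt0.
have [d d0 dP] := second_difference i j fC dfC e2.
have [d' d'0 d'P] := second_difference j i fC dfC e2.
pose m := Num.min d d'; have m0 : 0 < m by rewrite lt_min d0.
pose h := m / 2; have h0 : 0 < h by rewrite divr_gt0.
have hm : h < m by rewrite ltr_pdivrMr// ltr_pMr// ltr1n.
have := dP h; have := d'P h.
move: hm; rewrite (ltW h0)/= lt_min => /andP[-> ->] /(_ isT) H1 /(_ isT) H2.
rewrite -(ler_pM2l (exprn_gt0 2 h0)) -{1}(ger0_norm (ltW (exprn_gt0 2 h0))) -normrM.
set a := f _ - _ - _ - _ in H1; set b := f _ - _ - _ - _ in H2.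
rewrite (_ : h ^+ 2 * _ = a - b); last first.
  by rewrite /a /b (addrAC x); ring.
apply: (le_trans (ler_normB _ _)).
by rewrite (_ : h ^+ 2 * e = e / 2 * h ^+ 2 + e / 2 * h ^+ 2) ?lerD//; field.
Qed.

End schwarz.

Section localmax.
Variables (R : realType) (n : nat).
Local Notation V := 'rV[R]_n.
Implicit Types (f g : V -> R) (df dg : 'I_n -> V -> R) (x y z : V).

Lemma local_max_grad f df x : (\forall y \near x, f y <= f x) ->
  C1at f df x -> forall i, df i x = 0.
Proof.
move=> fx [_ D _] i; apply/eqP/negP => /negP dn0.
have d0 : 0 < `|df i x| / 2 by rewrite divr_gt0 ?normr_gt0.
have [r r0 rP] := eps_of_is_derive (D i) d0.
have [r' r'0 r'P] := (nearP _ _).1 fx.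
pose m := Num.min r r'; have m0 : 0 < m by rewrite lt_min r0.
pose h := Num.sg (df i x) * (m / 2).
have hn : `|h| = m / 2 by rewrite normrM normr_sg dn0 mul1r ger0_norm// divr_ge0// ltW.
have hm : `|h| < m by rewrite hn ltr_pdivrMr// ltr_pMr// ltr1n.
move: hm; rewrite lt_min => /andP[/rP H hr'].
have := r'P (x + h *: stdvec R i).
rewrite addrAC subrr add0r normrZ (le_lt_trans _ hr'); last first.
  by rewrite -[leRHS]mulr1 ler_wpM2l// stdvec_norm.
move=> /(_ isT) le0.
have hd : h * df i x = `|df i x| * (m / 2) by rewrite /h normrEsg; ring.
have : 0 < `|df i x| * (m / 2) by rewrite mulr_gt0 ?normr_gt0// divr_gt0.
move: H; rewrite hn hd => /ler_normlP[]; move: le0.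
move: (f _) (f _) => a b; move: `|df i x| (m / 2) => u v.
by move=> *; lra.
Qed.

(** With q the second derivative along b, the first derivative at distance c is
    c q + o(c), and the mean value theorem makes it nonpositive for some
    arbitrarily small c. *)
Lemma local_max_hess f df ddf x : (\forall y \near x, f y <= f x) ->
  (\forall y \near x, C1at f df y) ->
  (forall i, \forall y \near x, C1at (df i) (ddf i) y) ->
  forall b : 'I_n -> R, \sum_i \sum_j b i * b j * ddf i j x <= 0.
Proof.
move=> fx fC dfC b; rewrite leNgt; apply/negP => q0.
set q := \sum_i _ in q0.
have g0 := local_max_grad fx (nbhs_singleton fC).
pose B : V := \row_i b i.
pose e := q / 2 / ((1 + \sum_i `|b i|) * (`|B| + 1)).
have S0 : 0 < 1 + \sum_i `|b i| by rewrite ltr_wpDr// sumr_ge0.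
have B0 : 0 < `|B| + 1 by rewrite ltr_wpDl.
have e0 : 0 < e by rewrite !divr_gt0// mulr_gt0.
have H i : exists2 d : R, 0 < d & forall y z, `|y - x| < d -> `|z - x| < d ->
    `|df i z - df i y - \sum_j ddf i j x * (z 0 j - y 0 j)| <= e * `|z - y|.
  exact: C1at_strict (dfC i) _ e0.
have H2 i : \forall y \near x,
    `|df i y - df i x - \sum_j ddf i j x * (y 0 j - x 0 j)| <= e * `|y - x|.
  have [d d0 dP] := H i; apply/nearP; exists d => // y yd; apply: dP => //.
  by rewrite subrr normr0.
have [d d0 dP] : exists2 d : R, 0 < d & forall y, `|y - x| < d ->
    [/\ f y <= f x, C1at f df y, (\forall y \near y, C1at f df y) & forall i,
    `|df i y - df i x - \sum_j ddf i j x * (y 0 j - x 0 j)| <= e * `|y - x|].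
  apply/nearP; have := near_all H2; have := near_join fC.
  move: fx fC; near_simpl => h1 h2 h3 h4.
  by near=> y; split; near: y.
pose h := d / 2 / (`|B| + 1); have h0 : 0 < h by rewrite !divr_gt0.
have hB (s : R) : 0 <= s <= h -> `|x + s *: B - x| < d.
  move=> /andP[s0 sh]; rewrite addrAC subrr add0r normrZ (ger0_norm s0).
  apply: (@le_lt_trans _ _ (d / 2)); last by rewrite ltr_pdivrMr// ltr_pMr// ltr1n.
  apply: (@le_trans _ _ (h * (`|B| + 1))); last by rewrite /h divfK// gt_eqF.
  by rewrite ler_pM// lerDl.
pose p (s : R) := f (x + s *: B).
pose dp (s : R) := \sum_i df i (x + s *: B) * B 0 i.
have Dp (s : R) : 0 <= s <= h -> is_derive s (1 : R) p (dp s).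
  move=> sh; apply: is_derive_line; apply: is_derive_dir.
  by have [] := dP _ (hB s sh).
have cp : {within `[0, h], continuous p}.
  by apply: derivable_within_continuous => s; rewrite in_itv/= => /Dp[].
have Dp' (s : R) : s \in `]0, h[ -> is_derive s (1 : R) p (dp s).
  by rewrite in_itv/= => /andP[s0 sh]; apply: Dp; rewrite !ltW.
have [c] := MVT h0 Dp' cp.
rewrite in_itv/= => /andP[c0 ch] E.
have ch' : 0 <= c <= h by rewrite !ltW.
have [_ _ _ dfc] := dP _ (hB c ch').
have : dp c <= 0.
  have h0' : 0 <= h <= h by rewrite lexx ltW.
  have [ph _ _ _] := dP _ (hB h h0').
  by rewrite -(pmulr_lle0 _ (_ : 0 < h - 0)) ?subr0// -(subr0 h) -E subr_le0 /p scale0r addr0.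
apply/negP; rewrite -ltNge.
have Ec : dp c = c * q + \sum_i b i * (df i (x + c *: B) - df i x -
    \sum_j ddf i j x * ((x + c *: B) 0 j - x 0 j)).
  rewrite /dp /q mulr_sumr -big_split/=; apply: eq_bigr => i _.
  have -> : \sum_j b i * b j * ddf i j x = b i * \sum_j b j * ddf i j x.
    by rewrite mulr_sumr; apply: eq_bigr => j _; ring.
  have -> : \sum_j ddf i j x * ((x + c *: B) 0 j - x 0 j) =
      c * \sum_j b j * ddf i j x.
    by rewrite mulr_sumr; apply: eq_bigr => j _; rewrite !mxE; ring.
  by rewrite g0 subr0 !mxE; ring.
rewrite Ec -[X in _ + X]opprK subr_gt0.
apply: (@le_lt_trans _ _ (c * (q / 2))); last first.
  by rewrite ltr_pM2l// ltr_pdivrMr// ltr_pMr// ltr1n.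
apply: (le_trans (ler_norm _)); rewrite normrN; apply: (le_trans (ler_norm_sum _ _ _)).
apply: (@le_trans _ _ (\sum_i `|b i| * (e * (c * `|B|)))).
  apply: ler_sum => i _; rewrite normrM ler_wpM2l//; apply: (le_trans (dfc i)).
  by rewrite addrAC subrr add0r normrZ (gtr0_norm c0).
rewrite -mulr_suml (_ : c * (q / 2) = (1 + \sum_i `|b i|) * (e * (c * (`|B| + 1)))); last first.
  by rewrite /e; field; rewrite !gt_eqF.
have hS : 0 <= \sum_i `|b i| by rewrite sumr_ge0.
have hX : e * (c * `|B|) <= e * (c * (`|B| + 1)).
  by rewrite ler_wpM2l ?(ltW e0)// ler_wpM2l ?(ltW c0)// lerDl.
have hX0 : 0 <= e * (c * `|B|) by apply: mulr_ge0; [exact: ltW|apply: mulr_ge0 => //; exact: ltW].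
by apply: ler_pM => //; rewrite lerDr.
Unshelve. all: by end_near. Qed.

End localmax.

(** * Riemann sums of compactly supported functions *)

Section grid.
Variables (R : realType) (n : nat).
Local Notation V := 'rV[R]_n.
Implicit Types (f g : V -> R) (df dg : 'I_n -> V -> R) (x y z : V).

(** The radius 1/2 keeps the support away from the faces of the cube [-1, 1]^n
    over which the Riemann sums are taken. *)
Definition supported f := forall x, 1 / 2 <= `|x| -> f x = 0.

Lemma compact_cball x (c : R) : compact [set y : V | `|y - x| <= c].
Proof.
apply: bounded_closed_compact.
  exists (c + `|x|); split; [exact: num_real|move=> M M1 y /= yc].
  by rewrite -(subrK x y) (le_trans (ler_normD _ _))// ltW// (le_lt_trans _ M1)// lerD2r.
rewrite (_ : mkset _ = (fun y : V => `|y - x|) @^-1` [set r | r <= c])//.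
apply: closed_comp; last exact: closed_le.
move=> y _; apply/cvgrPdist_lt => e e0; apply/nearP; exists e => // z zy.
rewrite (le_lt_trans (ler_dist_dist _ _))// (_ : _ - _ = y - z) 1?distrC//.
by rewrite opprB addrA subrK.
Qed.

(** Heine-Cantor on the unit ball; outside, g vanishes. *)
Lemma supported_unif_cont g : supported g ->
  (forall x, g y @[y --> x] --> g x) ->
  forall eps : R, 0 < eps -> exists2 d : R, 0 < d &
    forall x y, `|y - x| < d -> `|g y - g x| <= eps.
Proof.
move=> sg cg e e0.
have e2 : 0 < e / 2 by rewrite divr_gt0.
have cK : compact [set x : V | `|x - 0| <= 1] by exact: compact_cball.
pose P (d : R) x := forall y, `|y - x| < d -> `|g y - g x| <= e.
have := (compact_near_coveringP _).1 cK R (0^'+) P _.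
have HP x : [set x : V | `|x - 0| <= 1] x -> \forall x' \near x & d \near 0^'+, P d x'.
  move=> _; have [r r0 rP] := (cvg_rVP _ _).1 (cg x) _ e2.
  have r2 : 0 < r / 2 by rewrite divr_gt0.
  exists (ball x (r / 2), [set d | d < r / 2]) => /=.
    by split; [exact: nbhsx_ballx|exact: nbhs_right_lt].
  move=> [x' d] /= [xx' dr] y yx'.
  have x'r : `|x' - x| < r / 2 by move: xx'; rewrite -ball_normE/= distrC.
  have yr : `|y - x| < r.
    rewrite -(subrKA x') (le_lt_trans (ler_normD _ _))//.
    rewrite (_ : r = r / 2 + r / 2) ?ltrD//; last by field.
    exact: lt_trans dr.
  rewrite -(subrKA (g x)) (le_trans (ler_normD _ _))//.
  rewrite (_ : e = e / 2 + e / 2) ?lerD//; last by field.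
    exact/ltW/rP.
  rewrite distrC; apply/ltW/rP/(lt_trans x'r).
  by rewrite ltr_pdivrMr// ltr_pMr// ltr1n.
move=> /(_ _ HP).
move=> H.
have {}H : \forall d \near 0^'+, [set x : V | `|x - 0| <= 1] `<=` P d by exact: H.
have [d [d0 [d2 dP]]] : exists d : R, 0 < d /\ d < 1 / 2 /\ [set x : V | `|x - 0| <= 1] `<=` P d.
  near (0 : R)^'+ => d; exists d; split; first by near: d; exact: nbhs_right_gt.
  split; first by near: d; apply: nbhs_right_lt.
  by near: d.
exists d => // x y xy; have [x1|x1] := leP `|x| 1; first by apply: dP; rewrite /= ?subr0.
have x2 : 1 / 2 <= `|x| by lra.
have y2 : 1 / 2 <= `|y|.
  by have := ler_normD y (x - y); rewrite addrC subrK distrC; lra.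
by rewrite !sg// subrr normr0 ltW.
Unshelve. all: by end_near. Qed.

Definition gpt (m : nat) (k : {ffun 'I_n -> 'I_(m.+1.*2).+1}) : V :=
  \row_i ((k i)%:R / m.+1%:R - 1).

(** A Riemann sum over the grid of mesh 1/(m+1) in the cube [-1, 1]^n; these
    sums play the role of the Lebesgue integral below. *)
Definition gsum (m : nat) f : R := m.+1%:R ^- n * \sum_k f (@gpt m k).

Lemma gsumD m f g : gsum m (fun x => f x + g x) = gsum m f + gsum m g.
Proof. by rewrite /gsum -mulrDr -big_split. Qed.

Lemma gsum_sum m (F : 'I_n -> V -> R) :
  gsum m (fun x => \sum_i F i x) = \sum_i gsum m (F i).
Proof. by rewrite /gsum -mulr_sumr exchange_big. Qed.

Lemma le_gsum m f g : (forall x, f x <= g x) -> gsum m f <= gsum m g.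
Proof.
by move=> fg; rewrite ler_wpM2l ?invr_ge0 ?exprn_ge0//; apply: ler_sum.
Qed.

Lemma gsum_cst m (c : R) : 0 <= c -> gsum m (fun=> c) <= 3 ^+ n * c.
Proof.
move=> c0; rewrite /gsum sumr_const card_ffun !card_ord -[c *+ _]mulr_natl mulrA.
rewrite ler_wpM2r// natrX -exprVn -exprMn lerXn2r ?nnegrE ?mulr_ge0 ?invr_ge0//.
rewrite mulrC ler_pdivrMr// -natrM ler_nat.
by rewrite -mul2n -addn1 (mulnDl 2 1) leq_add2l mul1n.
Qed.

(** Translation by a grid step is a cyclic permutation of the grid, up to the
    points that wrap around, where f vanishes. *)
Lemma gsum_telescope m f i : supported f ->
  \sum_k f (@gpt m k + m.+1%:R^-1 *: stdvec R i) = \sum_k f (@gpt m k).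
Proof.
move=> sf.
pose s (k : {ffun 'I_n -> 'I_(m.+1.*2).+1}) :=
  [ffun j => if j == i then ordS (k j) else k j].
have sI : injective s.
  move=> k l /ffunP kl; apply/ffunP => j; have := kl j; rewrite !ffunE.
  by case: ifP => // _ /ordS_inj.
rewrite [RHS](reindex_inj sI)/=; apply: eq_bigr => k _.
have far x : 1 <= `|x 0 i| -> f x = 0.
  move=> xi; apply: sf; rewrite (le_trans _ (coord_le_norm x i))// (le_trans _ xi)//.
  by lra.
have [ki|ki] := eqVneq (k i : nat) m.+1.*2.
  rewrite !far//.
    rewrite !mxE ffunE eqxx /= ki modnn mul0r sub0r normrN normr1//.
  rewrite !mxE !eqxx/= mulr1 ki.
  have -> : (m.+1.*2)%:R / m.+1%:R - 1 + m.+1%:R^-1 = 1 + m.+1%:R^-1 :> R.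
    by rewrite -mul2n natrM mulfK ?pnatr_eq0//; ring.
  by rewrite ger0_norm ?addr_ge0// lerDl.
congr f; apply/rowP => j; rewrite !mxE ffunE eqxx/=.
have [->|ji] := eqVneq j i; last by rewrite mulr0 addr0.
have kn : (k i < m.+1.*2)%N by rewrite ltn_neqAle ki -ltnS ltn_ord.
by rewrite /= modn_small ?ltnS// -natr1 mulr1; ring.
Qed.

(** The difference quotients telescope over the grid and converge uniformly to
    the derivative. This is the integration by parts of the Carleman
    estimate. *)
Lemma gsum_derive f df i : supported f -> (forall i, supported (df i)) ->
  (forall x, C1at f df x) ->
  forall eps : R, 0 < eps -> exists m0 : nat, forall m, (m0 <= m)%N ->
    `|gsum m (df i)| <= eps.
Proof.
move=> sf sdf fC e e0.
have n3 : 0 < (3 : R) ^+ n by rewrite exprn_gt0.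
have e'0 : 0 < e / 3 ^+ n by rewrite divr_gt0.
have cdf x : df i y @[y --> x] --> df i x by have [] := fC x.
have [d d0 dP] := supported_unif_cont (sdf i) cdf e'0.
exists (Num.truncn d^-1) => m mm.
have m1 : (0 : R) < m.+1%:R by [].
pose h : R := m.+1%:R^-1; have h0 : 0 < h by rewrite invr_gt0.
have hd : h < d.
  rewrite /h invf_plt ?posrE//; rewrite -truncn_lt_nat ?invr_ge0 ?ltW// ltnS.
have key x : `|h^-1 * (f (x + h *: stdvec R i) - f x) - df i x| <= e / 3 ^+ n.
  rewrite (_ : _ - df i x = h^-1 * (f (x + h *: stdvec R i) - f x - h * df i x)); last first.
    by rewrite [RHS]mulrBr mulKf// gt_eqF.
  rewrite normrM gtr0_norm ?invr_gt0// ler_pdivrMl//.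
  apply: (@le_line R _ f x (h *: stdvec R i) (fun s => h * df i (x + s *: (h *: stdvec R i)))).
    by move=> s _; apply: is_derive_dirZ; have [_ D _] := fC (x + s *: (h *: stdvec R i)).
  move=> s /andP[s0 s1]; rewrite -mulrBr normrM gtr0_norm// ler_wpM2l ?(ltW h0)//.
  apply: dP; rewrite addrAC subrr add0r (le_lt_trans _ hd)// !normrZ (ger0_norm s0) (gtr0_norm h0).
  have := stdvec_norm R i; move: (`|stdvec R i : V|) (normr_ge0 (stdvec R i : V)) => u u0 u1.
  by rewrite mulrCA ler_piMr ?(ltW h0)// mulr_ile1.
have E : gsum m (df i) = - gsum m (fun x => h^-1 * (f (x + h *: stdvec R i) - f x) - df i x).
  rewrite /gsum sumrB -mulr_sumr sumrB gsum_telescope// subrr mulr0 sub0r.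
  by rewrite mulrN opprK.
rewrite E normrN; apply: (@le_trans _ _ (gsum m (fun=> e / 3 ^+ n))).
  rewrite /gsum normrM ger0_norm ?invr_ge0 ?exprn_ge0// ler_wpM2l ?invr_ge0 ?exprn_ge0//.
  by apply: (le_trans (ler_norm_sum _ _ _)); apply: ler_sum.
apply: (le_trans (gsum_cst _ (ltW e'0))).
by rewrite mulrC divfK// gt_eqF.
Qed.

Lemma grid_line (m : nat) (a rho : R) : `|a| <= 1 / 2 -> 0 < rho <= 1 / 2 ->
  1 <= m.+1%:R * rho ->
  m.+1%:R * rho <= \sum_(j < m.+1.*2.+1) ((`|j%:R / m.+1%:R - 1 - a : R| <= rho)%R : bool)%:R.
Proof.
move=> /ler_normlP[a1 a2] /andP[r0 r1] mr.
set M : R := m.+1%:R in mr *; have M0 : 0 < M by rewrite ltr0n.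
pose b := M * (1 + a - rho); have b0 : 0 <= b by rewrite mulr_ge0 ?(ltW M0)//; lra.
pose q := Num.truncn (M * rho); pose k0 := (Num.truncn b).+1.
have /andP[q1 q2] := truncn_itv (ltW (lt_le_trans ltr01 mr)).
have /andP[kb1 kb2] := truncn_itv b0.
have kj (j : 'I_q.+1) : b <= (k0 + j)%:R <= b + 2 * (M * rho).
  have jq : (j%:R : R) <= q%:R by rewrite ler_nat -ltnS ltn_ord.
  have j0 : (0 : R) <= j%:R by [].
  rewrite natrD /k0 -[_.+1]addn1 natrD; move: kb1 kb2 q1 jq; rewrite -natr1.
  by rewrite -/q; lra.
have kj' (j : 'I_q.+1) : (k0 + j < m.+1.*2.+1)%N.
  rewrite ltnS -(@ler_nat R) -mul2n natrM -/M.
  have /andP[_ /le_trans] := kj j; apply; rewrite /b.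
  by nra.
pose g (j : 'I_q.+1) := Ordinal (kj' j).
have gI : injective g by move=> i j /(congr1 val) /= /addnI /val_inj.
apply: (@le_trans _ _ (q.+1)%:R); first exact: ltW.
rewrite -natr_sum ler_nat.
pose P := [pred j : 'I_(m.+1.*2).+1 | `|j%:R / M - 1 - a : R| <= rho].
rewrite (_ : (\sum_(j < _) _)%N = #|P|); last first.
  rewrite -sum1_card [RHS]big_mkcond; apply: eq_bigr => j _.
  by rewrite /P inE; case: ifP.
rewrite -[leqLHS]card_ord -(card_codom gI); apply: subset_leq_card.
apply/fintype.subsetP => _ /codomP[j ->]; rewrite inE /=.
have /andP[h1 h2] := kj j.
have E : (k0 + j)%:R = M * ((k0 + j)%:R / M) by rewrite mulrC divfK// gt_eqF.
rewrite E in h1 h2; rewrite ler_norml; move: ((k0 + j)%:R / M) h1 h2 => t.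
rewrite /b => h1 h2; apply/andP; split; rewrite -(ler_pM2l M0); lra.
Qed.

(** The ball of radius rho contains at least ((m + 1) rho)^n grid points. *)
Lemma gsum_lower m f a (rho c : R) : `|a : V| <= 1 / 2 -> 0 < rho <= 1 / 2 ->
  1 <= m.+1%:R * rho -> 0 <= c -> (forall x, 0 <= f x) ->
  (forall x, `|x - a| <= rho -> c <= f x) -> c * rho ^+ n <= gsum m f.
Proof.
move=> a1 r1 mr c0 f0 fc.
pose F (i : 'I_n) (j : 'I_(m.+1.*2).+1) : R := ((`|j%:R / m.+1%:R - 1 - a 0 i : R| <= rho)%R : bool)%:R.
have M0 : (0 : R) < m.+1%:R by [].
have E : c * \sum_(k : {ffun 'I_n -> 'I_(m.+1.*2).+1}) \prod_i F i (k i) <=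
    \sum_k f (@gpt m k).
  rewrite mulr_sumr; apply: ler_sum => k _.
  have [H|] := boolP [forall i, (`|(k i)%:R / m.+1%:R - 1 - a 0 i : R| <= rho)%R].
    rewrite big1 ?mulr1 => [|i _]; last by rewrite /F (forallP H).
    apply: fc; apply: norm_le_coord => [|i]; first by case/andP: r1 => /ltW.
    by rewrite !mxE; exact: (forallP H).
  rewrite negb_forall => /existsP[i iP].
  by rewrite (bigD1 i)//= /F (negbTE iP) mul0r mulr0.
rewrite /gsum; apply: (le_trans _ (ler_wpM2l _ E)); last by rewrite invr_ge0 exprn_ge0.
rewrite mulrCA ler_wpM2l// -bigA_distr_bigA -exprVn.
rewrite (_ : m.+1%:R^-1 ^+ n = \prod_(i < n) m.+1%:R^-1); last first.
  by rewrite prodr_const card_ord.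
rewrite -big_split/= (_ : rho ^+ n = \prod_(i < n) rho); last first.
  by rewrite prodr_const card_ord.
apply: ler_prod => i _; case/andP: (r1) => r0 _; rewrite (ltW r0)/=.
rewrite ler_pdivlMl//; apply: grid_line => //.
exact: le_trans (coord_le_norm a i) a1.
Qed.

End grid.

(** * A Carleman estimate *)

Lemma C1at_sumT (R : realType) n (I : finType) (F : I -> 'rV[R]_n -> R)
    (dF : I -> 'I_n -> 'rV[R]_n -> R) x :
  (forall k, C1at (F k) (dF k) x) ->
  C1at (fun x => \sum_k F k x) (fun i x => \sum_k dF k i x) x.
Proof. by move=> H; apply: C1at_sum. Qed.

Section carleman.
Variables (R : realType) (n : nat) (e : 'rV[R]_n) (B : R).
Hypothesis e1 : \sum_i e 0 i ^+ 2 = 1.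
Local Notation V := 'rV[R]_n.
Implicit Types (x : V).

Definition height x : R := \sum_i e 0 i * x 0 i.

(** With h the coordinate along e this is (h - B)^2 / 2 - |x - h e|^2 / 4:
    convex along e, with gradient - B e at the origin, and concave in the
    orthogonal directions. *)
Definition weight x : R :=
  (height x - B) ^+ 2 / 2 - ((\sum_i x 0 i ^+ 2) - height x ^+ 2) / 4.

Definition dweight (i : 'I_n) x : R := (3 / 2 * height x - B) * e 0 i - x 0 i / 2.

Definition ddweight (i j : 'I_n) : R := 3 / 2 * e 0 j * e 0 i - (j == i)%:R / 2.

Lemma sum_delta (F : 'I_n -> R) i : \sum_j (i == j)%:R * F j = F i.
Proof.
rewrite (bigD1 i)//= eqxx mul1r big1 ?addr0// => j.
by rewrite eq_sym => /negbTE ->; rewrite mul0r.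
Qed.

Lemma C1at_height x : C1at height (fun i _ => e 0 i) x.
Proof.
apply: C1at_ext (C1at_sumT (fun (j : 'I_n) => C1atZ (e 0 j) (C1at_coord j x))) => //.
move=> i y /=; rewrite -[RHS](sum_delta (fun j => e 0 j)).
by apply: eq_bigr => j _; rewrite mulrC.
Qed.

Lemma C1at_weight x : C1at weight dweight x.
Proof.
have hC := C1at_height x.
have sC : C1at (fun x : V => \sum_i x 0 i ^+ 2) (fun i x => 2 * x 0 i) x.
  apply: C1at_ext (C1at_sumT (fun (j : 'I_n) => C1atM (C1at_coord j x) (C1at_coord j x))) => [y|i y] /=.
    by apply: eq_bigr => j _; rewrite expr2.
  rewrite -(sum_delta (fun j => 2 * y 0 j)).
  by apply: eq_bigr => j _; ring.
have hB := C1atB hC (C1at_cst B x).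
have wC := C1atB (C1atZ (1 / 2) (C1atM hB hB)) (C1atZ (1 / 4) (C1atB sC (C1atM hC hC))).
apply: C1at_ext wC => [y|i y] /=; first by rewrite /weight; field.
by rewrite /dweight; field.
Qed.

Lemma C1at_dweight i x : C1at (dweight i) (fun j _ => ddweight i j) x.
Proof.
have hC := C1at_height x.
have wC := C1atB (C1atM (C1atB (C1atZ (3 / 2) hC) (C1at_cst B x)) (C1at_cst (e 0 i) x))
  (C1atZ (1 / 2) (C1at_coord i x)).
apply: C1at_ext wC => [y|j y] /=; first by rewrite /dweight; field.
by rewrite /ddweight; field.
Qed.

Definition qweight x : R := \sum_i dweight i x ^+ 2.

(** The quadratic form 4 D^2 w (Dw, Dw) - 3 |Dw|^2, whose positivity on the
    support makes the zero order term of the Carleman inequality positive. *)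
Definition pweight x : R :=
  6 * (\sum_i e 0 i * dweight i x) ^+ 2 - 5 * qweight x.

Lemma C1at_qweight x :
  C1at qweight (fun i x => \sum_j 2 * dweight j x * ddweight j i) x.
Proof.
apply: C1at_ext (C1at_sumT (fun (j : 'I_n) =>
   C1atM (C1at_dweight j x) (C1at_dweight j x))) => [y|i y] /=.
  by apply: eq_bigr => j _; rewrite expr2.
by apply: eq_bigr => j _; ring.
Qed.

Lemma ddweight_form (a b : 'I_n -> R) :
  \sum_i \sum_j a i * b j * ddweight j i =
  3 / 2 * (\sum_i e 0 i * a i) * (\sum_i e 0 i * b i) - (\sum_i a i * b i) / 2.
Proof.
rewrite (eq_bigr (fun i => 3 / 2 * (e 0 i * a i) * (\sum_j e 0 j * b j) - a i * b i / 2)).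
  by rewrite sumrB -mulr_suml -mulr_sumr -mulr_suml.
move=> i _.
rewrite (eq_bigr (fun j => 3 / 2 * (e 0 i * a i) * (e 0 j * b j)
   - (i == j)%:R * (a i * b j / 2))).
  by rewrite sumrB -mulr_sumr sum_delta.
by move=> j _; rewrite /ddweight; ring.
Qed.

(** The algebraic heart of the Carleman estimate, with W the weight and w
    its gradient at a point: the square of the conjugated Laplacian
    v |-> exp(l W) Lap (exp(-l W) v) is at least a divergence plus positive
    terms. *)
Lemma carleman_identity (l v : R) (dv w : 'I_n -> R) (ddv : 'I_n -> 'I_n -> R) :
  (forall i j, ddv i j = ddv j i) -> 0 <= l ->
  forall G b L q d : R, G = \sum_i dv i ^+ 2 -> b = \sum_i w i * dv i ->
  L = \sum_i ddv i i -> q = \sum_i w i ^+ 2 -> d = \sum_i ddweight i i ->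
  \sum_i (- (4 * l) * (ddv i i * b + dv i * \sum_j (ddweight j i * dv j + w j * ddv j i))
     + 2 * l * (ddweight i i * G + w i * \sum_j 2 * dv j * ddv j i)
     - (2 * d + 3) * l * (dv i * dv i + v * ddv i i)
     - 2 * l ^+ 3 * ((\sum_j 2 * w j * ddweight j i) * v ^+ 2 * w i
          + q * (2 * v * dv i) * w i + q * v ^+ 2 * ddweight i i))
  + l * G
  + (l ^+ 3 * (6 * (\sum_i e 0 i * w i) ^+ 2 - 5 * q) - 9 / 4 * l ^+ 2) * v ^+ 2
  <= (L - 2 * l * b + (l ^+ 2 * q - l * d) * v) ^+ 2.
Proof.
move=> sym l0 G b L q d EG Eb EL Eq Ed.
pose Hv := \sum_i \sum_j dv i * dv j * ddweight j i.
pose Hw := \sum_i \sum_j w i * w j * ddweight j i.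
pose T := \sum_i \sum_j dv i * w j * ddv j i.
have Tsym : \sum_i \sum_j w i * dv j * ddv j i = T.
  rewrite exchange_big /T /=; apply: eq_bigr => i _; apply: eq_bigr => j _.
  by rewrite sym; ring.
rewrite (eq_bigr (fun i => - (4 * l) * (b * ddv i i)
   + - (4 * l) * \sum_j dv i * dv j * ddweight j i
   + - (4 * l) * (\sum_j dv i * w j * ddv j i)
   + 2 * l * (G * ddweight i i)
   + 4 * l * (\sum_j w i * dv j * ddv j i)
   - (2 * d + 3) * l * (dv i ^+ 2) - (2 * d + 3) * l * (v * ddv i i)
   - 4 * l ^+ 3 * v ^+ 2 * (\sum_j w i * w j * ddweight j i)
   - 4 * l ^+ 3 * q * v * (w i * dv i) - 2 * l ^+ 3 * q * v ^+ 2 * ddweight i i)); last first.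
  move=> i _.
  have -> : \sum_j (ddweight j i * dv j + w j * ddv j i) =
     \sum_j ddweight j i * dv j + \sum_j w j * ddv j i by rewrite big_split.
  have -> : \sum_j dv i * dv j * ddweight j i = dv i * \sum_j ddweight j i * dv j.
    by rewrite mulr_sumr; apply: eq_bigr => j _; ring.
  have -> : \sum_j dv i * w j * ddv j i = dv i * \sum_j w j * ddv j i.
    by rewrite mulr_sumr; apply: eq_bigr => j _; ring.
  have -> : \sum_j w i * dv j * ddv j i = w i * \sum_j dv j * ddv j i.
    by rewrite mulr_sumr; apply: eq_bigr => j _; ring.
  have -> : \sum_j w i * w j * ddweight j i = w i * \sum_j w j * ddweight j i.
    by rewrite mulr_sumr; apply: eq_bigr => j _; ring.
  have -> : \sum_j 2 * dv j * ddv j i = 2 * \sum_j dv j * ddv j i.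
    by rewrite mulr_sumr; apply: eq_bigr => j _; ring.
  have -> : \sum_j 2 * w j * ddweight j i = 2 * \sum_j w j * ddweight j i.
    by rewrite mulr_sumr; apply: eq_bigr => j _; ring.
  by ring.
rewrite !(sumrB, big_split)/= -!mulr_sumr -/Hv -/Hw -/T Tsym -EG -Eb -EL -Ed.
have EHv : Hv = 3 / 2 * (\sum_i e 0 i * dv i) ^+ 2 - G / 2.
  rewrite /Hv ddweight_form; congr (_ - _ / _); first by ring.
  by rewrite ?EG ?Eq; apply: eq_bigr => i _; rewrite expr2.
have EHw : Hw = 3 / 2 * (\sum_i e 0 i * w i) ^+ 2 - q / 2.
  rewrite /Hw ddweight_form; congr (_ - _ / _); first by ring.
  by rewrite ?EG ?Eq; apply: eq_bigr => i _; rewrite expr2.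
rewrite EHv EHw.
move: (\sum_i e 0 i * dv i) (\sum_i e 0 i * w i) => s t.
rewrite -subr_ge0.
rewrite [leRHS](_ : _ = (2 * l * b + l * d * v) ^+ 2 +
  (L + l ^+ 2 * q * v + 3 / 2 * l * v) ^+ 2 + 6 * l * s ^+ 2); last by field.
by apply: addr_ge0; [apply: addr_ge0; exact: sqr_ge0|apply: mulr_ge0; [exact: mulr_ge0|exact: sqr_ge0]].
Qed.

Lemma C1at_expR (f : V -> R) df x : C1at f df x ->
  C1at (fun x => expR (f x)) (fun i x => expR (f x) * df i x) x.
Proof.
move=> fC; apply: (C1at_comp1 (p := expR) (dp := expR)) => //.
exact: continuous_expR.
Qed.

Lemma supported_bounded (f : V -> R) : supported f ->
  (forall x, f y @[y --> x] --> f x) -> exists2 C : R, 0 <= C & forall x, `|f x| <= C.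
Proof.
move=> sf cf.
have cK : compact [set x : V | `|x - 0| <= 1] by exact: compact_cball.
have K0 : [set x : V | `|x - 0| <= 1] !=set0 by exists 0; rewrite /= subrr normr0.
have [|c _ cmax] := compact_EVT_max K0 cK (f := fun x => `|f x|).
  apply: continuous_subspaceT => x; exact: cvg_norm (cf x).
exists `|f c| => // x; have [x1|x1] := leP `|x - 0| 1.
  by apply: cmax; rewrite inE.
by rewrite sf ?normr0//; move: x1; rewrite subr0; lra.
Qed.

Section estimate.
Variables (U : V -> R) (dU : 'I_n -> V -> R) (ddU : 'I_n -> 'I_n -> V -> R).
Hypothesis UC : forall x, C1at U dU x.
Hypothesis dUC : forall i x, C1at (dU i) (ddU i) x.

Section fixed_l.
Variable l : R.

Let E x := expR (l * weight x).
Let v x := E x * U x.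
Let dv i x := E x * (l * dweight i x * U x + dU i x).
Let ddv i j x := E x * (l ^+ 2 * dweight i x * dweight j x * U x
  + l * ddweight i j * U x + l * dweight i x * dU j x + l * dweight j x * dU i x
  + ddU i j x).

Lemma carleman_C1v x : C1at v dv x.
Proof.
apply: C1at_ext (C1atM (C1at_expR (C1atZ l (C1at_weight x))) (UC x)) => // i y.
by rewrite /dv /E; ring.
Qed.

Lemma carleman_C1dv i x : C1at (dv i) (ddv i) x.
Proof.
apply: C1at_ext (C1atM (C1at_expR (C1atZ l (C1at_weight x)))
  (C1atD (C1atM (C1atZ l (C1at_dweight i x)) (UC x)) (dUC i x))) => // j y.
by rewrite /ddv /E; ring.
Qed.

Let b x := \sum_i dweight i x * dv i x.
Let db k x := \sum_j (ddweight j k * dv j x + dweight j x * ddv j k x).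
Let G x := \sum_i dv i x ^+ 2.
Let dG k x := \sum_j 2 * dv j x * ddv j k x.
Let d : R := \sum_i ddweight i i.
Let dq k x := \sum_j 2 * dweight j x * ddweight j k.

Let Z i x := - (4 * l) * (dv i x * b x) + 2 * l * (dweight i x * G x)
  - (2 * d + 3) * l * (v x * dv i x)
  - 2 * l ^+ 3 * (qweight x * v x ^+ 2 * dweight i x).
Let dZ i k x := - (4 * l) * (ddv i k x * b x + dv i x * db k x)
  + 2 * l * (ddweight i k * G x + dweight i x * dG k x)
  - (2 * d + 3) * l * (dv k x * dv i x + v x * ddv i k x)
  - 2 * l ^+ 3 * (dq k x * v x ^+ 2 * dweight i x
     + qweight x * (2 * v x * dv k x) * dweight i x
     + qweight x * v x ^+ 2 * ddweight i k).

Lemma carleman_C1Z i x : C1at (Z i) (dZ i) x.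
Proof.
have vC := carleman_C1v x; have dvC j := carleman_C1dv j x.
have bC : C1at b db x.
  exact: (C1at_sumT (fun j => C1atM (C1at_dweight j x) (dvC j))).
have GC : C1at G dG x.
  apply: C1at_ext (C1at_sumT (fun j => C1atM (dvC j) (dvC j))) => [y|k y].
    by apply: eq_bigr => j _; rewrite expr2.
  by apply: eq_bigr => j _; ring.
have qC := C1at_qweight x.
have C := C1atB (C1atB (C1atD (C1atZ (- (4 * l)) (C1atM (dvC i) bC))
   (C1atZ (2 * l) (C1atM (C1at_dweight i x) GC)))
   (C1atZ ((2 * d + 3) * l) (C1atM vC (dvC i))))
   (C1atZ (2 * l ^+ 3) (C1atM (C1atM qC (C1atM vC vC)) (C1at_dweight i x))).
apply: C1at_ext C => [y|k y]; first by rewrite /Z; ring.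
by rewrite /dZ /dq; ring.
Qed.

Hypothesis sU : supported U.
Hypothesis sdU : forall i, supported (dU i).
Hypothesis sddU : forall i j, supported (ddU i j).

Lemma carleman_supported : (forall i, supported (Z i)) /\
  (forall i j, supported (dZ i j)).
Proof.
have v0 x : 1 / 2 <= `|x| -> [/\ v x = 0, (forall i, dv i x = 0) & forall i j, ddv i j x = 0].
  move=> x2; split=> [|i|i j]; rewrite /v /dv /ddv sU// ?sdU// ?sddU//; ring.
by split=> [i x x2|i j x x2]; have [vx dvx ddvx] := v0 x x2;
  rewrite /Z /dZ vx !dvx ?ddvx /b /db /G /dG;
  repeat (rewrite big1; last by move=> *; rewrite dvx ?ddvx; ring); ring.
Qed.

Lemma carleman_div : forall eps : R, 0 < eps -> exists m0 : nat,
  forall m, (m0 <= m)%N -> `|gsum m (fun x => \sum_i dZ i i x)| <= eps.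
Proof.
move=> eps eps0; have [sZ sdZ] := carleman_supported.
have e'0 : 0 < eps / n.+1%:R by rewrite divr_gt0.
have H i : exists m0 : nat, forall m, (m0 <= m)%N ->
    `|gsum m (dZ i i)| <= eps / n.+1%:R.
  by apply: (gsum_derive i (sZ i) (sdZ i)) e'0 => x; exact: carleman_C1Z.
have [f fP] := fin_all_exists H.
exists (\max_i f i)%N => m mm; rewrite gsum_sum.
apply: (le_trans (ler_norm_sum _ _ _)).
apply: (@le_trans _ _ (\sum_(i < n) eps / n.+1%:R)).
  by apply: ler_sum => i _; apply: fP; apply: leq_trans mm; exact: leq_bigmax.
rewrite sumr_const card_ord -[_ *+ n]mulr_natr mulrAC.
by rewrite ler_pdivrMr// ler_wpM2l ?(ltW eps0)// ler_nat.
Qed.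

Lemma carleman_pointwise x : 0 <= l ->
  \sum_i dZ i i x + l * G x
    + (l ^+ 3 * pweight x - 9 / 4 * l ^+ 2) * v x ^+ 2
  <= (E x * \sum_i ddU i i x) ^+ 2.
Proof.
move=> l0.
have sym i j : ddv i j x = ddv j i x.
  apply: (@C2_sym _ _ v dv (fun i j => ddv i j)); first by near=> y; exact: carleman_C1v.
  by move=> k; near=> y; exact: carleman_C1dv.
have EP : \sum_i ddv i i x - 2 * l * b x + (l ^+ 2 * qweight x - l * d) * v x
    = E x * \sum_i ddU i i x.
  have -> : \sum_i ddv i i x = E x * (l ^+ 2 * qweight x * U x + l * d * U x
      + 2 * l * (\sum_i dweight i x * dU i x) + \sum_i ddU i i x).
    rewrite -mulr_sumr; congr (_ * _).
    rewrite /qweight /d !mulr_sumr !mulr_suml -!big_split/=.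
    by apply: eq_bigr => i _; ring.
  have -> : b x = E x * (l * qweight x * U x + \sum_i dweight i x * dU i x).
    rewrite /b /qweight !mulr_sumr !mulr_suml -big_split/= mulr_sumr.
    by apply: eq_bigr => i _; rewrite /dv; ring.
  by rewrite /v; ring.
rewrite -EP; have := @carleman_identity l (v x) (dv^~ x) (dweight^~ x)
  (fun i j => ddv i j x) sym l0 _ _ _ _ _ erefl erefl erefl erefl erefl.
exact.
Unshelve. all: by end_near. Qed.

(** Carleman's estimate, in terms of Riemann sums: the sums of the divergence of
    Z are dropped, by [gsum_derive]. *)
Lemma carleman_estimate : 0 <= l -> forall eps : R, 0 < eps -> exists m0 : nat,
  forall m, (m0 <= m)%N ->
  gsum m (fun x => l * (\sum_i (expR (l * weight x) * (l * dweight i x * U x + dU i x)) ^+ 2)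
    + (l ^+ 3 * pweight x - 9 / 4 * l ^+ 2) * (expR (l * weight x) * U x) ^+ 2)
  <= gsum m (fun x => (expR (l * weight x) * \sum_i ddU i i x) ^+ 2) + eps.
Proof.
move=> l0 eps eps0; have [m0 m0P] := carleman_div eps0.
exists m0 => m /m0P /ler_normlP[mP _].
have : gsum m (fun x => \sum_i dZ i i x) + gsum m (fun x => l * G x
    + (l ^+ 3 * pweight x - 9 / 4 * l ^+ 2) * v x ^+ 2) <=
    gsum m (fun x => (E x * \sum_i ddU i i x) ^+ 2).
  by rewrite -gsumD; apply: le_gsum => x; rewrite addrA; exact: carleman_pointwise.
rewrite -/(G _); move: mP; move: (gsum m (fun x => \sum_i dZ i i x)) => s h1 h2.
rewrite -lerBlDr; apply: le_trans h2; rewrite addrC lerD2r.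
by rewrite lerNl.
Qed.

End fixed_l.


Hypothesis sU : supported U.
Hypothesis sdU : forall i, supported (dU i).
Hypothesis sddU : forall i j, supported (ddU i j).

(** If U x0 were not zero, the estimate would fail for large l: its left side
    grows at least like exp(2 l m2) with m2 > m1, because of the points near
    x0, while the points of weight at most m1, where nothing is known of the
    Laplacian, contribute at most a multiple of exp(2 l m1). *)
Lemma carleman_uc (m1 K Q beta : R) : 0 <= K -> 0 <= Q -> 0 < beta ->
  (forall x, [/\ U x = 0, (forall i, dU i x = 0) & forall i j, ddU i j x = 0] \/
     beta <= pweight x /\ qweight x <= Q) ->
  (forall x, m1 <= weight x ->
     (\sum_i ddU i i x) ^+ 2 <= K * ((\sum_i dU i x ^+ 2) + U x ^+ 2)) ->
  forall x0, `|x0| <= 1 / 2 -> m1 < weight x0 -> U x0 = 0.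
Proof.
move=> K0 Q0 beta0 region ineq x0 x02 wx0; apply/eqP/negPn/negP => Ux0.
have [C C0 CP] : exists2 C : R, 0 <= C & forall x, `|\sum_i ddU i i x| <= C.
  apply: supported_bounded => [x x2|x].
    by rewrite big1// => i _; apply: sddU.
  by apply: cvg_sum_rV => i; have [_ _ h] := dUC i x; exact: h.
pose m2 := (m1 + weight x0) / 2.
have m12 : m1 < m2 by rewrite /m2; lra.
have m2x : m2 < weight x0 by rewrite /m2; lra.
have c0 : 0 < `|U x0| / 2 by rewrite divr_gt0 ?normr_gt0.
have [rho rho1 rhoP] : exists2 rho : R, 0 < rho <= 1 / 2 &
    forall x, `|x - x0| <= rho -> m2 <= weight x /\ `|U x0| / 2 <= `|U x|.
  have [cw _ _] := C1at_weight x0; have [cU _ _] := UC x0.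
  have wm2 : 0 < weight x0 - m2 by lra.
  have [d d0 dP] := (cvg_rVP _ _).1 cw _ wm2.
  have [d' d'0 d'P] := (cvg_rVP _ _).1 cU _ c0.
  exists (Num.min (1 / 2) (Num.min d d' / 2)).
    by rewrite lt_min ge_min lexx/= !divr_gt0// lt_min d0.
  move=> x; rewrite !le_min => /andP[_ xd].
  have : `|x - x0| < Num.min d d'.
    by rewrite (le_lt_trans xd)// ltr_pdivrMr// ltr_pMr ?ltr1n// lt_min d0.
  rewrite lt_min => /andP[/dP /ltr_normlP[h1 _] /d'P h2].
  split; first by lra.
  have := ler_normD (U x) (U x0 - U x); rewrite addrC subrK distrC; lra.
pose c := (`|U x0| / 2) ^+ 2; have cc0 : 0 < c by rewrite exprn_gt0.
have rn0 : 0 < rho ^+ n by rewrite exprn_gt0//; case/andP: rho1.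
pose K3 := K * (2 * Q + 2); have K30 : 0 <= K3 by rewrite mulr_ge0// addr_ge0// mulr_ge0.
pose C6 := (3 ^+ n * C ^+ 2 + 1) / (c * rho ^+ n).
have C60 : 0 <= C6.
  apply: divr_ge0; last by apply: mulr_ge0; exact: ltW.
  by apply: addr_ge0 => //; apply: mulr_ge0; rewrite ?exprn_ge0.
pose l := 1 + K3 + (9 / 4 + K3 + 1) / beta + C6 / (2 * (m2 - m1)).
have lb0 : 0 <= (9 / 4 + K3 + 1) / beta by rewrite divr_ge0 ?(ltW beta0)//; lra.
have lc0 : 0 <= C6 / (2 * (m2 - m1)) by rewrite divr_ge0//; lra.
have l1 : 1 <= l by rewrite /l; lra.
have l0 : 0 <= l by lra.
have lK : K3 <= l by rewrite /l; lra.
have lbeta : 1 <= l ^+ 3 * beta - 9 / 4 * l ^+ 2 - K3 * l ^+ 2.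
  have : 9 / 4 + K3 + 1 <= l * beta.
    by rewrite -ler_pdivrMr// /l; lra.
  have : 1 <= l ^+ 2 by rewrite expr_ge1.
  rewrite (_ : l ^+ 3 * beta - _ - _ = l ^+ 2 * (l * beta - 9 / 4 - K3)); last by ring.
  by move: (l ^+ 2) (l * beta) => s t s1 h; nra.
have lexp : 1 + C6 <= expR (2 * l * (m2 - m1)).
  apply: (le_trans _ (expR_ge1Dx _)); rewrite lerD2l.
  have m210 : 0 < 2 * (m2 - m1) by lra.
  rewrite (_ : 2 * l * (m2 - m1) = l * (2 * (m2 - m1))); last by ring.
  by rewrite -ler_pdivrMr// /l; lra.
pose em := expR (2 * l * m1); have em0 : 0 < em by exact: expR_gt0.
have [m0 m0P] := carleman_estimate sU sdU sddU l0 em0.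
pose m := maxn m0 (Num.truncn rho^-1).
have := m0P m (leq_maxl _ _).
have r0 : 0 < rho by case/andP: rho1.
have mr : 1 <= m.+1%:R * rho.
  rewrite -ler_pdivrMr// mul1r ltW// -truncn_lt_nat ?invr_ge0 ?(ltW r0)// ltnS.
  exact: leq_maxr.
set S := gsum m _; move=> SP.
have up x : expR (l * weight x) ^+ 2 * (\sum_i ddU i i x) ^+ 2 <=
    K3 * (\sum_i (expR (l * weight x) * (l * dweight i x * U x + dU i x)) ^+ 2)
    + K3 * l ^+ 2 * (expR (l * weight x) * U x) ^+ 2 + C ^+ 2 * em.
  set E := expR _.
  have C2 : 0 <= C ^+ 2 * em by rewrite mulr_ge0 ?sqr_ge0 ?ltW.
  set T := \sum_i (E * _) ^+ 2.
  have T0 : 0 <= T by rewrite sumr_ge0// => i _; exact: sqr_ge0.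
  have KT0 : 0 <= K3 * T + K3 * l ^+ 2 * (E * U x) ^+ 2.
    by apply: addr_ge0; [exact: mulr_ge0|apply: mulr_ge0; [apply: mulr_ge0 => //; exact: sqr_ge0|exact: sqr_ge0]].
  have [wx|wx] := leP m1 (weight x); last first.
    rewrite -[leLHS]add0r lerD// mulrC ler_pM ?sqr_ge0//.
      by rewrite -[leLHS]real_normK ?num_real// lerXn2r ?nnegrE.
    rewrite /em /E -expRM_natr ler_expR.
    by nra.
  have [[Ux dUx ddUx]|[_ qx]] := region x.
    by rewrite big1 ?expr0n ?mulr0 => [|i _]; [exact: addr_ge0|exact: ddUx].
  rewrite -[leLHS]addr0 lerD//.
  apply: (@le_trans _ _ (E ^+ 2 * (K * ((\sum_i dU i x ^+ 2) + U x ^+ 2)))).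
    by rewrite ler_wpM2l ?sqr_ge0// ineq.
  have h1 : E ^+ 2 * (\sum_i dU i x ^+ 2) <= 2 * T + 2 * l ^+ 2 * qweight x * (E * U x) ^+ 2.
    rewrite /T /qweight !mulr_sumr mulr_suml -big_split/=.
    apply: ler_sum => i _; rewrite -subr_ge0.
    rewrite [leRHS](_ : _ = (E * (2 * l * dweight i x * U x + dU i x)) ^+ 2); last by ring.
    exact: sqr_ge0.
  have h2 : qweight x * (E * U x) ^+ 2 <= Q * (E * U x) ^+ 2 by rewrite ler_wpM2r ?sqr_ge0.
  have h3 : 1 <= l ^+ 2 by rewrite expr_ge1.
  have h4 : 0 <= (E * U x) ^+ 2 by exact: sqr_ge0.
  have h5 : l ^+ 2 * (qweight x * (E * U x) ^+ 2) <= l ^+ 2 * (Q * (E * U x) ^+ 2).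
    by rewrite ler_wpM2l ?sqr_ge0.
  have h6 : (E * U x) ^+ 2 <= l ^+ 2 * (E * U x) ^+ 2 by rewrite ler_peMl.
  rewrite (_ : E ^+ 2 * (K * _) = K * (E ^+ 2 * (\sum_i dU i x ^+ 2) + (E * U x) ^+ 2)); last by ring.
  rewrite /K3 -!(mulrA K) -mulrDr ler_wpM2l//.
  have h7 : 0 <= Q * T by rewrite mulr_ge0.
  have h8 : 0 <= Q * (l ^+ 2 * (E * U x) ^+ 2) by rewrite mulr_ge0// mulr_ge0// sqr_ge0.
  move: h1 h2 h4 h5 h6 h7 h8; move: (E ^+ 2 * _) ((E * U x) ^+ 2) (l ^+ 2) => a u s; nra.
have : c * expR (2 * l * m2) * rho ^+ n <= 3 ^+ n * (C ^+ 2 * em) + em.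
  apply: (@le_trans _ _ (gsum m (fun x => (expR (l * weight x) * U x) ^+ 2))).
    apply: (gsum_lower x02 rho1 mr) => [|x|x xr].
    - by rewrite mulr_ge0 ?expR_ge0 ?ltW.
    - exact: sqr_ge0.
    - have [wx Ux] := rhoP x xr; rewrite exprMn mulrC ler_pM ?expR_ge0 ?(ltW cc0)//.
        by rewrite -expRM_natr ler_expR; nra.
      by rewrite -[leRHS]real_normK ?num_real// lerXn2r ?nnegrE ?(ltW c0).
  rewrite -(lerD2l (gsum m (fun x => l * (\sum_i (expR (l * weight x) * (l * dweight i x * U x + dU i x)) ^+ 2)
     + K3 * l ^+ 2 * (expR (l * weight x) * U x) ^+ 2))).
  rewrite -gsumD; apply: (@le_trans _ _ S).
    apply: le_gsum => x; rewrite -addrA lerD2l -[X in _ + X]mul1r -mulrDl.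
    have [[Ux _ _]|[px _]] := region x; first by rewrite Ux !(mulr0, expr0n).
    rewrite ler_wpM2r ?sqr_ge0//.
    have : l ^+ 3 * beta <= l ^+ 3 * pweight x by rewrite ler_wpM2l// exprn_ge0.
    by lra.
  apply: (le_trans SP); rewrite addrA lerD2r.
  apply: (@le_trans _ _ (gsum m (fun x => l * (\sum_i (expR (l * weight x) * (l * dweight i x * U x + dU i x)) ^+ 2)
     + K3 * l ^+ 2 * (expR (l * weight x) * U x) ^+ 2 + C ^+ 2 * em))).
    apply: le_gsum => x; rewrite exprMn; apply: (le_trans (up x)).
    by rewrite !lerD2r ler_wpM2r// sumr_ge0// => i _; exact: sqr_ge0.
  by rewrite gsumD lerD2l gsum_cst// mulr_ge0 ?sqr_ge0 ?ltW.
apply/negP; rewrite -ltNge.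
rewrite (_ : 2 * l * m2 = 2 * l * (m2 - m1) + 2 * l * m1); last by ring.
rewrite expRD -/em (_ : _ + em = (c * rho ^+ n) * C6 * em); last first.
  by rewrite /C6; field; rewrite !gt_eqF.
rewrite [ltRHS](_ : _ = (c * rho ^+ n) * expR (2 * l * (m2 - m1)) * em); last by ring.
rewrite ltr_pM2r// ltr_pM2l ?(mulr_gt0 cc0 rn0)//.
by apply: lt_le_trans lexp; rewrite ltrDr.
Qed.

End estimate.

End carleman.

(** * Unique continuation across a sphere *)

Section sums.
Variables (R : realType) (n : nat).
Implicit Types (a b : 'I_n -> R).

Lemma sum_cauchy_schwarz a b :
  (\sum_i a i * b i) ^+ 2 <= (\sum_i a i ^+ 2) * (\sum_i b i ^+ 2).
Proof.
rewrite -subr_ge0.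
have -> : (\sum_i a i ^+ 2) * (\sum_i b i ^+ 2) - (\sum_i a i * b i) ^+ 2 =
    (\sum_i \sum_j (a i * b j - a j * b i) ^+ 2) / 2.
  have E1 : \sum_i \sum_j a i ^+ 2 * b j ^+ 2 = (\sum_i a i ^+ 2) * (\sum_i b i ^+ 2).
    by rewrite mulr_suml; apply: eq_bigr => i _; rewrite mulr_sumr.
  have E2 : \sum_i \sum_j a j ^+ 2 * b i ^+ 2 = (\sum_i a i ^+ 2) * (\sum_i b i ^+ 2).
    by rewrite exchange_big.
  have E3 : \sum_i \sum_j (a i * b i) * (a j * b j) = (\sum_i a i * b i) ^+ 2.
    by rewrite expr2 mulr_suml; apply: eq_bigr => i _; rewrite mulr_sumr.
  have -> : \sum_i \sum_j (a i * b j - a j * b i) ^+ 2 =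
    (\sum_i \sum_j a i ^+ 2 * b j ^+ 2) + (\sum_i \sum_j a j ^+ 2 * b i ^+ 2)
    - 2 * \sum_i \sum_j (a i * b i) * (a j * b j).
    rewrite mulr_sumr -big_split/= -sumrB; apply: eq_bigr => i _.
    by rewrite mulr_sumr -big_split/= -sumrB; apply: eq_bigr => j _; ring.
  by rewrite E1 E2 E3; field.
by rewrite divr_ge0// sumr_ge0// => i _; rewrite sumr_ge0// => j _; exact: sqr_ge0.
Qed.

Lemma sqr_norm_le_sum (x : 'rV[R]_n) : `|x| ^+ 2 <= \sum_i x 0 i ^+ 2.
Proof.
have N0 : 0 <= \sum_i x 0 i ^+ 2 by rewrite sumr_ge0// => i _; exact: sqr_ge0.
rewrite -[leRHS]sqr_sqrtr// lerXn2r ?nnegrE ?sqrtr_ge0//.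
apply: norm_le_coord => [|i]; first exact: sqrtr_ge0.
rewrite -sqrtr_sqr ler_wsqrtr// (bigD1 i)//= lerDl sumr_ge0// => j _.
exact: sqr_ge0.
Qed.

Lemma sum_le_sqr_norm (x : 'rV[R]_n) : \sum_i x 0 i ^+ 2 <= n%:R * `|x| ^+ 2.
Proof.
apply: (@le_trans _ _ (\sum_(i < n) `|x| ^+ 2)).
  apply: ler_sum => i _; rewrite -real_normK ?num_real// lerXn2r ?nnegrE//.
  exact: coord_le_norm.
by rewrite sumr_const card_ord -[_ *+ n]mulr_natl.
Qed.

Lemma C1at_near0 (f : 'rV[R]_n -> R) df x : (\forall y \near x, f y = 0) ->
  C1at f df x -> forall i, df i x = 0.
Proof.
move=> f0 [_ D _] i; have [_ <-] := D i.
have [_ E] := @is_derive_cst R _ _ (0 : R) x (stdvec R i).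
rewrite -[RHS]E; apply: near_eq_derive; exact: f0.
Qed.

End sums.

(** A cut-off adds terms of lower order to the Laplacian, with coefficients that
    are bounded where the cut-off is bounded below; this lemma and the next one
    absorb them. *)
Lemma coefficient_square_le (R : realType) (a al q Q s : R) :
  0 <= a -> a <= al -> 0 <= a ^+ 2 * q -> a ^+ 2 * q <= al ^+ 2 * Q ->
  (6 * a ^+ 2 * q + 3 * a * s) ^+ 2 <= (6 * al ^+ 2 * Q + 3 * al * `|s|) ^+ 2.
Proof.
move=> a0 aal q0 qQ; have al0 := le_trans a0 aal.
have s0 : 0 <= al * `|s| by rewrite mulr_ge0.
rewrite -[leLHS]real_normK ?num_real// lerXn2r ?nnegrE//; first by lra.
apply: (le_trans (ler_normD _ _)); rewrite lerD//.
  by rewrite ger0_norm; lra.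
by rewrite !normrM (ger0_norm a0) (ger0_norm (_ : 0 <= 3))// ler_wpM2r// ler_wpM2l.
Qed.

Lemma absorb_square (R : realType) (K al Q C a S P c f T Y : R) :
  0 <= K -> 0 <= al ^+ 2 * Q -> 0 <= T ->
  P ^+ 2 <= K * Y -> S ^+ 2 <= Q * Y -> a ^+ 2 <= al ^+ 2 -> c ^+ 2 <= C ^+ 2 ->
  Y <= 2 * T + 18 * (al ^+ 2 * Q) * f ^+ 2 ->
  (P + 6 * a * S + c * f) ^+ 2 <=
  (3 * (K + 36 * al ^+ 2 * Q) * (2 + 18 * al ^+ 2 * Q) + 3 * C ^+ 2) * (T + f ^+ 2).
Proof.
move=> K0 A2 T0 hP hS a2 hc hY.
apply: (@le_trans _ _ (3 * (P ^+ 2 + 36 * (a ^+ 2 * S ^+ 2) + c ^+ 2 * f ^+ 2))).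
  rewrite -subr_ge0 [leRHS](_ : _ = (P - 6 * a * S) ^+ 2 + (P - c * f) ^+ 2
     + (6 * a * S - c * f) ^+ 2); last by ring.
  by rewrite !addr_ge0 ?sqr_ge0.
have h1 : a ^+ 2 * S ^+ 2 <= al ^+ 2 * Q * Y.
  by rewrite -mulrA ler_pM ?sqr_ge0.
have h2 : c ^+ 2 * f ^+ 2 <= C ^+ 2 * f ^+ 2 by rewrite ler_wpM2r ?sqr_ge0.
have h5 : 0 <= C ^+ 2 * T by rewrite mulr_ge0 ?sqr_ge0.
rewrite -(mulrA 36) -(mulrA 18).
move: (al ^+ 2 * Q) (C ^+ 2) (f ^+ 2) (sqr_ge0 f) A2 hY h1 h2 h5 => Z D F F0 Z0 hY h1 h2 h5.
have h3 : (K + 36 * Z) * Y <= (K + 36 * Z) * (2 * T + 18 * Z * F).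
  by rewrite ler_wpM2l//; lra.
have h4 : (K + 36 * Z) * (2 * T + 18 * Z * F) <= (K + 36 * Z) * ((2 + 18 * Z) * (T + F)).
  rewrite ler_wpM2l//; first by lra.
  have : 0 <= Z * T by rewrite mulr_ge0.
  by lra.
by move: hP; lra.
Qed.

Section uc_sphere.
Variables (R : realType) (n : nat) (e : 'rV[R]_n) (radius : R).
Hypothesis e1 : \sum_i e 0 i ^+ 2 = 1.
Hypothesis radius0 : 0 < radius.
Local Notation V := 'rV[R]_n.
Let B := radius / 4.
Local Notation w := (weight e B).
Local Notation dw := (dweight e B).
Local Notation ddw := (ddweight e).
Local Notation N x := (\sum_i x 0 i ^+ 2).

(** Outside the ball of radius radius and center - radius e, the maximum of the
    weight at the origin is strict enough to leave room for a cut-off. *)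
Lemma weight_le (x : V) : N x <= B ^+ 2 -> 0 <= N x + 2 * radius * height e x ->
  w x <= w 0 - N x / 16.
Proof.
move=> NB; rewrite (_ : radius = 4 * B); last by rewrite /B; field.
have B0 : 0 < B by rewrite divr_gt0.
have h0 : height e 0 = 0.
  by rewrite /height big1// => i _; rewrite mxE mulr0.
have N0 : N (0 : V) = 0 by rewrite big1// => i _; rewrite mxE expr0n.
have hN : height e x ^+ 2 <= N x.
  by have := sum_cauchy_schwarz (e 0) (x 0); rewrite e1 mul1r.
rewrite /weight h0 N0; move: (height e x) (N x) hN NB => X M XM MB HX.
have M0 : 0 <= M by apply: le_trans XM; exact: sqr_ge0.
have [X0|X0] := leP 0 X.
  have XB : X <= B.
    by rewrite -(@ler_pXn2r _ 2)// ?nnegrE ?(ltW B0)//; apply: le_trans MB.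
  nra.
have X2 : X ^+ 2 * 64 <= M.
  have h : - (8 * B * X) <= M by lra.
  have h2 : (8 * B * X) ^+ 2 <= M ^+ 2.
    by rewrite -sqrrN lerXn2r ?nnegrE//; nra.
  have [M00|Mn0] := eqVneq M 0; first by move: XM; rewrite M00; have := sqr_ge0 X; lra.
  have Mp : 0 < M by rewrite lt_def Mn0.
  rewrite -(ler_pM2r Mp) -expr2; apply: le_trans h2.
  have : X ^+ 2 * M <= X ^+ 2 * B ^+ 2 by rewrite ler_wpM2l ?sqr_ge0.
  by lra.
lra.
Qed.

Variables (u : V -> R) (du : 'I_n -> V -> R) (ddu : 'I_n -> 'I_n -> V -> R).

(** The function u is multiplied by chi, the cube of the positive part of the
    weight above a level m0, which is of class C2. The product vanishes on a
    spherical shell around the origin: where u does, and by [weight_le] where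
    chi does. So it extends by zero to a compactly supported function U, to
    which [carleman_uc] applies above a slightly higher level. *)
Lemma uc_sphere (rho K : R) : 0 < rho -> 0 <= K ->
  (forall x : V, `|x| < rho -> C1at u du x) ->
  (forall i (x : V), `|x| < rho -> C1at (du i) (ddu i) x) ->
  (forall x : V, `|x| < rho -> (\sum_i ddu i i x) ^+ 2 <= K * \sum_i du i x ^+ 2) ->
  (forall x : V, `|x| < rho -> N x + 2 * radius * height e x < 0 -> u x = 0) ->
  \forall x \near (0 : V), u x = 0.
Proof.
move=> rho0 K0 uC duC upde u0.
have B0 : 0 < B by rewrite divr_gt0.
have h0 : height e 0 = 0 by rewrite /height big1// => i _; rewrite mxE mulr0.
have dw0 i : dw i 0 = - B * e 0 i by rewrite /dweight h0 mxE; ring.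
have q0 : qweight e B 0 = B ^+ 2.
  rewrite /qweight (eq_bigr (fun i => B ^+ 2 * e 0 i ^+ 2)) => [|i _].
    by rewrite -mulr_sumr e1 mulr1.
  by rewrite dw0; ring.
pose dn i x := \sum_(j < n) 2 * dw j x * ddw j i.
have C1sum x : C1at (fun x => \sum_i e 0 i * dw i x)
    (fun k _ => \sum_i e 0 i * ddw i k) x.
  exact: (C1at_sumT (fun i => C1atZ (e 0 i) (C1at_dweight e B i x))).
have [r [r0 r1 r2 r3]] : exists r : R, [/\ 0 < r, r <= rho, r <= 1 / 2 & forall x : V, `|x| < r ->
    [/\ B ^+ 2 / 2 <= pweight e B x, qweight e B x <= B ^+ 2 + 1 & N x <= B ^+ 2]].
  have [cq _ _] := C1at_qweight e B 0; have [cs _ _] := C1sum 0.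
  have cp : pweight e B x @[x --> (0 : V)] --> pweight e B 0.
    apply: cvgB; apply: cvgM; [exact: cvg_cst|exact: cvgM|exact: cvg_cst|exact: cq].
  have p0 : pweight e B 0 = B ^+ 2.
    rewrite /pweight q0 (eq_bigr (fun i => - B * e 0 i ^+ 2)) => [|i _].
      by rewrite -mulr_sumr e1; ring.
    by rewrite dw0; ring.
  have B2 : 0 < B ^+ 2 / 2 by rewrite divr_gt0// exprn_gt0.
  have [d d0 dP] := (cvg_rVP _ _).1 cp _ B2.
  have [d' d'0 d'P] := (cvg_rVP _ _).1 cq _ ltr01.
  pose d'' := B / (n%:R + 1); have d''0 : 0 < d'' by rewrite divr_gt0// ltr_wpDl.
  exists (Num.min (Num.min rho (1 / 2)) (Num.min d (Num.min d' d''))).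
  split; rewrite ?lt_min ?ge_min ?lexx ?orbT ?rho0 ?d0 ?d'0 ?d''0 ?divr_gt0//.
  move=> x; rewrite !lt_min => /andP[_ /and3P[xd xd' xd'']].
  have := dP x; rewrite subr0 => /(_ xd) /ltr_normlP[h1 _].
  have := d'P x; rewrite subr0 => /(_ xd') /ltr_normlP[_ h2].
  split; [rewrite p0 in h1; lra|rewrite q0 in h2; lra|].
  apply: (le_trans (sum_le_sqr_norm x)).
  have h3 : (n%:R + 1) * `|x| <= B by rewrite mulrC -ler_pdivlMr ?ltr_wpDl// ltW.
  have n0 : (0 : R) <= n%:R by [].
  have x0 : 0 <= `|x| by [].
  apply: (@le_trans _ _ (((n%:R + 1) * `|x|) ^+ 2)).
    by rewrite exprMn ler_wpM2r ?sqr_ge0//; nra.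
  by rewrite lerXn2r ?nnegrE ?mulr_ge0 ?addr_ge0// ltW.
(* on the shell r / 2 <= |x| the weight is at most m0, by weight_le *)
pose m0 := w 0 - r ^+ 2 / 64.
pose dlt := r ^+ 2 / 128; have dlt0 : 0 < dlt by rewrite divr_gt0 ?exprn_gt0.
pose om x := w x - m0.
have omC x : C1at om dw x.
  apply: C1at_ext (C1atB (C1at_weight e B x) (C1at_cst m0 x)) => // i y.
  by rewrite subr0.
pose bo x := 0 < om x.
pose f1 x := om x ^+ 3.
pose df1 i x := 3 * om x ^+ 2 * dw i x.
pose ddf1 i j x := 6 * om x * dw j x * dw i x + 3 * om x ^+ 2 * ddw i j.
have f1C x : C1at f1 df1 x.
  apply: C1at_ext (C1atM (omC x) (C1atM (omC x) (omC x))) => [y|i y]; first by rewrite /f1; ring.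
  by rewrite /df1; ring.
have df1C i x : C1at (df1 i) (ddf1 i) x.
  apply: C1at_ext (C1atM (C1atZ 3 (C1atM (omC x) (omC x))) (C1at_dweight e B i x)) => [y|j y].
    by rewrite /df1; ring.
  by rewrite /ddf1; ring.
have bo_near x : om x != 0 -> (\forall y \near x, bo y) \/ (\forall y \near x, ~~ bo y).
  have [co _ _] := omC x; rewrite /bo.
  case: ltgtP => // ox _; [right|left].
    have ox' : 0 < - om x by rewrite oppr_gt0.
    have [d d0 dP] := (cvg_rVP _ _).1 co _ ox'.
    apply/nearP; exists d => // y /dP /ltr_normlP[h1 h2]; rewrite -leNgt; lra.
  have [d d0 dP] := (cvg_rVP _ _).1 co _ ox.
  by apply/nearP; exists d => // y /dP /ltr_normlP[h1 h2]; lra.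
pose chi := cutoff bo f1.
pose dchi i := cutoff bo (df1 i).
pose ddchi i j := cutoff bo (ddf1 i j).
have chiC x : C1at chi dchi x.
  apply: C1at_cutoff; have [ox|ox] := eqVneq (om x) 0.
    by apply: Or33; split=> // [|i]; rewrite /f1 ?/df1 ox ?expr0n/= ?mulr0 ?mul0r.
  by have [h|h] := bo_near _ ox; [apply: Or31; split|apply: Or32].
have dchiC i x : C1at (dchi i) (ddchi i) x.
  apply: C1at_cutoff; have [ox|ox] := eqVneq (om x) 0.
    by apply: Or33; split=> // [|j]; rewrite ?/df1 ?/ddf1 ox ?expr0n/= ?mulr0 ?mul0r ?addr0.
  by have [h|h] := bo_near _ ox; [apply: Or31; split|apply: Or32].
pose f2 x := chi x * u x.
pose df2 i x := dchi i x * u x + chi x * du i x.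
pose ddf2 i j x := (ddchi i j x * u x + dchi i x * du j x)
  + (dchi j x * du i x + chi x * ddu i j x).
have rrho x : `|x : V| < r -> `|x| < rho by move=> /lt_le_trans; apply.
have f2C x : `|x : V| < r -> C1at f2 df2 x.
  by move=> /rrho xr; apply: C1atM => //; exact: uC.
have df2C i x : `|x : V| < r -> C1at (df2 i) (ddf2 i) x.
  by move=> /rrho xr; apply: C1atD; apply: C1atM => //; [exact: uC|exact: duC].
have ring0 x : r / 2 <= `|x : V| -> `|x| < r ->
    [/\ f2 x = 0, (forall i, df2 i x = 0) & forall i j, ddf2 i j x = 0].
  move=> x1 x2; have [_ _ NB] := r3 _ x2.
  have [HX|HX] := leP 0 (N x + 2 * radius * height e x).
    have wx : ~~ bo x.
      rewrite /bo -leNgt /om /m0; have := weight_le NB HX.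
      have : r ^+ 2 / 4 <= N x.
        apply: le_trans (sqr_norm_le_sum x).
        by rewrite (_ : r ^+ 2 / 4 = (r / 2) ^+ 2) ?lerXn2r ?nnegrE ?divr_ge0 ?(ltW r0)//; field.
      by lra.
    have cut0 f : cutoff bo f x = 0 by rewrite /cutoff (negbTE wx).
    by split=> [|i|i j]; rewrite /f2 /df2 /ddf2 /chi /dchi /ddchi !cut0 !mul0r ?addr0.
  have ux0 : \forall y \near x, u y = 0.
    have hC : C1at (fun x : V => N x + 2 * radius * height e x)
        (fun i x => 2 * x 0 i + 2 * radius * e 0 i) x.
      have sC : C1at (fun x : V => N x) (fun i x => 2 * x 0 i) x.
        apply: C1at_ext (C1at_sumT (fun (j : 'I_n) => C1atM (C1at_coord j x) (C1at_coord j x))) => [y|i y] /=.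
          by apply: eq_bigr => j _; rewrite expr2.
        rewrite -(sum_delta (fun j => 2 * y 0 j)).
        by apply: eq_bigr => j _; ring.
      exact: C1atD sC (C1atZ (2 * radius) (C1at_height e x)).
    have [hc _ _] := hC.
    have HX' : 0 < - (N x + 2 * radius * height e x) by rewrite oppr_gt0.
    have [d d0 dP] := (cvg_rVP _ _).1 hc _ HX'.
    apply/nearP; exists (Num.min d (r - `|x|)) => [|y]; first by rewrite lt_min d0 subr_gt0.
    rewrite lt_min => /andP[/dP /ltr_normlP[h1 h2] yx].
    apply: u0; last by lra.
    apply: rrho; have := ler_normD (y - x) x; rewrite subrK; lra.
  have near_r : \forall y \near x, `|y : V| < r.
    apply/nearP; exists (r - `|x|) => [|y yx]; first by rewrite subr_gt0.
    by have := ler_normD (y - x) x; rewrite subrK; lra.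
  have dux0 i : \forall y \near x, du i y = 0.
    have H := near_join ux0.
    by near=> y; apply: (C1at_near0 (f := u)); [near: y; exact: H|apply: uC; apply: rrho; near: y].
  have dd i j : ddu i j x = 0.
    by apply: (C1at_near0 (dux0 i)); apply: duC; exact: rrho.
  have ux := nbhs_singleton ux0; have dx i := nbhs_singleton (dux0 i).
  by split=> [|i|i j]; rewrite /f2 /df2 /ddf2 ?ux ?dx ?dd; rewrite ?dx !mulr0 ?addr0.
pose bb x := `|x : V| < 3 / 4 * r.
have r34 : 3 / 4 * r < r by lra.
have bb_near x : [\/ \forall y \near x, bb y, \forall y \near x, ~~ bb y | `|x : V| = 3 / 4 * r].
  rewrite /bb; case: (ltgtP `|x : V| (3 / 4 * r)) => xr; [apply: Or31|apply: Or32|exact: Or33].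
    apply/nearP; exists (3 / 4 * r - `|x|) => [|y yx]; first by rewrite subr_gt0.
    by have := ler_normD (y - x) x; rewrite subrK; lra.
  apply/nearP; exists (`|x| - 3 / 4 * r) => [|y yx]; first by rewrite subr_gt0.
  by rewrite -leNgt; have := ler_normD (x - y) y; rewrite subrK distrC; lra.
pose U := cutoff bb f2; pose dU i := cutoff bb (df2 i).
pose ddU i j := cutoff bb (ddf2 i j).
have bbr x : (\forall y \near x, bb y) -> `|x : V| < r.
  by move=> /nbhs_singleton xr; exact: lt_trans r34.
have UC x : C1at U dU x.
  apply: C1at_cutoff; have [bx|bx|bx] := bb_near x; [apply: Or31|exact: Or32|apply: Or33].
    by split=> //; apply: f2C; exact: bbr.
  have [|//|h1 h2 h3] := ring0 x; rewrite ?bx; [lra|exact: r34|].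
  by split=> //; apply: f2C; rewrite bx.
have dUC i x : C1at (dU i) (ddU i) x.
  apply: C1at_cutoff; have [bx|bx|bx] := bb_near x; [apply: Or31|exact: Or32|apply: Or33].
    by split=> //; apply: df2C; exact: bbr.
  have [|//|h1 h2 h3] := ring0 x; rewrite ?bx; [lra|exact: r34|].
  by split=> //; apply: df2C; rewrite bx.
have far x : 1 / 2 <= `|x : V| -> bb x = false by move=> x2; apply/negbTE; rewrite /bb -leNgt; lra.
have sU : supported U by move=> x /far; rewrite /U /cutoff => ->.
have sdU i : supported (dU i) by move=> x /far; rewrite /dU /cutoff => ->.
have sddU i j : supported (ddU i j) by move=> x /far; rewrite /ddU /cutoff => ->.
pose Q := B ^+ 2 + 1; have Q0 : 0 <= Q by rewrite addr_ge0 ?sqr_ge0.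
pose al := dlt^-1; have al0 : 0 < al by rewrite invr_gt0.
pose d : R := `|\sum_i ddw i i|.
pose K' := 3 * (K + 36 * al ^+ 2 * Q) * (2 + 18 * al ^+ 2 * Q) + 3 * (6 * al ^+ 2 * Q + 3 * al * d) ^+ 2.
have A2 : 0 <= al ^+ 2 * Q by rewrite mulr_ge0 ?sqr_ge0.
have K'0 : 0 <= K'.
  by apply: addr_ge0; [apply: mulr_ge0; [apply: mulr_ge0 => //|]; lra|
    apply: mulr_ge0 => //; exact: sqr_ge0].
have beta0 : 0 < B ^+ 2 / 2 by rewrite divr_gt0 ?exprn_gt0.
have region x : [/\ U x = 0, (forall i, dU i x = 0) & forall i j, ddU i j x = 0] \/
     B ^+ 2 / 2 <= pweight e B x /\ qweight e B x <= Q.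
  have [bx|bx] := boolP (bb x); [right|left].
    by have [] := r3 x (lt_trans bx r34).
  by rewrite /U /dU /ddU /cutoff (negbTE bx).
have ineq x : m0 + dlt <= w x ->
    (\sum_i ddU i i x) ^+ 2 <= K' * ((\sum_i dU i x ^+ 2) + U x ^+ 2).
  move=> wx; rewrite /U /dU /ddU /cutoff.
  have [bx|bx] := boolP (bb x); last first.
    rewrite [leLHS](_ : _ = 0); last by rewrite big1// expr0n.
    apply: mulr_ge0 => //; apply: addr_ge0; last exact: sqr_ge0.
    by apply: sumr_ge0 => i _; exact: sqr_ge0.
  have xr : `|x| < r by exact: lt_trans r34.
  have [_ qx _] := r3 x xr.
  have od : dlt <= om x by rewrite /om; lra.
  have o0 : 0 < om x by exact: lt_le_trans od.
  have box : bo x by [].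
  have cut1 f : cutoff bo f x = f x by rewrite /cutoff box.
  pose a := (om x)^-1; have a0 : 0 < a by rewrite invr_gt0.
  have aal : a <= al by rewrite /a /al lef_pV2 ?posrE.
  pose y i := om x ^+ 3 * du i x.
  have ao : a * om x = 1 by rewrite mulVf// gt_eqF.
  have EU : f2 x = om x ^+ 3 * u x by rewrite /f2 /chi cut1.
  have EdU i : df2 i x = y i + 3 * a * dw i x * f2 x.
    rewrite EU /df2 /chi /dchi !cut1 /df1 /f1 /y.
    have E1 : 3 * a * dw i x * (om x ^+ 3 * u x) =
      (a * om x) * (3 * om x ^+ 2 * dw i x * u x) by ring.
    by rewrite E1 ao; ring.
  have EddU : \sum_i ddf2 i i x = om x ^+ 3 * (\sum_i ddu i i x) +
     6 * a * (\sum_i dw i x * y i) +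
     (6 * a ^+ 2 * qweight e B x + 3 * a * \sum_i ddw i i) * f2 x.
    rewrite [RHS](_ : _ = \sum_i (om x ^+ 3 * ddu i i x + 6 * a * (dw i x * y i) +
      (6 * a ^+ 2 * dw i x ^+ 2 + 3 * a * ddw i i) * f2 x)); last first.
      rewrite [RHS]big_split/= [X in _ = X + _]big_split/=; congr (_ + _ + _); first by rewrite mulr_sumr.
        by rewrite mulr_sumr.
      rewrite -mulr_suml; congr (_ * _); rewrite [RHS]big_split/= /qweight.
      by congr (_ + _); rewrite mulr_sumr.
    apply: eq_bigr => i _; rewrite EU /ddf2 /ddchi /dchi /chi !cut1 /ddf1 /df1 /f1 /y.
    have E1 : 6 * a * (dw i x * (om x ^+ 3 * du i x)) = (a * om x) * (6 * om x ^+ 2 * dw i x * du i x) by ring.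
    have E2 : 6 * a ^+ 2 * dw i x ^+ 2 * (om x ^+ 3 * u x) = (a * om x) ^+ 2 * (6 * om x * dw i x ^+ 2 * u x) by ring.
    have E3 : 3 * a * ddw i i * (om x ^+ 3 * u x) = (a * om x) * (3 * om x ^+ 2 * ddw i i * u x) by ring.
    by rewrite [X in _ = _ + X]mulrDl E1 E2 E3 ao; ring.
  rewrite EddU.
  pose Y := \sum_i y i ^+ 2; pose T := \sum_i df2 i x ^+ 2; pose F := f2 x ^+ 2.
  have Y0 : 0 <= Y by rewrite sumr_ge0// => i _; exact: sqr_ge0.
  have T0 : 0 <= T by rewrite sumr_ge0// => i _; exact: sqr_ge0.
  have F0 : 0 <= F by exact: sqr_ge0.
  have q0' : 0 <= qweight e B x by rewrite sumr_ge0// => i _; exact: sqr_ge0.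
  have hP : (om x ^+ 3 * \sum_i ddu i i x) ^+ 2 <= K * Y.
    have -> : K * Y = (om x ^+ 3) ^+ 2 * (K * \sum_i du i x ^+ 2).
      rewrite mulrCA; congr (_ * _); rewrite mulr_sumr; apply: eq_bigr => i _.
      by rewrite /y exprMn.
    by rewrite exprMn ler_wpM2l ?sqr_ge0//; apply: upde; exact: rrho.
  have hS : (\sum_i dw i x * y i) ^+ 2 <= Q * Y.
    by apply: (le_trans (sum_cauchy_schwarz _ _)); rewrite ler_wpM2r.
  have a2 : a ^+ 2 <= al ^+ 2 by rewrite lerXn2r ?nnegrE ?(ltW a0) ?(ltW al0).
  have aq : a ^+ 2 * qweight e B x <= al ^+ 2 * Q by rewrite ler_pM ?sqr_ge0.
  have hY : Y <= 2 * T + 18 * (al ^+ 2 * Q) * F.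
    apply: (@le_trans _ _ (2 * T + 18 * (a ^+ 2 * qweight e B x) * F)); last first.
      by rewrite lerD2l ler_wpM2r// ler_wpM2l.
    rewrite /Y /T /qweight !mulr_sumr mulr_suml -big_split/=; apply: ler_sum => i _.
    rewrite EdU -subr_ge0 [leRHS](_ : _ = (y i + 6 * a * dw i x * f2 x) ^+ 2); last by rewrite /F; ring.
    exact: sqr_ge0.
  have aq0 : 0 <= a ^+ 2 * qweight e B x by rewrite mulr_ge0 ?sqr_ge0.
  exact: absorb_square K0 A2 T0 hP hS a2 (coefficient_square_le _ (ltW a0) aal aq0 aq) hY.
have m1w : m0 + dlt < w 0.
  by rewrite /m0 /dlt; have := exprn_gt0 2 r0; lra.
have Uc := carleman_uc UC dUC sU sdU sddU K'0 Q0 beta0 region ineq.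
have [cw _ _] := C1at_weight e B 0.
have mw : 0 < w 0 - (m0 + dlt) by rewrite subr_gt0.
have [d1 d10 d1P] := (cvg_rVP _ _).1 cw _ mw.
apply/nearP; exists (Num.min d1 (r / 2)) => [|x]; first by rewrite lt_min d10 divr_gt0.
rewrite subr0 lt_min => /andP[xd xr].
have := d1P x; rewrite subr0 => /(_ xd) /ltr_normlP[h1 h2].
have wx : m0 + dlt < w x by lra.
have := Uc x (_ : `|x| <= 1 / 2) wx.
have x12 : `|x| <= 1 / 2 by lra.
move=> /(_ x12); rewrite /U /f2 /chi /cutoff /bb /bo.
rewrite (_ : `|x| < 3 / 4 * r); last by lra.
rewrite (_ : 0 < om x); last by rewrite /om; lra.
move/eqP; rewrite /f1 mulf_eq0 expf_eq0/= => /orP[|/eqP//].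
by rewrite gt_eqF// /om; lra.
Unshelve. all: by end_near. Qed.

End uc_sphere.

(** * Weak unique continuation *)

Section weak_uc.
Variables (R : realType) (n : nat).
Local Notation V := 'rV[R]_n.
Implicit Types (f u : V -> R) (x y z : V).

Lemma C1at_translate f df x (a : V) : C1at f df (x + a) ->
  C1at (fun y => f (y + a)) (fun i y => df i (y + a)) x.
Proof.
have tr (g : V -> R) : g y @[y --> x + a] --> g (x + a) ->
    g (y + a) @[y --> x] --> g (x + a).
  move=> /cvg_rVP gc; apply/(cvg_rVP (fun y => g (y + a))) => e e0.
  have [d d0 dP] := gc e e0; exists d => // y yx; apply: dP.
  by rewrite opprD addrACA subrr addr0.
move=> [cf Df cdf]; split=> [|i|i]; [exact: tr| |exact: tr].
exact: is_derive_translate.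
Qed.

Lemma open_near_set (P : V -> Prop) : open [set x | \forall y \near x, P y].
Proof. by rewrite openE => x /= /near_join. Qed.

(** Weak unique continuation. If the zero set of u had a boundary point in the
    ball, a ball inside the zero set could be made to touch its complement at
    a point p, against [uc_sphere] at p. *)
Lemma weak_uc u du ddu (c0 : V) (rho K : R) : 0 <= K ->
  (forall x, `|x - c0| < rho -> C1at u du x) ->
  (forall i x, `|x - c0| < rho -> C1at (du i) (ddu i) x) ->
  (forall x, `|x - c0| < rho ->
     (\sum_i ddu i i x) ^+ 2 <= K * \sum_i du i x ^+ 2) ->
  forall z, `|z - c0| < rho -> (\forall x \near z, u x = 0) ->
  forall x, `|x - c0| < rho -> u x = 0.
Proof.
move=> K0 uC duC upde z zrho uz b brho; apply: contrapT => ub.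
pose Z : set V := [set x | \forall y \near x, u y = 0].
have oZ : open Z by exact: open_near_set.
have bZ : ~ Z b by move=> /nbhs_singleton.
pose g (t : R) : V := z + t *: (b - z).
have gc : continuous g.
  move=> t; apply: cvgD; first exact: cvg_cst.
  by apply: cvgZr_tmp; exact: cvg_id.
have grho (t : R) : 0 <= t <= 1 -> `|g t - c0| < rho.
  move=> /andP[t0 t1].
  rewrite (_ : g t - c0 = (1 - t) *: (z - c0) + t *: (b - c0)); last first.
    by apply/rowP => i; rewrite !mxE; ring.
  apply: (le_lt_trans (ler_normD _ _)); rewrite !normrZ (ger0_norm t0) ger0_norm ?subr_ge0//.
  set s := `|z - c0|; set s' := `|b - c0|.
  apply: (@le_lt_trans _ _ (Num.max s s')); last by rewrite gt_max zrho.
  have h1 : s <= Num.max s s' by rewrite le_max lexx.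
  have h2 : s' <= Num.max s s' by rewrite le_max lexx orbT.
  rewrite [leRHS](_ : _ = (1 - t) * Num.max s s' + t * Num.max s s'); last by ring.
  by apply: lerD; rewrite ler_wpM2l ?subr_ge0.
pose A := `[0, 1] `&` g @^-1` (~` Z).
have cA : compact A.
  apply: compact_closedI; first exact: segment_compact.
  by apply: closed_comp => [t _|]; [exact: gc|exact: open_closedC].
have A0 : A !=set0.
  exists 1; split; first by rewrite /= in_itv/= ler01 lexx.
  by rewrite /g /= scale1r addrC subrK.
(* the first exit from the interior Z of the zero set along a segment *)
have [ts tsA tsmin] := compact_EVT_min A0 cA (f := id) (continuous_subspaceT (fun _ => cvg_id)).
move: tsA; rewrite inE => -[/= ts01 gts].
have ts0 : 0 < ts.
  move: ts01; rewrite in_itv/= => /andP[]; rewrite le_eqVlt => /orP[/eqP ts0|//] _.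
  by exfalso; apply: gts; rewrite -ts0 /g scale0r addr0.
pose q : V := g ts.
have qrho : `|q - c0| < rho by apply: grho; move: ts01; rewrite in_itv.
pose eta := rho - `|q - c0|; have eta0 : 0 < eta by rewrite subr_gt0.
have n1 : (0 : R) < n%:R + 1 by rewrite ltr_wpDl.
have [ep ep0 epE] : exists2 ep : R, 0 < ep & (n%:R + 1) * ep = eta / 4.
  exists (eta / (4 * (n%:R + 1))); first by rewrite divr_gt0// mulr_gt0.
  by field; rewrite gt_eqF.
have [t [t0 tts tq]] : exists t, [/\ 0 <= t, t < ts & `|g t - q| < ep].
  have /cvgrPdist_lt/(_ _ ep0)/nbhs_normP[d /= d0 dP] := gc ts.
  pose t := Num.max 0 (ts - d / 2).
  have h1 : t < ts by rewrite gt_max ts0; lra.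
  have h2 : ts - d / 2 <= t by rewrite le_max lexx orbT.
  exists t; split=> //; first by rewrite le_max lexx.
  rewrite distrC; apply: dP; rewrite /ball_/= ger0_norm; lra.
pose c : V := g t.
have cZ : Z c.
  apply: contrapT => cZ; have := tsmin t; rewrite leNgt tts inE => H.
  suff /H : A t by [].
  by split=> //; move: ts01; rewrite /= !in_itv/= t0 => /andP[_ ts1]; lra.
(* p: a nearest point to c outside Z *)
pose D x := \sum_i (x 0 i - c 0 i) ^+ 2.
have DC x : C1at D (fun i x => 2 * (x 0 i - c 0 i)) x.
  have C := C1at_sumT (fun j : 'I_n => C1atM (C1atB (C1at_coord j x) (C1at_cst (c 0 j) x))
     (C1atB (C1at_coord j x) (C1at_cst (c 0 j) x))).
  apply: C1at_ext C => [y|i y].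
    by apply: eq_bigr => j _; rewrite expr2.
  rewrite -(sum_delta (fun j => 2 * (y 0 j - c 0 j))).
  by apply: eq_bigr => j _; ring.
pose Kc := [set x | `|x - q| <= eta / 2] `&` ~` Z.
have cK : compact Kc.
  by apply: compact_closedI; [exact: compact_cball|exact: open_closedC].
have Kq : Kc q by split=> //=; rewrite subrr normr0 divr_ge0// ltW.
have [|p] := compact_EVT_min (ex_intro _ q Kq) cK (f := D).
  by apply: continuous_subspaceT => x; have [h _ _] := DC x; exact: h.
rewrite inE => -[/= pq pZ] pmin.
have Dp0 : 0 < D p.
  rewrite lt_def sumr_ge0 ?andbT => [|i _]; last exact: sqr_ge0.
  apply/eqP => Dp; apply: pZ; rewrite (_ : p = c)//.
  apply/eqP; rewrite -subr_eq0 -normr_eq0 -sqrf_eq0 eq_le sqr_ge0 andbT -Dp.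
  apply: (le_trans (sqr_norm_le_sum _)); apply: ler_sum => i _; by rewrite !mxE.
pose rad := Num.sqrt (D p); have rad0 : 0 < rad by rewrite sqrtr_gt0.
have rad2 : rad ^+ 2 = D p by rewrite sqr_sqrtr// ltW.
have Dnorm x : D x = \sum_i (x - c) 0 i ^+ 2.
  by apply: eq_bigr => i _; rewrite !mxE.
have Dsmall x : D x <= D p -> `|x - q| < eta / 2.
  move=> Dx.
  have h1 : D x <= n%:R * ep ^+ 2.
    apply: (le_trans Dx); apply: (@le_trans _ _ (D q)); first by apply: pmin; rewrite inE.
    rewrite Dnorm; apply: (le_trans (sum_le_sqr_norm _)).
    by rewrite ler_wpM2l// lerXn2r ?nnegrE ?(ltW ep0)// distrC ltW.
  have h2 : `|x - c| <= eta / 4.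
    rewrite -(@ler_pXn2r _ 2)// ?nnegrE ?divr_ge0 ?(ltW eta0)//.
    apply: (le_trans (sqr_norm_le_sum _)); rewrite -Dnorm; apply: (le_trans h1).
    rewrite -epE exprMn; apply: ler_wpM2r; first exact: sqr_ge0.
    by move: (ler0n R n) => n0; clear -n0; nra.
  have h3 : ep <= eta / 4.
    by rewrite -epE ler_peMl ?(ltW ep0)// lerDr.
  rewrite -(subrKA c) (le_lt_trans (ler_normD _ _))//; lra.
have uball x : D x < D p -> u x = 0.
  move=> Dx; suff xZ : Z x by exact: (nbhs_singleton xZ).
  apply: contrapT => xZ; suff /(pmin x) : x \in Kc by rewrite leNgt Dx.
  by rewrite inE; split=> //=; apply/ltW/Dsmall/ltW.
have prho y : `|y| < eta / 2 -> `|y + p - c0| < rho.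
  move=> ye; rewrite -addrA (le_lt_trans (ler_normD _ _))//.
  have := Dsmall p (lexx _); have := ler_normD (p - q) (q - c0).
  rewrite subrKA; move: ye eta0; rewrite /eta; clear; lra.
pose e : V := rad^-1 *: (p - c).
have e1 : \sum_i e 0 i ^+ 2 = 1.
  rewrite (eq_bigr (fun i => rad ^- 2 * (p 0 i - c 0 i) ^+ 2)) => [|i _].
    by rewrite -mulr_sumr -/(D p) rad2 mulVf// gt_eqF.
  by rewrite !mxE exprMn exprVn.
have eta2 : 0 < eta / 2 by rewrite divr_gt0.
apply: pZ.
have := @uc_sphere _ _ e rad e1 rad0 (fun y => u (y + p)) (fun i y => du i (y + p))
  (fun i j y => ddu i j (y + p)) (eta / 2) K eta2 K0.
move=> H.
have /nearP[d d0 dP] : \forall x \near (0 : V), u (x + p) = 0.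
  apply: H => [x /prho xr|i x /prho xr|x /prho xr|x xr Nx].
  - by apply: C1at_translate; exact: uC.
  - by apply: C1at_translate; exact: duC.
  - exact: upde.
  - apply: uball; rewrite -subr_lt0; apply: le_lt_trans Nx.
    rewrite /height mulr_sumr -big_split/= /D -sumrB le_eqVlt; apply/orP; left; apply/eqP.
    apply: eq_bigr => i _; rewrite !mxE; field; rewrite gt_eqF//.
apply/nearP; exists d => // y yp; have := dP (y - p); rewrite subr0 subrK; exact.
Qed.

End weak_uc.

(** * The inverse function theorem *)

Lemma le_half_le0 (R : realType) (x y : R) : y <= 1 / 2 * x -> x <= y -> x <= 0.
Proof. by lra. Qed.

Section matrix_C1.
Variables (R : realType) (n : nat).
Local Notation V := 'rV[R]_n.

Lemma C1at_prod_ex (I : finType) (F : I -> V -> R) (dF : I -> 'I_n -> V -> R) :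
  exists dP, forall y, (forall k, C1at (F k) (dF k) y) ->
    C1at (fun x => \prod_k F k x) dP y.
Proof.
elim: (index_enum I) => [|k r [dP IH]].
  exists (fun _ _ => 0) => y _.
  by apply: C1at_ext (C1at_cst 1 y) => [z|i z]; rewrite ?big_nil.
eexists => y Fy.
by apply: C1at_ext (C1atM (Fy k) (IH _ Fy)) => [z|i z]; rewrite ?big_cons.
Qed.

Lemma C1at_det m (M : V -> 'M[R]_m) (dM : 'I_m -> 'I_m -> 'I_n -> V -> R) :
  exists dD, forall y, (forall i j, C1at (fun x => M x i j) (dM i j) y) ->
    C1at (fun x => \det (M x)) dD y.
Proof.
have H (s : {perm 'I_m}) : exists dP, forall y,
    (forall k, C1at (fun x => M x k (s k)) (dM k (s k)) y) ->
    C1at (fun x => \prod_k M x k (s k)) dP y.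
  exact: (C1at_prod_ex (fun k x => M x k (s k)) (fun k => dM k (s k))).
have [dP dPP] := choice H.
exists (fun i x => \sum_(s : {perm 'I_m}) (-1) ^+ s * dP s i x) => y My.
have sC (s : {perm 'I_m}) := C1atZ ((-1) ^+ s) (dPP s y (fun k => My k (s k))).
exact: (C1at_sumT sC).
Qed.

Lemma unitmx_near m (M : V -> 'M[R]_m) (dM : 'I_m -> 'I_m -> 'I_n -> V -> R) y :
  (forall i j, C1at (fun x => M x i j) (dM i j) y) -> M y \in unitmx ->
  \forall x \near y, M x \in unitmx.
Proof.
move=> My Mu; have [dD dDP] := C1at_det M dM; have [cd _ _] := dDP y My.
have d0 : 0 < `|\det (M y)| by rewrite normr_gt0 -unitfE -unitmxE.
have [d dp dP] := (cvg_rVP _ _).1 cd _ d0.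
apply/nearP; exists d => // x /dP; rewrite unitmxE unitfE.
by apply: contraTneq => ->; rewrite sub0r normrN ltxx.
Qed.

(** Cramer's rule. The derivatives are chosen before the point, so that they can be
    composed and their continuity used. *)
Lemma C1at_invmx m (M : V -> 'M[R]_m) (dM : 'I_m -> 'I_m -> 'I_n -> V -> R) :
  exists dI : 'I_m -> 'I_m -> 'I_n -> V -> R, forall y,
    (forall i j, C1at (fun x => M x i j) (dM i j) y) -> M y \in unitmx ->
    forall i j, C1at (fun x => invmx (M x) i j) (dI i j) y.
Proof.
have [dD dDP] := C1at_det M dM.
have H (ij : 'I_m * 'I_m) : exists dC, forall y,
    (forall a b, C1at (fun x => (row' ij.2 (col' ij.1 (M x))) a b)
      (dM (lift ij.2 a) (lift ij.1 b)) y) ->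
    C1at (fun x => \det (row' ij.2 (col' ij.1 (M x)))) dC y.
  exact: (C1at_det (fun x => row' ij.2 (col' ij.1 (M x)))
    (fun a b => dM (lift ij.2 a) (lift ij.1 b))).
have [dC dCP] := choice H.
eexists => y My Mu i j.
have dy : \det (M y) != 0 by rewrite unitmxE unitfE in Mu.
have cC : C1at (fun x => \adj (M x) i j)
    (fun k x => (-1) ^+ (j + i) * dC (i, j) k x) y.
  apply: C1at_ext (C1atZ ((-1) ^+ (j + i)) (dCP (i, j) y _)) => //.
    by move=> x; rewrite mxE.
  move=> a b; apply: C1at_ext (My (lift j a) (lift i b)) => // x.
  by rewrite !mxE.
have nz := unitmx_near My Mu.
apply: C1at_near_eq (C1atM (C1atV dy (dDP y My)) cC); last first.
  by move=> k; near=> x; reflexivity.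
near=> x; have Mx : M x \in unitmx by near: x.
by rewrite /invmx Mx [RHS]mxE.
Unshelve. all: by end_near. Qed.

End matrix_C1.

Section inverse_function.
Variables (R : realType) (n : nat).
Local Notation V := 'rV[R]_n.

(** An upper bound of the operator norm for the sup norm, made positive by the
    added 1. *)
Definition mxnorm (A : 'M[R]_n) : R := 1 + \sum_i \sum_j `|A i j|.

Lemma mxnorm_gt0 A : 0 < mxnorm A.
Proof. by rewrite ltr_wpDr// sumr_ge0// => i _; rewrite sumr_ge0. Qed.

Lemma mulmx_norm (x : V) A : `|x *m A| <= mxnorm A * `|x|.
Proof.
apply: norm_le_coord => [|j]; first by rewrite mulr_ge0// ltW// mxnorm_gt0.
rewrite mxE; apply: (le_trans (ler_norm_sum _ _ _)).
apply: (@le_trans _ _ (\sum_i `|A i j| * `|x|)).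
  by apply: ler_sum => i _; rewrite normrM mulrC ler_wpM2l// coord_le_norm.
rewrite -mulr_suml ler_wpM2r// /mxnorm -[leLHS]add0r lerD//.
apply: ler_sum => i _; rewrite (bigD1 j)//= lerDl sumr_ge0//.
Qed.

Variables (h : V -> V) (dh : 'I_n -> 'I_n -> V -> R).

(** The Jacobian matrix acts on row vectors: its i-th row is the i-th partial
    derivative. *)
Definition jac (u : V) : 'M[R]_n := \matrix_(i, k) dh k i u.

Lemma vec_strict (u : V) : (forall k, \forall y \near u, C1at (fun x => h x 0 k) (dh k) y) ->
  forall eps : R, 0 < eps -> exists2 d : R, 0 < d & forall y z : V,
    `|y - u| < d -> `|z - u| < d ->
    `|h z - h y - (z - y) *m jac u| <= eps * `|z - y|.
Proof.
move=> hC eps eps0.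
have H k : exists d : R, 0 < d /\ forall y z : V, `|y - u| < d -> `|z - u| < d ->
    `|h z 0 k - h y 0 k - \sum_i dh k i u * (z 0 i - y 0 i)| <= eps * `|z - y|.
  by have [d d0 dP] := C1at_strict (hC k) eps0; exists d.
have [d dP] := choice H.
exists (\big[Num.min/1]_k d k).
  by apply: lt_bigmin => // k _; have [] := dP k.
move=> y z yd zd; apply: norm_le_coord => [|k]; first by rewrite mulr_ge0// ltW.
have le_d : \big[Num.min/1]_k d k <= d k by exact: bigmin_le_cond.
have [_ kP] := dP k.
have := kP y z (lt_le_trans yd le_d) (lt_le_trans zd le_d).
rewrite !mxE (eq_bigr (fun i => (z - y) 0 i * jac u i k))// => i _.
by rewrite !mxE mulrC.
Qed.

Variables (W : set V) (ddh : 'I_n -> 'I_n -> 'I_n -> V -> R).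
Hypothesis oW : open W.
Hypothesis hC : forall k u, W u -> C1at (fun x => h x 0 k) (dh k) u.
Hypothesis dhC : forall k i u, W u -> C1at (dh k i) (ddh k i) u.

Lemma hC_near k (u : V) : W u -> \forall y \near u, C1at (fun x => h x 0 k) (dh k) y.
Proof. move=> Wu; have nW : \forall y \near u, W y by exact: (open_nbhs_nbhs (conj oW Wu)).
by apply: filterS nW => y; exact: hC. Qed.

(** The map T w u = u - (h u - w) A, with A the inverse of the Jacobian matrix
    at u0, contracts a closed ball. Its fixed point is the minimizer of the
    displacement |T w u - u| over this compact ball, and is the inverse image
    k w; the estimate of strict differentiability gives the derivative of k. *)
Lemma inverse_function (u0 : V) : W u0 -> jac u0 \in unitmx ->
  exists rho del : R, exists k : V -> V, [/\ 0 < rho, 0 < del,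
    (forall w : V, `|w - h u0| < rho ->
      [/\ `|k w - u0| < del, W (k w), h (k w) = w & jac (k w) \in unitmx]),
    (forall u : V, `|u - u0| < del -> `|h u - h u0| < rho -> k (h u) = u) &
    (forall w : V, `|w - h u0| < rho -> forall j,
      C1at (fun w => k w 0 j) (fun l w => invmx (jac (k w)) l j) w)].
Proof.
move=> Wu0 J0.
have jacC i j u : W u -> C1at (fun u => jac u i j) (ddh j i) u.
  by move=> Wu; apply: C1at_ext (dhC j i Wu) => // y; rewrite mxE.
have [dI dIP] := C1at_invmx jac (fun i j => ddh j i).
set A := invmx (jac u0); set c := mxnorm A; have c0 : 0 < c by exact: mxnorm_gt0.
have e0 : 0 < (2 * c)^-1 by rewrite invr_gt0 mulr_gt0.
have [d d0 dP] := vec_strict (fun k => hC_near k Wu0) e0.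
have [dW dW0 dWP] : exists2 d : R, 0 < d & forall y : V, `|y - u0| < d -> W y /\ jac y \in unitmx.
  have nW : \forall y \near u0, W y by exact: (open_nbhs_nbhs (conj oW Wu0)).
  have nJ := unitmx_near (fun i j => jacC i j u0 Wu0) J0.
  have [d1 d10 d1P] := (nearP _ _).1 nJ.
  have [d2 d20 d2P] := (nearP _ _).1 nW.
  exists (Num.min d1 d2) => [|y]; first by rewrite lt_min d10.
  by rewrite lt_min => /andP[/d1P y1 /d2P Wy].
pose del := Num.min d dW / 2.
have m0 : 0 < Num.min d dW by rewrite lt_min d0.
have del0 : 0 < del by rewrite divr_gt0.
have deld (u : V) : `|u - u0| <= del -> `|u - u0| < d /\ `|u - u0| < dW.
  move=> H; have : `|u - u0| < Num.min d dW.
    by rewrite (le_lt_trans H)// /del ltr_pdivrMr// ltr_pMr// ltr1n.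
  by rewrite lt_min => /andP[].
pose T (w u : V) : V := u - (h u - w) *m A.
have Tlip (w u u' : V) : `|u - u0| <= del -> `|u' - u0| <= del -> `|T w u' - T w u| <= 1 / 2 * `|u' - u|.
  move=> /deld[ud _] /deld[u'd _].
  have -> : T w u' - T w u = - ((h u' - h u - (u' - u) *m jac u0) *m A).
    rewrite mulmxBl -mulmxA mulmxV// mulmx1 /T !mulmxBl.
    by rewrite !opprB; apply/rowP => i; rewrite !mxE; ring.
  rewrite normrN (le_trans (mulmx_norm _ _))//.
  apply: (le_trans (ler_wpM2l (ltW c0) (dP _ _ ud u'd))).
  by rewrite mulrA ler_wpM2r// -/c invfM mulrCA mulfV ?gt_eqF// mulr1 mul1r.
have expand (u u' : V) : `|u - u0| <= del -> `|u' - u0| <= del -> `|u' - u| <= 2 * c * `|h u' - h u|.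
  move=> ud u'd; have := Tlip 0 u u' ud u'd.
  have -> : T 0 u' - T 0 u = (u' - u) - (h u' - h u) *m A.
    by rewrite /T !subr0 mulmxBl; apply/rowP => i; rewrite !mxE; ring.
  move=> H; have := mulmx_norm (h u' - h u) A; rewrite -/c => H2.
  have := ler_normD ((u' - u) - (h u' - h u) *m A) ((h u' - h u) *m A).
  rewrite subrK; move: H H2; lra.
pose rho := del / (4 * c); have rho0 : 0 < rho by rewrite divr_gt0// mulr_gt0.
have fix_pt (w : V) : `|w - h u0| < rho -> exists u : V, `|u - u0| < del /\ h u = w.
  move=> wr.
  have T0 : `|T w u0 - u0| <= del / 4.
    rewrite /T addrAC subrr sub0r normrN (le_trans (mulmx_norm _ _))//.
    rewrite distrC -/c mulrC -ler_pdivlMr// (le_trans (ltW wr))// /rho.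
    by rewrite invfM mulrA.
  pose U := [set u : V | `|u - u0| <= del].
  have TU : {homo T w : u / U u >-> U u}.
    move=> u; rewrite /U /= => ud; rewrite -(subrKA (T w u0)) (le_trans (ler_normD _ _))//.
    have uu0 : `|u0 - u0| <= del by rewrite subrr normr0 ltW.
    have := Tlip w u0 u uu0 ud; move: T0 ud del0; lra.
  have U0 : U !=set0 by exists u0; rewrite /U /= subrr normr0 ltW.
  have cU : compact U by exact: compact_cball.
  pose L := c * ((2 * c)^-1 + mxnorm (jac u0)).
  have L0 : 0 < L by rewrite mulr_gt0// addr_gt0 ?mxnorm_gt0.
  have [|u uU umin] := compact_EVT_min U0 cU (f := fun u => `|T w u - u|).
    apply: continuous_in_subspaceT => u; rewrite inE => /deld[ud _].
    apply/(cvg_rVP (fun u => `|T w u - u|)) => ep ep0.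
    exists (Num.min (d - `|u - u0|) (ep / L)).
      by rewrite lt_min subr_gt0 ud divr_gt0.
    move=> u'; rewrite lt_min => /andP[u'd u'e].
    have {}u'd : `|u' - u0| < d.
      by rewrite -(subrKA u) (le_lt_trans (ler_normD _ _))//; move: u'd; lra.
    apply: (le_lt_trans (ler_dist_dist _ _)).
    have -> : T w u' - u' - (T w u - u) = - ((h u' - h u) *m A).
      by rewrite /T !mulmxBl; apply/rowP => i; rewrite !mxE; ring.
    rewrite normrN (le_lt_trans (mulmx_norm _ _))// -/c.
    have := dP u u' ud u'd; have := mulmx_norm (u' - u) (jac u0).
    have := ler_normD (h u' - h u - (u' - u) *m jac u0) ((u' - u) *m jac u0).
    rewrite subrK => a1 a2 a3.
    apply: (@le_lt_trans _ _ (L * `|u' - u|)); last by rewrite mulrC -ltr_pdivlMr.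
    rewrite /L -mulrA ler_wpM2l ?(ltW c0)// mulrDl.
    by move: a1 a2 a3; lra.
  rewrite inE in uU; have Uu : `|u - u0| <= del by [].
  have Eu : u = T w u.
    have UT : T w u \in U by rewrite inE; exact: TU.
    have := umin _ UT; have := Tlip w u (T w u) Uu (TU _ uU).
    move=> a1 a2; apply/eqP; rewrite eq_sym -subr_eq0 -normr_le0.
    exact: le_half_le0 a1 a2.
  have hu : h u = w.
    have : (h u - w) *m A = 0.
      have : u - T w u = 0 by rewrite {1}Eu subrr.
      by rewrite /T opprB addrC subrK.
    move/(congr1 (mulmx^~ (jac u0))); rewrite mul0mx -mulmxA mulVmx// mulmx1.
    by move/eqP; rewrite subr_eq0 => /eqP.
  exists u; split=> //; rewrite Eu.
  have uu0 : `|u0 - u0| <= del by rewrite subrr normr0 ltW.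
  rewrite -(subrKA (T w u0)) (le_lt_trans (ler_normD _ _))//.
  have := Tlip w u0 u uu0 Uu; move: T0 Uu del0; rewrite /U /=; lra.
pose k (w : V) : V := xget u0 [set u : V | `|u - u0| < del /\ h u = w].
have kP (w : V) : `|w - h u0| < rho -> `|k w - u0| < del /\ h (k w) = w.
  by move=> /fix_pt wP; exact: (@xgetPex _ u0 [set u : V | `|u - u0| < del /\ h u = w] wP).
have kJ (w : V) : `|w - h u0| < rho -> W (k w) /\ jac (k w) \in unitmx.
  by move=> /kP[/ltW/deld[_ h1] _]; exact: dWP.
exists rho, del, k; split=> //.
- by move=> w wr; have [h1 h2] := kP w wr; have [h3 h4] := kJ w wr.
- move=> u ud uh; have [h1 h2] := kP _ uh.
  apply/eqP; rewrite -subr_eq0 -normr_le0.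
  by have := expand u (k (h u)) (ltW ud) (ltW h1); rewrite h2 subrr normr0 mulr0.
move=> w wr j; have [kd hk] := kP w wr; have [Wk Jk] := kJ w wr.
set u := k w in kd hk Wk Jk *.
have near_rho (w' : V) : `|w' - w| < rho - `|w - h u0| -> `|w' - h u0| < rho.
  by move=> H; rewrite -(subrKA w) (le_lt_trans (ler_normD _ _))//; move: H; lra.
have kLip (w' : V) : `|w' - h u0| < rho -> `|k w' - u| <= 2 * c * `|w' - w|.
  move=> w'r; have [k'd hk'] := kP w' w'r.
  by have := expand u (k w') (ltW kd) (ltW k'd); rewrite hk' hk.
have rho'0 : 0 < rho - `|w - h u0| by rewrite subr_gt0.
have c20 : 0 < 2 * c by rewrite mulr_gt0.
have kc : k w' @[w' --> w] --> k w.
  apply/cvgrPdist_lt => e ep; apply/nearP.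
  exists (Num.min (rho - `|w - h u0|) (e / (2 * c))).
    by rewrite lt_min rho'0 divr_gt0.
  move=> w'; rewrite lt_min => /andP[/near_rho w'r w'e].
  by rewrite distrC (le_lt_trans (kLip w' w'r))// mulrC -ltr_pdivlMr.
split.
- apply/(cvg_rVP (fun w => k w 0 j)) => e ep.
  move/cvgrPdist_lt : kc => /(_ e ep)/nearP[d1 d10 d1P].
  exists d1 => // w' /d1P; rewrite distrC; apply: le_lt_trans.
  by have := coord_le_norm (k w' - k w) j; rewrite !mxE.
- move=> l; apply: is_derive_of_eps => e ep.
  set B := invmx (jac u); have cB : 0 < mxnorm B by exact: mxnorm_gt0.
  have e'0 : 0 < e / (mxnorm B * (2 * c)) by rewrite divr_gt0// mulr_gt0.
  have [d1 d10 d1P] := vec_strict (fun k => hC_near k Wk) e'0.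
  pose d2 := Num.min (rho - `|w - h u0|) (d1 / (2 * c)).
  exists d2; first by rewrite lt_min rho'0 divr_gt0.
  move=> s; rewrite lt_min => /andP[sr sd1].
  pose w' := w + s *: stdvec R l.
  have ww' : `|w' - w| <= `|s|.
    by rewrite /w' addrAC subrr add0r normrZ ler_piMr// stdvec_norm.
  have w'r : `|w' - h u0| < rho by apply: near_rho; exact: le_lt_trans sr.
  have [k'd hk'] := kP w' w'r.
  have Lk := kLip w' w'r.
  have kd1 : `|k w' - u| < d1.
    apply: (le_lt_trans Lk); rewrite mulrC -ltr_pdivlMr//; exact: le_lt_trans sd1.
  have := d1P u (k w'); rewrite subrr normr0 => /(_ d10 kd1); rewrite hk' hk => H.
  have H2 := mulmx_norm (w' - w - (k w' - u) *m jac u) B.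
  rewrite mulmxBl -mulmxA mulmxV// mulmx1 in H2.
  have H3 := coord_le_norm ((w' - w) *m B - (k w' - u)) j.
  have E : k (w + s *: stdvec R l) 0 j - u 0 j - s * B l j =
      - (((w' - w) *m B - (k w' - u)) 0 j).
    have -> : w' - w = s *: stdvec R l by rewrite /w' addrAC subrr add0r.
    by rewrite -scalemxAl -rowE !mxE -/w'; ring.
  rewrite E normrN; apply: (le_trans H3); apply: (le_trans H2).
  apply: (le_trans (ler_wpM2l (ltW cB) H)).
  apply: (@le_trans _ _ (mxnorm B * (e / (mxnorm B * (2 * c)) * (2 * c * `|s|)))).
    rewrite ler_wpM2l ?(ltW cB)// ler_wpM2l ?(ltW e'0)//.
    by apply: (le_trans Lk); rewrite ler_wpM2l ?(ltW c20).
  by rewrite le_eqVlt; apply/orP; left; apply/eqP; field; rewrite !gt_eqF.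
- move=> l; have [cI _ _] := dIP u (fun i j => jacC i j u Wk) Jk l j.
  exact: (cvg_comp _ _ kc cI).
Qed.

End inverse_function.

(** * Inner products and projections *)

Section dot_algebra.
Variables (R : realType) (m : nat).
Implicit Types (u v w : 'rV[R]_m).

Lemma dotE u v : dot u v = (u *m v^T) 0 0.
Proof. by rewrite mxE; apply: eq_bigr => i _; rewrite mxE. Qed.

Lemma dotC u v : dot u v = dot v u.
Proof. by apply: eq_bigr => i _; rewrite mulrC. Qed.

Lemma dotDl u v w : dot (u + v) w = dot u w + dot v w.
Proof. by rewrite !dotE mulmxDl mxE. Qed.

Lemma dotBl u v w : dot (u - v) w = dot u w - dot v w.
Proof. by rewrite !dotE mulmxBl !mxE. Qed.

Lemma dotZl a u w : dot (a *: u) w = a * dot u w.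
Proof. by rewrite !dotE -scalemxAl mxE. Qed.

Lemma dotDr u v w : dot w (u + v) = dot w u + dot w v.
Proof. by rewrite dotC dotDl !(dotC w). Qed.

Lemma dotBr u v w : dot w (u - v) = dot w u - dot w v.
Proof. by rewrite dotC dotBl !(dotC w). Qed.

Lemma dotZr a u w : dot w (a *: u) = a * dot w u.
Proof. by rewrite dotC dotZl (dotC w). Qed.

Lemma dot0l u : dot 0 u = 0.
Proof. by rewrite dotE mul0mx mxE. Qed.

Lemma dot_suml (I : Type) (r : seq I) (F : I -> 'rV[R]_m) w :
  dot (\sum_(k <- r) F k) w = \sum_(k <- r) dot (F k) w.
Proof. by elim/big_rec2: _ => [|k x y _ <-]; rewrite ?dot0l ?dotDl. Qed.

Lemma dot_stdvec u (i : 'I_m) : dot u (stdvec R i) = u 0 i.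
Proof.
rewrite /dot (bigD1 i)//= big1 => [|j ji]; first by rewrite mxE !eqxx mulr1 addr0.
by rewrite mxE eqxx (negbTE ji) mulr0.
Qed.

Lemma dot_ge0 u : 0 <= dot u u.
Proof. by rewrite sumr_ge0// => i _; rewrite -expr2 sqr_ge0. Qed.

Lemma dot_eq0 u : dot u u = 0 -> u = 0.
Proof.
move=> /eqP; rewrite psumr_eq0 => [/allP H|i _]; last by rewrite -expr2 sqr_ge0.
apply/rowP => i; rewrite mxE; have := H i (mem_index_enum i).
by rewrite /= mulf_eq0 orbb => /eqP.
Qed.

Lemma enorm1 u : enorm u = 1 -> dot u u = 1.
Proof.
by move=> /(congr1 (fun t => t ^+ 2)); rewrite /enorm sqr_sqrtr ?dot_ge0// expr1n.
Qed.

End dot_algebra.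

Section frames.
Variables (R : realType) (n : nat).
Local Notation E := 'rV[R]_n.+1.

Lemma gram_unit (B : 'M[R]_(n, n.+1)) : row_free B -> B *m B^T \in unitmx.
Proof.
move=> Bf; rewrite -row_free_unit; apply: inj_row_free => x xg.
have xB : x *m B = 0.
  apply: dot_eq0; rewrite dotE trmx_mul mulmxA -(mulmxA x) xg mul0mx mxE//.
by apply/eqP; rewrite -(mulmx_free_eq0 x Bf) xB.
Qed.

(** The two terms are the orthogonal projections onto the row space of B and
    onto its normal line. *)
Lemma gram_projection (B : 'M[R]_(n, n.+1)) (v : E) :
  row_free B -> v *m v^T = 1%:M -> B *m v^T = 0 ->
  B^T *m invmx (B *m B^T) *m B + v^T *m v = 1%:M.
Proof.
move=> Bf v1 Bv; have gu := gram_unit Bf.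
have vB : v *m B^T = 0 by rewrite -[LHS]trmxK trmx_mul trmxK Bv trmx0.
pose C : 'M[R]_(1 + n, n.+1) := col_mx v B.
have Cu : (C : 'M[R]_n.+1) \in unitmx.
  rewrite -row_free_unit; apply: inj_row_free => x.
  rewrite -[x](@hsubmxK _ 1 1 n); move: (lsubmx _) (rsubmx _) => a b.
  rewrite /C (mul_row_col a b v B) => xC.
  have a0 : a = 0.
    have := congr1 (mulmx^~ v^T) xC.
    by rewrite mulmxDl -!mulmxA v1 mulmx1 Bv mulmx0 addr0 mul0mx.
  have b0 : b = 0.
    by apply/eqP; rewrite -(mulmx_free_eq0 _ Bf); move: xC; rewrite a0 mul0mx add0r => ->.
  by rewrite a0 b0 row_mx0.
set Q := _ + _.
have CQ : C *m Q = C.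
  rewrite mul_col_mx /Q; congr col_mx.
    by rewrite mulmxDr !mulmxA vB !mul0mx v1 mul1mx add0r.
  by rewrite mulmxDr !mulmxA Bv mul0mx addr0 mulmxV// mul1mx.
by rewrite -[Q](mulKmx Cu) CQ mulVmx.
Qed.

End frames.

(** * The soliton equation in a parametrization *)

Section parametrization.
Variables (R : realType) (n : nat).
Local Notation E := 'rV[R]_n.+1.
Variables (M : set E) (W : set 'rV[R]_n) (F : 'rV[R]_n -> E).
Hypothesis par : local_parametrization M W F.

Lemma param_iter_C1 vs (c : E) u : W u ->
  C1at (fun x => dot (iter_derive vs F x) c)
    (fun i x => dot (iter_derive (stdvec R i :: vs) F x) c) u.
Proof.
case: par => oW sm _ _ _ Wu.
have cont us : {for u, continuous (iter_derive us F)}.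
  have [//|+ _] := sm (size us) us _ (leqnn _).
  by rewrite continuous_open_subspace// => /(_ u); apply; rewrite inE.
have der us v : derivable (iter_derive us F) u v.
  have [//|_ +] := sm (size us).+1 us _ (leqnSn _).
  by apply.
have coordC us (j : 'I_n.+1) : iter_derive us F x 0 j @[x --> u] --> iter_derive us F u 0 j.
  apply: (@cvg_comp _ _ _ (iter_derive us F) (fun y : E => y 0 j) _ _ _ (cont us)).
  exact: coord_continuous.
have C j : C1at (fun x => iter_derive vs F x 0 j)
    (fun i x => iter_derive (stdvec R i :: vs) F x 0 j) u.
  split=> [|i|i]; [exact: coordC| |exact: coordC].
  split; first by have /derivable_mxP := der vs (stdvec R i); apply.
  by rewrite /= (derive_mx (der vs (stdvec R i))) mxE.
apply: C1at_ext (C1at_sumT (fun j : 'I_n.+1 => C1atM (C j) (C1at_cst (c 0 j) u))) => // i y.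
by apply: eq_bigr => j _; rewrite mulr0 addr0.
Qed.

End parametrization.

Lemma C1at_uniq (R : realType) (n : nat) (f g : 'rV[R]_n -> R) df dg x :
  C1at f df x -> C1at g dg x -> (\forall y \near x, f y = g y) ->
  forall i, df i x = dg i x.
Proof.
move=> fC gC fg i; apply/eqP; rewrite -subr_eq0; apply/eqP.
apply: (C1at_near0 (f := fun y => f y - g y) _ (C1atB fC gC)).
by apply: filterS fg => y ->; rewrite subrr.
Qed.

Section soliton.
Variables (R : realType) (n : nat).
Local Notation E := 'rV[R]_n.+1.
Local Notation e := (stdvec R (@ord_max n)).
Variables (M : set E) (N : E -> E).
Hypothesis orN : orientation M N.
Hypothesis eqH : forall W F, local_parametrization M W F -> forall u, W u ->
  mean_curvature_vector F (N (F u)) u = normal_part (N (F u)) e.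
Variables (W : set 'rV[R]_n) (F : 'rV[R]_n -> E).
Hypothesis par : local_parametrization M W F.

Lemma param_in u : W u -> M (F u).
Proof.
case: par => oW _ _ _ /(_ W oW (fun=> id))[U _ E] Wu.
by have : (F @` W) (F u) by [exists u]; rewrite E => -[].
Qed.

Definition tangent_mx u : 'M[R]_(n, n.+1) := \matrix_(i < n) partial F i u.
Local Notation A := tangent_mx.
Local Notation ginv u := (invmx (A u *m (A u)^T)).
Local Notation hess i j u := (partial (partial F i) j u).

Lemma first_formE u : first_form F u = A u *m (A u)^T.
Proof.
apply/matrixP => i j; rewrite !mxE dotE mxE; apply: eq_bigr => k _.
by rewrite !mxE.
Qed.

Lemma A_free u : W u -> row_free (A u).
Proof. by case: par => _ _ _ + _; apply. Qed.

Lemma mul_AT (c : E) u i : (c *m (A u)^T) 0 i = dot c (partial F i u).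
Proof. by rewrite mxE; apply: eq_bigr => k _; rewrite !mxE. Qed.

Lemma normal_unit u : W u -> N (F u) *m (N (F u))^T = 1%:M.
Proof.
move=> Wu; have [_ N1 _] := orN; apply/rowP => i; rewrite ord1.
by rewrite -dotE enorm1 ?mxE ?eqxx//; apply: N1; exact: param_in.
Qed.

Lemma normal_orth u : W u -> N (F u) *m (A u)^T = 0.
Proof.
move=> Wu; have [_ _ N0] := orN; apply/rowP => i; rewrite mul_AT mxE.
exact: (N0 _ _ par _ _ Wu).
Qed.

Lemma normal_orthT u : W u -> A u *m (N (F u))^T = 0.
Proof. by move=> Wu; rewrite -[LHS]trmxK trmx_mul trmxK normal_orth// trmx0. Qed.

Lemma projection u : W u ->
  (A u)^T *m ginv u *m A u + (N (F u))^T *m N (F u) = 1%:M.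
Proof.
move=> Wu; apply: gram_projection; [exact: A_free|exact: normal_unit|].
exact: normal_orthT.
Qed.

Lemma ginv_sym u i j : ginv u i j = ginv u j i.
Proof.
rewrite -[in RHS](trmxK (ginv u)) mxE trmx_inv trmx_mul trmxK.
by [].
Qed.

(** The terms of second order of the Laplace-Beltrami operator of M, applied to
    the height function x |-> <x, c>. *)
Definition trace_hess (c : E) u : R :=
  \sum_i \sum_j ginv u i j * dot (hess j i u) c.

Lemma trace_hess_normal u : W u ->
  trace_hess (N (F u)) u = dot e (N (F u)).
Proof.
move=> Wu; have := eqH par Wu.
rewrite /mean_curvature_vector first_formE /normal_part => /(congr1 (fun v => dot v (N (F u)))).
have N1 : dot (N (F u)) (N (F u)) = 1 by have [_ N1 _] := orN; rewrite enorm1// N1//; exact: param_in.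
rewrite dotZl N1 mulr1 => <-; rewrite dot_suml; apply: eq_bigr => i _.
rewrite dot_suml; apply: eq_bigr => j _.
by rewrite dotZl /second_form /normal_part dotZl N1 mulr1.
Qed.

Lemma decompose (c : E) u : W u ->
  c = (c *m (A u)^T *m ginv u) *m A u + dot c (N (F u)) *: N (F u).
Proof.
move=> Wu; rewrite -[LHS]mulmx1 -(projection Wu) mulmxDr !mulmxA; congr (_ + _).
by rewrite [c *m _]mx11_scalar -dotE mul_scalar_mx.
Qed.

Lemma dot_decompose (c d : E) u : W u ->
  dot d c = \sum_k (c *m (A u)^T *m ginv u) 0 k * dot d (partial F k u)
    + dot c (N (F u)) * dot d (N (F u)).
Proof.
move=> Wu; rewrite {1}(decompose c Wu) dotDr dotZr; congr (_ + _).
rewrite dotE trmx_mul mulmxA mxE; apply: eq_bigr => k _.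
by rewrite mul_AT mxE mulrC.
Qed.

Lemma trace_hessE (c : E) u : W u ->
  trace_hess c u = \sum_k (c *m (A u)^T *m ginv u) 0 k * trace_hess (partial F k u) u
    + dot c (N (F u)) * dot e (N (F u)).
Proof.
move=> Wu; rewrite -(trace_hess_normal Wu).
have -> : trace_hess c u = \sum_i \sum_j ginv u i j *
   (\sum_k (c *m (A u)^T *m ginv u) 0 k * dot (hess j i u) (partial F k u)
    + dot c (N (F u)) * dot (hess j i u) (N (F u))).
  by apply: eq_bigr => i _; apply: eq_bigr => j _; rewrite -dot_decompose.
rewrite (eq_bigr (fun i => (\sum_k (c *m (A u)^T *m ginv u) 0 k *
   \sum_j ginv u i j * dot (hess j i u) (partial F k u)) +
   dot c (N (F u)) * \sum_j ginv u i j * dot (hess j i u) (N (F u)))); last first.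
  move=> i _; rewrite (eq_bigr (fun j => (\sum_k (c *m (A u)^T *m ginv u) 0 k *
     (ginv u i j * dot (hess j i u) (partial F k u))) +
     dot c (N (F u)) * (ginv u i j * dot (hess j i u) (N (F u))))); last first.
    move=> j _; rewrite mulrDr mulr_sumr; congr (_ + _); last by rewrite mulrCA.
    by apply: eq_bigr => k _; rewrite mulrCA.
  rewrite big_split/= -mulr_sumr; congr (_ + _); rewrite exchange_big/=.
  by apply: eq_bigr => k _; rewrite mulr_sumr.
rewrite big_split/= -mulr_sumr; congr (_ + _); rewrite exchange_big/=.
by apply: eq_bigr => k _; rewrite mulr_sumr.
Qed.

(** The soliton equation contributes <c, N> <e, N>. When c is orthogonal to e
    this is minus the product of the tangential parts of c and e, so that the
    equation of <F, c> has no term of order zero. *)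
Lemma trace_hess_orth (c : E) u : W u -> dot e c = 0 ->
  trace_hess c u = \sum_k dot c (partial F k u) *
    (\sum_l ginv u k l * trace_hess (partial F l u) u - (e *m (A u)^T *m ginv u) 0 k).
Proof.
move=> Wu ec; rewrite trace_hessE//.
have := dot_decompose e c Wu; rewrite dotC ec => /esym/eqP.
rewrite addrC addr_eq0 mulrC => /eqP ->.
rewrite -sumrN [X in X + _ = _](_ : _ = \sum_k dot c (partial F k u) *
   \sum_l ginv u k l * trace_hess (partial F l u) u); last first.
  rewrite (eq_bigr (fun k => \sum_l dot c (partial F l u) * (ginv u l k * trace_hess (partial F k u) u))).
    by rewrite exchange_big/=; apply: eq_bigr => k _; rewrite mulr_sumr.
  move=> k _; rewrite mxE mulr_suml; apply: eq_bigr => l _.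
  by rewrite mul_AT; ring.
by rewrite -big_split/=; apply: eq_bigr => k _; ring.
Qed.

Lemma param_C1 (c : E) u : W u ->
  C1at (fun x => dot (F x) c) (fun i x => dot (partial F i x) c) u.
Proof. by move=> Wu; exact: (param_iter_C1 par [::] c Wu). Qed.

Lemma param_dC1 (c : E) i u : W u ->
  C1at (fun x => dot (partial F i x) c) (fun j x => dot (hess i j x) c) u.
Proof. by move=> Wu; exact: (param_iter_C1 par [:: stdvec R i] c Wu). Qed.

Lemma param_open : open W. Proof. by case: par. Qed.

Lemma param_near (P : 'rV[R]_n -> Prop) u : (forall v, W v -> P v) -> W u ->
  \forall v \near u, P v.
Proof.
move=> WP Wu; have := open_nbhs_nbhs (conj param_open Wu); exact: filterS.
Qed.

Definition quad (a q x : E) : R := dot x a + \sum_k q 0 k * x 0 k ^+ 2.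

(** At a maximum the ambient gradient D of the quadratic function is normal to
    M, and the trace of the second derivatives with the inverse metric is
    nonpositive. This trace is twice the trace of the form diag(q) over the
    tangent space, plus <D, H> = <D, e> for the mean curvature vector H. *)
Lemma quad_max (a q : E) u : W u ->
  (\forall v \near u, quad a q (F v) <= quad a q (F u)) ->
  2 * (\sum_k q 0 k * (1 - N (F u) 0 k ^+ 2)) + a 0 ord_max
    + 2 * q 0 ord_max * F u 0 ord_max <= 0.
Proof.
move=> Wu umax.
have ar1 (p b q1 f1 : R) : p * b + q1 * (p * f1 + f1 * p) = p * (b + 2 * q1 * f1) by ring.
have ar2 (h b q1 f1 p p' : R) :
  h * (b + 2 * q1 * f1) + p * (0 + 2 * q1 * p') = h * (b + 2 * q1 * f1) + 2 * q1 * (p * p').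
  by ring.
have ar3 (c d p : R) : 2 * (c * (d * p)) = d * (2 * c * p) by ring.
pose f v := quad a q (F v).
pose D v : E := \row_k (a 0 k + 2 * q 0 k * F v 0 k).
have FkC k v : W v -> C1at (fun x => F x 0 k) (fun i x => partial F i x 0 k) v.
  move=> Wv; apply: C1at_ext (param_C1 (stdvec R k) Wv) => [x|i x]; exact: dot_stdvec.
have dFkC k i v : W v -> C1at (fun x => partial F i x 0 k) (fun j x => hess i j x 0 k) v.
  move=> Wv; apply: C1at_ext (param_dC1 (stdvec R k) i Wv) => [x|j x]; exact: dot_stdvec.
pose df i v := dot (partial F i v) (D v).
pose ddf i j v := dot (hess i j v) (D v) + \sum_k 2 * q 0 k * (partial F i v 0 k * partial F j v 0 k).
have fC v : W v -> C1at f df v.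
  move=> Wv; apply: C1at_ext (C1atD (param_C1 a Wv) (C1at_sumT (fun k : 'I_n.+1 =>
    C1atZ (q 0 k) (C1atM (FkC k v Wv) (FkC k v Wv))))) => [x|i x].
    by rewrite /f /quad; congr (_ + _); apply: eq_bigr => k _; rewrite expr2.
  rewrite /df /dot -big_split; apply: eq_bigr => k _ /=.
  rewrite [D x _ _]mxE; exact: ar1.
have dfC i v : W v -> C1at (df i) (ddf i) v.
  move=> Wv; apply: C1at_ext (C1at_sumT (fun k : 'I_n.+1 =>
    C1atM (dFkC k i v Wv) (C1atD (C1at_cst (a 0 k) v) (C1atZ (2 * q 0 k) (FkC k v Wv))))) => [x|j x].
    by rewrite /df /dot; apply: eq_bigr => k _; rewrite [D x _ _]mxE.
  rewrite /ddf /dot -big_split; apply: eq_bigr => k _ /=.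
  rewrite [D x _ _]mxE; exact: ar2.
have g0 i : df i u = 0 by apply: (local_max_grad umax (fC u Wu)).
have hess0 := local_max_hess umax (param_near fC Wu) (fun i => param_near (dfC i) Wu).
(* ginv = B^T B, and each row of B is a direction of nonpositive second derivative *)
pose B := (A u)^T *m ginv u.
have gu : A u *m (A u)^T \in unitmx by apply: gram_unit; exact: A_free.
have gB i j : ginv u i j = \sum_m B m i * B m j.
  have <- : B^T *m B = ginv u.
    by rewrite /B trmx_mul trmxK trmx_inv trmx_mul trmxK mulmxA -(mulmxA (ginv u)) mulVmx// mul1mx.
  by rewrite mxE; apply: eq_bigr => k _; rewrite mxE.
have S : \sum_i \sum_j ginv u i j * ddf i j u <= 0.
  rewrite [leLHS](_ : _ = \sum_m \sum_i \sum_j B m i * B m j * ddf i j u).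
    by apply: sumr_le0 => m _; exact: hess0.
  rewrite [RHS]exchange_big/=; apply: eq_bigr => i _; rewrite exchange_big/=.
  by apply: eq_bigr => j _; rewrite gB mulr_suml.
have DN : D u = dot (D u) (N (F u)) *: N (F u).
  rewrite {1}(decompose (D u) Wu) (_ : D u *m (A u)^T = 0) ?mul0mx ?add0r//.
  by apply/rowP => i; rewrite mul_AT mxE dotC; exact: g0.
have S1 : \sum_i \sum_j ginv u i j * dot (hess i j u) (D u) = dot e (D u).
  rewrite exchange_big/= {2}DN dotZr -(trace_hess_normal Wu) /trace_hess mulr_sumr.
  apply: eq_bigr => i _; rewrite mulr_sumr; apply: eq_bigr => j _.
  by rewrite ginv_sym {1}DN dotZr mulrCA.
have S2 : \sum_i \sum_j ginv u i j * (\sum_k 2 * q 0 k * (partial F i u 0 k * partial F j u 0 k))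
    = 2 * (\sum_k q 0 k * (1 - N (F u) 0 k ^+ 2)).
  rewrite mulr_sumr.
  have P k : 1 - N (F u) 0 k ^+ 2 = \sum_i \sum_j ginv u i j * (partial F i u 0 k * partial F j u 0 k).
    have /(congr1 (fun C : 'M[R]_n.+1 => C k k)) := projection Wu.
    rewrite [LHS]mxE [RHS]mxE eqxx => /(canRL (addrK _)).
    rewrite [((N (F u))^T *m N (F u)) k k]mxE big_ord1 [(N (F u))^T _ _]mxE -expr2 => <-.
    rewrite mxE (eq_bigr (fun j => \sum_i ginv u i j * (partial F i u 0 k * partial F j u 0 k))).
      exact: exchange_big.
    move=> j _; rewrite mxE mulr_suml; apply: eq_bigr => i _.
    rewrite [tangent_mx u j k]mxE [(tangent_mx u)^T k i]mxE [tangent_mx u i k]mxE.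
    by rewrite mulrCA mulrA.
  rewrite (eq_bigr (fun k => \sum_i \sum_j ginv u i j * (2 * q 0 k * (partial F i u 0 k * partial F j u 0 k)))).
    rewrite [RHS]exchange_big/=; apply: eq_bigr => i _; rewrite [RHS]exchange_big/=.
    by apply: eq_bigr => j _; rewrite mulr_sumr.
  move=> k _; rewrite P 2!mulr_sumr; apply: eq_bigr => i _; rewrite 2!mulr_sumr.
  by apply: eq_bigr => j _; exact: ar3.
have : \sum_i \sum_j ginv u i j * ddf i j u =
   dot e (D u) + 2 * (\sum_k q 0 k * (1 - N (F u) 0 k ^+ 2)).
  rewrite -S1 -S2 -big_split/=; apply: eq_bigr => i _; rewrite -big_split/=.
  by apply: eq_bigr => j _; rewrite /ddf mulrDr.
rewrite dotC dot_stdvec mxE => Eq; move: S; rewrite Eq.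
by rewrite addrC -addrA.
Qed.

End soliton.

(** * Graphs over a hyperplane parallel to the direction of motion *)

Section local_graph.
Variables (R : realType) (n : nat).
Local Notation E := 'rV[R]_n.+1.
Local Notation V := 'rV[R]_n.
Local Notation e := (stdvec R (@ord_max n)).
Variables (M : set E) (N : E -> E).
Hypothesis orN : orientation M N.
Hypothesis eqH : forall W F, local_parametrization M W F -> forall u, W u ->
  mean_curvature_vector F (N (F u)) u = normal_part (N (F u)) e.
Variables (W : set V) (F : V -> E).
Hypothesis par : local_parametrization M W F.
Variables (fr : 'M[R]_(n, n.+1)) (nu : E).
Hypothesis fr1 : fr *m fr^T = 1%:M.
Hypothesis nu1 : nu *m nu^T = 1%:M.
Hypothesis frnu : fr *m nu^T = 0.

Local Notation A := (tangent_mx F).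
Local Notation ginv u := (invmx (A u *m (A u)^T)).
Local Notation hess i j u := (partial (partial F i) j u).
Local Notation f l := (row l fr).

Lemma dot_row (c : E) l : dot c (f l) = (c *m fr^T) 0 l.
Proof. by rewrite mxE; apply: eq_bigr => k _; rewrite !mxE. Qed.

Lemma frame_free : row_free fr.
Proof.
apply: inj_row_free => x x0.
by rewrite -[x]mulmx1 -fr1 mulmxA x0 mul0mx.
Qed.

Lemma frame_decompose (c : E) : c = (c *m fr^T) *m fr + dot c nu *: nu.
Proof.
rewrite -[LHS]mulmx1 -(gram_projection frame_free nu1 frnu) fr1 invmx1 mulmx1.
by rewrite mulmxDr !mulmxA [c *m nu^T]mx11_scalar -dotE mul_scalar_mx.
Qed.

Definition frame_jac u : 'M[R]_n := A u *m fr^T.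
Local Notation J := frame_jac.

Lemma frame_jacE u i l : J u i l = dot (partial F i u) (f l).
Proof.
by rewrite dot_row [LHS]mxE [RHS]mxE; apply: eq_bigr => k _; rewrite [A u i k]mxE.
Qed.

(** The components of the normal in the hyperplane of the frame are proportional
    to the gradient of the graph. *)
Lemma normal_slope u (g : V) : W u -> J u \in unitmx ->
  (forall i, dot (partial F i u) nu = \sum_l J u i l * g 0 l) ->
  N (F u) *m fr^T = - dot (N (F u)) nu *: g.
Proof.
move=> Wu Ju ug.
have nuA : nu *m (A u)^T = g *m (J u)^T.
  apply/rowP => i; rewrite mul_AT dotC ug mxE; apply: eq_bigr => l _.
  by rewrite mulrC [(J u)^T l i]mxE.
have : N (F u) *m (A u)^T = 0 by exact: (normal_orth orN par Wu).
rewrite {1}(frame_decompose (N (F u))) mulmxDl -scalemxAl nuA scalemxAl -mulmxA.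
rewrite (_ : fr *m (A u)^T = (J u)^T); last by rewrite trmx_mul trmxK.
rewrite -mulmxDl => /(congr1 (mulmx^~ (invmx (J u)^T))).
rewrite mulmxK ?unitmx_tr// mul0mx => /eqP; rewrite addr_eq0 => /eqP ->.
by rewrite scaleNr.
Qed.

Lemma inverse_metric_frame u m l : W u ->
  \sum_i \sum_j J u i m * ginv u i j * J u j l =
  (m == l)%:R - dot (N (F u)) (f m) * dot (N (F u)) (f l).
Proof.
move=> Wu.
have : (J u)^T *m ginv u *m J u = 1%:M - (N (F u) *m fr^T)^T *m (N (F u) *m fr^T).
  rewrite -fr1 -{1}[fr]mulmx1 -(projection orN par Wu) /frame_jac.
  by rewrite mulmxDr mulmxDl !trmx_mul trmxK !mulmxA addrK.
move=> /(congr1 (fun C : 'M[R]_n => C m l)).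
have R0 (b : V) : (1%:M - b^T *m b) m l = (m == l)%:R - b 0 m * b 0 l.
  by rewrite !mxE big_ord1 !mxE.
rewrite R0 !dot_row => <-.
rewrite [RHS]mxE exchange_big/=; apply: eq_bigr => j _.
rewrite [((J u)^T *m ginv u) m j]mxE mulr_suml; apply: eq_bigr => i _.
by rewrite [(J u)^T m i]mxE.
Qed.

(** The coefficients of the gradient terms in the equations of the height
    functions of directions orthogonal to e ([trace_hess_orth]). *)
Definition drift u k : R :=
  \sum_l ginv u k l * trace_hess F (partial F l u) u - (e *m (A u)^T *m ginv u) 0 k.

Definition frame_drift u l : R :=
  \sum_k J u k l * drift u k - trace_hess F (f l) u.

(** The relation between the second derivatives of F and of the graph is traced
    with the inverse metric. In the frame this metric is the identity minus a
    rank one term of second order in the gradient g ([inverse_metric_frame],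
    [normal_slope]), so that every term but the Laplacian has a factor g. *)
Lemma graph_equation u (g : V) (H : 'I_n -> 'I_n -> R) : dot e nu = 0 ->
  W u -> J u \in unitmx ->
  (forall i, dot (partial F i u) nu = \sum_l J u i l * g 0 l) ->
  (forall j i, dot (hess j i u) nu =
     \sum_l (dot (hess j i u) (f l) * g 0 l + J u j l * \sum_m J u i m * H l m)) ->
  \sum_l H l l = \sum_l g 0 l *
    (frame_drift u l + dot (N (F u)) nu ^+ 2 * \sum_m g 0 m * H l m).
Proof.
move=> enu Wu Ju ug Hg.
have T1 : trace_hess F nu u = \sum_l g 0 l * \sum_k J u k l * drift u k.
  rewrite (trace_hess_orth orN eqH par Wu enu).
  rewrite (eq_bigr (fun k => \sum_l g 0 l * (J u k l * drift u k))).
    by rewrite exchange_big/=; apply: eq_bigr => l _; rewrite mulr_sumr.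
  move=> k _; rewrite dotC ug mulr_suml; apply: eq_bigr => l _.
  by rewrite mulrA; congr (_ * _); rewrite mulrC.
have T2 : trace_hess F nu u = \sum_l g 0 l * trace_hess F (f l) u +
    \sum_l \sum_m H l m * \sum_i \sum_j J u i m * ginv u i j * J u j l.
  rewrite -big_split/=.
  rewrite /trace_hess (eq_bigr (fun i => \sum_l (g 0 l * \sum_j ginv u i j * dot (hess j i u) (f l)
     + \sum_m H l m * \sum_j J u i m * ginv u i j * J u j l))).
    rewrite exchange_big/=; apply: eq_bigr => l _.
    rewrite big_split/= -mulr_sumr; congr (_ + _).
    by rewrite exchange_big/=; apply: eq_bigr => m _; rewrite mulr_sumr.
  move=> i _; rewrite (eq_bigr (fun j => \sum_l (g 0 l * (ginv u i j * dot (hess j i u) (f l))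
     + \sum_m H l m * (J u i m * ginv u i j * J u j l)))).
    rewrite exchange_big/=; apply: eq_bigr => l _.
    rewrite big_split/= -mulr_sumr; congr (_ + _).
    by rewrite exchange_big/=; apply: eq_bigr => m _; rewrite mulr_sumr.
  move=> j _; rewrite Hg mulr_sumr; apply: eq_bigr => l _.
  rewrite mulrDr; congr (_ + _); first by rewrite [_ * g 0 l]mulrC mulrCA.
  rewrite mulr_sumr mulr_sumr; apply: eq_bigr => m _.
  by rewrite mulrCA [LHS]mulrCA !mulrA [RHS]mulrC !mulrA [X in X * _ * _]mulrC -!mulrA; congr (_ * _); rewrite mulrCA mulrC -!mulrA; congr (_ * _); rewrite mulrC.
have T3 : \sum_l \sum_m H l m * \sum_i \sum_j J u i m * ginv u i j * J u j l =
   \sum_l H l l - \sum_l g 0 l * (dot (N (F u)) nu ^+ 2 * \sum_m g 0 m * H l m).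
  rewrite -sumrB; apply: eq_bigr => l _.
  have S m : H l m * (\sum_i \sum_j J u i m * ginv u i j * J u j l) =
     H l m * (m == l)%:R - g 0 l * (dot (N (F u)) nu ^+ 2 * (g 0 m * H l m)).
    rewrite inverse_metric_frame// !dot_row (normal_slope Wu Ju ug) ![(_ *: g) _ _]mxE.
    have ar (h d c gm gl : R) : h * (d - (- c * gm) * (- c * gl)) = h * d - gl * (c ^+ 2 * (gm * h)).
      by ring.
    exact: ar.
  rewrite (eq_bigr _ (fun m _ => S m)) sumrB; congr (_ - _).
    rewrite (bigD1 l)//= eqxx mulr1 big1 ?addr0// => m ml.
    by rewrite (negbTE ml) mulr0.
  by rewrite -mulr_sumr -mulr_sumr.
have : \sum_l H l l = trace_hess F nu u - \sum_l g 0 l * trace_hess F (f l) u +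
    \sum_l g 0 l * (dot (N (F u)) nu ^+ 2 * \sum_m g 0 m * H l m).
  by rewrite {1}T2 T3 [X in X - _ + _]addrC addrK subrK.
move=> ->; rewrite T1 -sumrB -big_split/=; apply: eq_bigr => l _.
by rewrite /frame_drift -mulrBr -mulrDr.
Qed.


Lemma frame_jac_unit u : W u -> (forall i, dot (partial F i u) nu = 0) ->
  J u \in unitmx.
Proof.
move=> Wu tan; rewrite -row_free_unit; apply: inj_row_free => x xJ.
have A0 : A u *m nu^T = 0.
  by apply/colP => i; rewrite [RHS]mxE -[RHS](tan i) mxE; apply: eq_bigr => k _; rewrite !mxE.
have xA : x *m A u = 0.
  rewrite (frame_decompose (x *m A u)) -(mulmxA x (A u) fr^T) xJ mul0mx add0r.
  by rewrite dotE -mulmxA A0 mulmx0 mxE scale0r.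
by apply/eqP; rewrite -(mulmx_free_eq0 x (A_free par Wu)) xA.
Qed.

Lemma frame_jac_solve u (c : 'I_n -> R) i : J u \in unitmx ->
  \sum_l J u i l * \sum_j c j * invmx (J u) l j = c i.
Proof.
move=> Ju; rewrite (eq_bigr (fun l => \sum_j c j * (J u i l * invmx (J u) l j))); last first.
  by move=> l _; rewrite mulr_sumr; apply: eq_bigr => j _; rewrite mulrCA.
rewrite exchange_big/=.
have S j : \sum_l c j * (J u i l * invmx (J u) l j) = c j * (i == j)%:R.
  rewrite -mulr_sumr; congr (_ * _).
  by have /matrixP/(_ i j) := mulmxV Ju; rewrite [LHS]mxE [RHS]mxE.
rewrite (eq_bigr _ (fun j _ => S j)) (bigD1 i)//= eqxx mulr1 big1 ?addr0// => j ji.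
by rewrite eq_sym (negbTE ji) mulr0.
Qed.

Lemma frame_drift_continuous u l : W u -> frame_drift y l @[y --> u] --> frame_drift u l.
Proof.
move=> Wu.
have ext (g g' : V -> R) : (forall y, g y = g' y) -> g y @[y --> u] --> g u ->
  g' y @[y --> u] --> g' u by move=> /funext ->.
have partC c i : dot (partial F i y) c @[y --> u] --> dot (partial F i u) c.
  by have [] := param_dC1 par c i Wu.
have hessC c i j : dot (hess i j y) c @[y --> u] --> dot (hess i j u) c.
  by have [_ _] := param_dC1 par c i Wu; apply.
have partkC i k : partial F i y 0 k @[y --> u] --> partial F i u 0 k.
  by apply: (ext _ _ _ (partC (stdvec R k) i)) => y; exact: dot_stdvec.
have hesskC i j k : hess i j y 0 k @[y --> u] --> hess i j u 0 k.
  by apply: (ext _ _ _ (hessC (stdvec R k) i j)) => y; exact: dot_stdvec.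
have ginvC i j : ginv y i j @[y --> u] --> ginv u i j.
  have [dI HI] := C1at_invmx (fun y => A y *m (A y)^T)
    (fun i j l y => \sum_(k < n.+1) (hess i l y 0 k * partial F j y 0 k + partial F i y 0 k * hess j l y 0 k)).
  have [|+ _ _] := HI u _ (gram_unit (A_free par Wu)) i j; last by [].
  move=> a b; have FkC c k : C1at (fun x => partial F c x 0 k) (fun j x => hess c j x 0 k) u.
    by apply: C1at_ext (param_dC1 par (stdvec R k) c Wu) => [x|j' x]; exact: dot_stdvec.
  apply: C1at_ext (C1at_sumT (fun k : 'I_n.+1 => C1atM (FkC a k) (FkC b k))) => // x.
  by rewrite mxE; apply: eq_bigr => k _; rewrite !mxE.
have thC c : trace_hess F c y @[y --> u] --> trace_hess F c u.
  by apply: cvg_sum_rV => i; apply: cvg_sum_rV => j; apply: cvgM.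
have th2C a : trace_hess F (partial F a y) y @[y --> u] --> trace_hess F (partial F a u) u.
  apply: cvg_sum_rV => i; apply: cvg_sum_rV => j; apply: cvgM => //.
  by apply: cvg_sum_rV => k; apply: cvgM.
have JC i m : J y i m @[y --> u] --> J u i m.
  by apply: (ext _ _ _ (partC (f m) i)) => y; rewrite frame_jacE.
apply: cvgB; last exact: thC.
apply: cvg_sum_rV => k; apply: cvgM => //; apply: cvgB.
  by apply: cvg_sum_rV => m; apply: cvgM.
apply: (ext (fun y => \sum_j dot (partial F j y) e * ginv y j k)).
  by move=> y; rewrite mxE; apply: eq_bigr => j _; rewrite mul_AT dotC.
by apply: cvg_sum_rV => j; apply: cvgM.
Qed.


Lemma normal_coord_le1 u : W u -> dot (N (F u)) nu ^+ 2 <= 1.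
Proof.
move=> Wu; set x := N (F u).
have xx : dot x x = 1 by rewrite dotE (normal_unit orN par Wu) mxE eqxx.
have nn : dot nu nu = 1 by rewrite dotE nu1 mxE eqxx.
have := dot_ge0 (x - dot x nu *: nu).
rewrite dotBl !dotBr !dotZl !dotZr xx nn (dotC nu x) mulr1 subrr subr0 -expr2.
by rewrite subr_ge0.
Qed.

(** Near a point with tangent space orthogonal to nu, M is the graph of a
    function of which the Laplacian is controlled by the gradient: there is no
    zero order term, since e is tangent to the hyperplane of the frame. *)
Lemma local_graph u0 : dot e nu = 0 -> W u0 ->
  (forall i, dot (partial F i u0) nu = 0) ->
  exists (G : V -> R) (dG : 'I_n -> V -> R) (ddG : 'I_n -> 'I_n -> V -> R)
    (rho K : R) (U : set E),
  [/\ [/\ 0 < rho, 0 <= K, open U & U (F u0)],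
      (forall w : V, `|w| < rho -> C1at G dG w /\ forall l, C1at (dG l) (ddG l) w),
      (forall w : V, `|w| < rho -> (\sum_l ddG l l w) ^+ 2 <= K * \sum_l dG l w ^+ 2),
      (forall w : V, `|w| < rho -> M (F u0 + (w *m fr + G w *: nu))) &
      (forall x, M x -> U x -> `|(x - F u0) *m fr^T| < rho /\
         dot (x - F u0) nu = G ((x - F u0) *m fr^T))].
Proof.
move=> enu Wu0 tan; have Ju0 := frame_jac_unit Wu0 tan.
pose h (v : V) : V := (F v - F u0) *m fr^T.
pose dh l i v := J v i l.
have jacE : jac dh = J by apply/funext => v; apply/matrixP => i l; rewrite mxE.
have hE v l : h v 0 l = dot (F v) (f l) - dot (F u0) (f l) by rewrite /h -dot_row dotBl.
have hC l v : W v -> C1at (fun x => h x 0 l) (dh l) v.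
  move=> Wv; apply: C1at_ext (C1atB (param_C1 par (f l) Wv) (C1at_cst (dot (F u0) (f l)) v)).
    by move=> x; rewrite hE.
  by move=> i x; rewrite subr0 /dh frame_jacE.
have JC i l v : W v -> C1at (fun x => J x i l) (fun j x => dot (hess i j x) (f l)) v.
  by move=> Wv; apply: C1at_ext (param_dC1 par (f l) i Wv) => // x; rewrite frame_jacE.
have h0 : h u0 = 0 by rewrite /h subrr mul0mx.
have [|rho [del [k [rho0 del0 kP kh kC]]]] :=
  inverse_function (param_open par) hC (fun l i v Wv => JC i l v Wv) Wu0.
  by rewrite jacE.
rewrite jacE h0 in kP kh kC.
(* G is the height <F - p, nu> read in the coordinates h along the frame *)
have [dI dIC] := C1at_invmx J (fun i l j x => dot (hess i j x) (f l)).
pose gam l v := \sum_j dot (partial F j v) nu * invmx (J v) l j.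
pose dgam l i v := \sum_j (dot (hess j i v) nu * invmx (J v) l j
   + dot (partial F j v) nu * dI l j i v).
have gamC l v : W v -> J v \in unitmx -> C1at (gam l) (dgam l) v.
  move=> Wv Jv; have JvC i m := JC i m v Wv.
  exact: (C1at_sumT (fun j : 'I_n => C1atM (param_dC1 par nu j Wv) (dIC v JvC Jv l j))).
have Junear (v : V) : W v -> J v \in unitmx -> \forall x \near v, W x /\ J x \in unitmx.
  move=> Wv Jv; apply: filterI; first exact: (param_near par _ Wv).
  by apply: unitmx_near => [i j|]; [exact: JC|exact: Jv].
pose G w := dot (F (k w) - F u0) nu.
pose dG l w := gam l (k w).
pose ddG l m w := \sum_i dgam l i (k w) * invmx (J (k w)) m i.
have kw0 (w : V) : `|w| < rho -> [/\ `|k w - u0| < del, W (k w), h (k w) = w & J (k w) \in unitmx].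
  by move=> wr; apply: kP; rewrite subr0.
have kC0 (w : V) : `|w| < rho -> forall j, C1at (fun w => k w 0 j) (fun l w => invmx (J (k w)) l j) w.
  by move=> wr; apply: kC; rewrite subr0.
have GC (w : V) : `|w| < rho -> C1at G dG w /\ forall l, C1at (dG l) (ddG l) w.
  move=> wr; have [_ Wk _ Jk] := kw0 w wr; split=> [|l].
    apply: (C1at_comp (f := fun v => dot (F v - F u0) nu) (df := fun i v => dot (partial F i v) nu)) (kC0 w wr).
    apply: (param_near par _ Wk) => v Wv.
    apply: C1at_ext (C1atB (param_C1 par nu Wv) (C1at_cst (dot (F u0) nu) v)).
      by move=> x; rewrite dotBl.
    by move=> i x; rewrite subr0.
  apply: (C1at_comp (f := gam l) (df := dgam l)) (kC0 w wr).
  by apply: filterS (Junear _ Wk Jk) => v [Wv Jv]; exact: gamC.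
have gamE v i : J v \in unitmx -> dot (partial F i v) nu = \sum_l J v i l * gam l v.
  by move=> Jv; rewrite /gam (frame_jac_solve (fun j => dot (partial F j v) nu)).
have eq (w : V) : `|w| < rho -> \sum_l ddG l l w = \sum_l dG l w *
    (frame_drift (k w) l + dot (N (F (k w))) nu ^+ 2 * \sum_m dG m w * ddG l m w).
  move=> wr; have [_ Wk _ Jk] := kw0 w wr.
  rewrite (graph_equation (g := \row_l gam l (k w)) (H := fun l m => ddG l m w) enu Wk Jk).
  - apply: eq_bigr => l _; rewrite mxE; congr (_ * (_ + _ * _)).
    by apply: eq_bigr => m _; rewrite mxE.
  - by move=> i; rewrite gamE//; apply: eq_bigr => l _; rewrite [(\row__ _) 0 l]mxE.
  move=> j i; have C := C1at_sumT (fun l : 'I_n => C1atM (JC j l _ Wk) (gamC l _ Wk Jk)).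
  rewrite (C1at_uniq (param_dC1 par nu j Wk) C); last first.
    by apply: filterS (Junear _ Wk Jk) => v [_ Jv]; exact: gamE.
  apply: eq_bigr => l _; rewrite [(\row__ _) 0 l]mxE; congr (_ + _ * _).
  by rewrite /ddG (frame_jac_solve (fun i => dgam l i (k w))).
have nw0 : `|0 : V| < rho by rewrite normr0.
have k0 : k 0 = u0 by rewrite -h0 kh// ?subrr ?h0 ?subr0 normr0.
have kcont (P : V -> Prop) : (\forall v \near u0, P v) -> \forall w \near (0 : V), P (k w).
  move=> /nearP[d d0 dP]; have : \forall w \near (0 : V), forall j, `|k w 0 j - k 0 0 j| < d / 2.
    apply: near_all => j; have [/cvg_rVP + _ _] := kC0 0 nw0 j.
    move=> /(_ (d / 2)); rewrite divr_gt0// => /(_ isT)[d' d'0 H].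
    by apply/nearP; exists d' => // y; exact: H.
  apply: filterS => w H; apply: dP; apply: (@le_lt_trans _ _ (d / 2)); last by lra.
  by apply: norm_le_coord => [|j]; [lra|rewrite !mxE -k0 ltW].
have bnd (g : V -> R) : g w @[w --> (0 : V)] --> g 0 -> \forall w \near (0 : V), `|g w| <= `|g 0| + 1.
  move=> /cvg_rVP/(_ 1 ltr01)[d d0 H]; apply/nearP; exists d => // w /H lt1.
  by rewrite -[g w](subrK (g 0)) (le_trans (ler_normD _ _))// addrC lerD2l ltW.
have : \forall w \near (0 : V), `|w| < rho /\ forall l,
   `|frame_drift (k w) l| <= `|frame_drift (k 0) l| + 1 /\
   `|\sum_m dG m w * ddG l m w| <= `|\sum_m dG m 0 * ddG l m 0| + 1.
  apply: filterI.
    by apply/nearP; exists rho => // y; rewrite subr0.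
  apply: near_all => l; apply: filterI.
    apply: bnd; apply/cvg_rVP => eps eps0.
    have /cvg_rVP/(_ eps eps0)[d d0 H] := frame_drift_continuous (l := l) Wu0.
    have /kcont : \forall v \near u0, `|frame_drift v l - frame_drift u0 l| < eps.
      by apply/nearP; exists d.
    by rewrite k0 => /nearP[d' d'0 H']; exists d'.
  apply: (bnd (fun w => \sum_m dG m w * ddG l m w)).
  apply: cvg_sum_rV => m; have [_ H] := GC 0 nw0; apply: cvgM.
    by have [] := H m.
  by have [_ _] := H l; apply.
move=> /nearP[r1 r10 r1P].
pose c l : R := `|frame_drift (k 0) l| + 1 + (`|\sum_m dG m 0 * ddG l m 0| + 1).
have r1P' (w : V) : `|w| < r1 -> `|w| < rho by move=> wr; have [] := r1P w; rewrite ?subr0.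
pose Wn := [set v : V | \forall y \near v, [/\ W y, `|y - u0| < del & `|h y| < r1]].
have WnW : Wn `<=` W by move=> v /nbhs_singleton[].
have oWn : open Wn by exact: open_near_set.
have [_ _ _ _ /(_ Wn oWn WnW)[U oU UE]] := par.
have Wnu0 : Wn u0.
  have hnear : \forall y \near u0, forall l, `|h y 0 l| < r1 / 2.
    apply: near_all => l; have [/cvg_rVP + _ _] := hC l u0 Wu0.
    move=> /(_ (r1 / 2)); rewrite divr_gt0// => /(_ isT)[d d0 H].
    by apply/nearP; exists d => // y /H; rewrite h0 [X in _ - X]mxE subr0.
  have hnear' : \forall y \near u0, `|h y| < r1.
    apply: filterS hnear => y H; apply: (@le_lt_trans _ _ (r1 / 2)); last by lra.
    by apply: norm_le_coord => [|j]; [lra|exact: ltW].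
  have dnear : \forall y \near u0, `|y - u0| < del by apply/nearP; exists del.
  have Wnear : \forall y \near u0, W y by exact: (param_near par _ Wu0).
  by rewrite /Wn/=; near=> y; split; near: y.
exists G, dG, ddG, r1, (\sum_l c l ^+ 2), U; split.
- split=> //; first by apply: sumr_ge0 => l _; exact: sqr_ge0.
  have : (F @` Wn) (F u0) by exists u0.
  by rewrite UE => -[].
- by move=> w /r1P'; exact: GC.
- move=> w wr; rewrite eq; last exact: r1P'.
  apply: le_trans (sum_cauchy_schwarz _ _) _; rewrite mulrC.
  apply: ler_wpM2r; first by apply: sumr_ge0 => l _; exact: sqr_ge0.
  apply: ler_sum => l _; have [|wrho /(_ l)[b1 b2]] := r1P w; first by rewrite subr0.
  have [_ Wk _ _] := kw0 w wrho; have n1 := normal_coord_le1 Wk.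
  have sqr_le (x y : R) : `|x| <= y -> x ^+ 2 <= y ^+ 2.
    move=> xy; rewrite -[x ^+ 2]real_normK ?num_real// lerXn2r ?nnegrE//.
    exact: le_trans (normr_ge0 x) xy.
  apply: sqr_le; apply: le_trans (ler_normD _ _) _; apply: lerD => //.
  rewrite normrM (ger0_norm (sqr_ge0 _)).
  apply: le_trans b2; exact: ler_piMl.
- move=> w /r1P' wr; have [_ Wk hk _] := kw0 w wr.
  rewrite -{1}hk /h /G -frame_decompose addrC subrK.
  exact: (param_in par Wk).
move=> x Mx Ux; have : (F @` Wn) x by rewrite UE.
move=> [v vW <-]; have [Wv vdel hr] := nbhs_singleton vW.
by split=> //; rewrite -/(h v) /G kh// subr0 r1P'.
Unshelve. all: by end_near. Qed.

End local_graph.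

(** * Closedness and cross sections *)

Lemma proper_closed (R : realType) n (M : set 'rV[R]_n.+1) :
  properly_embedded M -> closed M.
Proof.
move=> pM x xM; have := pM _ (compact_cball (x := x) (c := 1)).
move=> /(compact_closed (@norm_hausdorff _ _)) cl.
suff : closure (M `&` [set y | `|y - x| <= 1]) x by move=> /cl[].
move=> B /nearP[d d0 dB].
have [y [My yx]] : M `&` [set y : 'rV[R]_n.+1 | `|y - x| < Num.min d 1] !=set0.
  by apply: xM; apply/nearP; exists (Num.min d 1); rewrite ?lt_min ?d0 ?ltr01.
move: yx => /=; rewrite lt_min => /andP[yd y1].
by exists y; split; [split=> //; exact: ltW|exact: dB].
Qed.

Section plane_coordinates.
Variables (R : realType) (n : nat) (i0 i1 : 'I_n.+1).
Local Notation E := 'rV[R]_n.+1.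
Hypothesis i01 : i0 != i1.
Implicit Types (x y : E).

(** The squared distance to the axis of the cylinder. *)
Definition axis_dist2 x : R := x 0 i0 ^+ 2 + x 0 i1 ^+ 2.

Definition plane_vec (a b : R) : E := a *: stdvec R i0 + b *: stdvec R i1.

Lemma dot_plane_vec x a b : dot x (plane_vec a b) = a * x 0 i0 + b * x 0 i1.
Proof. by rewrite dotDr !dotZr !dot_stdvec. Qed.

Lemma plane_vec_i0 a b : plane_vec a b 0 i0 = a.
Proof. by rewrite !mxE !eqxx (negbTE i01) mulr1 mulr0 addr0. Qed.

Lemma plane_vec_i1 a b : plane_vec a b 0 i1 = b.
Proof. by rewrite !mxE !eqxx eq_sym (negbTE i01) mulr1 mulr0 add0r. Qed.

Lemma plane_vec_out a b k : k != i0 -> k != i1 -> plane_vec a b 0 k = 0.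
Proof. by move=> k0 k1; rewrite !mxE (negbTE k0) (negbTE k1) !mulr0 addr0. Qed.

Lemma sum_plane (f : 'I_n.+1 -> R) :
  \sum_k f k = f i0 + f i1 + \sum_(k | (k != i0) && (k != i1)) f k.
Proof. by rewrite (bigD1 i0)//= (bigD1 i1) ?[i1 == _]eq_sym//= addrA. Qed.

Lemma coord_continuous_rV k x : y 0 k @[y --> x] --> x 0 k.
Proof. by have [] := C1at_coord k x. Qed.

Lemma axis_dist2_continuous x : axis_dist2 y @[y --> x] --> axis_dist2 x.
Proof. by apply: cvgD; apply: cvgM; exact: coord_continuous_rV. Qed.

Lemma axis_dist2_le1 x : dot x x = 1 -> axis_dist2 x <= 1.
Proof.
rewrite /dot sum_plane -!expr2 => <-; rewrite lerDl.
by apply: sumr_ge0 => k _; rewrite -expr2 sqr_ge0.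
Qed.

Lemma closed_cylinder (r : R) : closed [set x | axis_dist2 x <= r ^+ 2].
Proof.
rewrite (_ : mkset _ = axis_dist2 @^-1` [set t | t <= r ^+ 2])//.
apply: closed_comp; last exact: closed_le.
by move=> x _; exact: axis_dist2_continuous.
Qed.

Lemma quad_continuous (a q : E) x : quad a q y @[y --> x] --> quad a q x.
Proof.
apply: cvgD; apply: cvg_sum_rV => k.
  by apply: cvgM; [exact: coord_continuous_rV|exact: cvg_cst].
apply: cvgM; first exact: cvg_cst.
by apply: cvgM; exact: coord_continuous_rV.
Qed.

End plane_coordinates.

(** * The maximum principle in the cylinder *)

Section max_principle.
Variables (R : realType) (n : nat) (i0 i1 : 'I_n.+1).
Local Notation E := 'rV[R]_n.+1.
Local Notation Q := (axis_dist2 i0 i1).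
Hypothesis i01 : i0 != i1.
Hypothesis i0n : i0 != ord_max.
Hypothesis i1n : i1 != ord_max.
Variables (M : set E) (N : E -> E) (r : R).
Hypothesis smM : smooth_hypersurface M.
Hypothesis orN : orientation M N.
Hypothesis eqH : forall W F, local_parametrization M W F -> forall u, W u ->
  mean_curvature_vector F (N (F u)) u = normal_part (N (F u)) (stdvec R ord_max).
Hypothesis pM : properly_embedded M.
Hypothesis r0 : 0 < r.

Lemma param_cont W F u (P : E -> Prop) : local_parametrization M W F -> W u ->
  (\forall y \near F u, P y) -> \forall v \near u, P (F v).
Proof.
move=> par Wu /nearP[d d0 dP].
have : \forall v \near u, forall k, `|F v 0 k - F u 0 k| < d / 2.
  apply: near_all => k; have [/cvg_rVP + _ _] := param_C1 par (stdvec R k) Wu.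
  move=> /(_ (d / 2)); rewrite divr_gt0// => /(_ isT)[d' d'0 H].
  by apply/nearP; exists d' => // v /H; rewrite !dot_stdvec.
apply: filterS => v H; apply: dP; apply: (@le_lt_trans _ _ (d / 2)); last by lra.
by apply: norm_le_coord => [|k]; [lra|rewrite !mxE ltW].
Qed.

(** The constants of [max_principle]: the convexity eta in the cross section is
    small with respect to the excess de at a given point, and the concavity eps
    along the axis is small with respect to eta. *)
Lemma max_constants (de c S : R) : 0 < de -> 0 <= S -> exists eta eps C : R,
  [/\ 0 < eta, 0 < eps, 2 * r + de + `|c| < C, eta * r ^+ 2 <= de / 4 &
    [/\ eps * S <= de / 4, eps * n.+1%:R <= eta / 4 & eps * C <= (eta / 4) ^+ 2]].
Proof.
move=> de0 S0.
pose eta := de / (4 * (r ^+ 2 + 1)).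
have r21 : 0 < r ^+ 2 + 1 by rewrite ltr_wpDl ?sqr_ge0.
have eta0 : 0 < eta by rewrite divr_gt0// mulr_gt0.
pose C := 2 * r + de + `|c| + 1.
have C0 : 0 < C.
  by rewrite /C; have := normr_ge0 c; have := r0; move: de0; lra.
pose D := de / 4 / (S + 1); pose D' := (eta / 4) / n.+1%:R; pose D'' := (eta / 4) ^+ 2 / C.
have D0 : 0 < D by rewrite !divr_gt0// ltr_wpDl.
have eta4 : 0 < eta / 4 by exact: divr_gt0.
have D'0 : 0 < D' by apply: divr_gt0; rewrite ?ltr0Sn.
have D''0 : 0 < D'' by apply: divr_gt0 => //; exact: exprn_gt0.
exists eta, (Num.min D (Num.min D' D'')), C; split=> //.
- by rewrite !lt_min D0 D'0 D''0.
- by rewrite /C ltrDl.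
- have e1 : eta * (r ^+ 2 + 1) = de / 4.
    by rewrite /eta invfM mulrA divfK// gt_eqF.
  by rewrite -e1 ler_pM2l// lerDl.
split.
- apply: (@le_trans _ _ (D * (S + 1))); last by rewrite divfK// gt_eqF// ltr_wpDl.
  by apply: ler_pM; rewrite ?ge_min ?lexx// ?lerDl// !le_min !ltW.
- by rewrite -ler_pdivlMr// !ge_min lexx orbT.
- by rewrite -ler_pdivlMr// !ge_min lexx !orbT.
Qed.

Lemma max_linear (c0 c1 : R) (y : E) : c0 ^+ 2 + c1 ^+ 2 = 1 ->
  Q y <= r ^+ 2 -> c0 * y 0 i0 + c1 * y 0 i1 <= r.
Proof.
move=> c01 Qy; rewrite real_leNgt ?num_real//; apply/negP => gt.
have : r ^+ 2 < (c0 * y 0 i0 + c1 * y 0 i1) ^+ 2.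
  by rewrite ltrXn2r// ?nnegrE ?ltW// (lt_trans r0).
rewrite ltNge => /negP; apply; apply: le_trans Qy; rewrite /axis_dist2.
rewrite -[leRHS]mul1r -c01 -subr_ge0.
rewrite (_ : _ - _ = (c0 * y 0 i1 - c1 * y 0 i0) ^+ 2) ?sqr_ge0//; ring.
Qed.

(** The function c0 x_i0 + c1 x_i1 is made slightly convex in the cross section,
    and slightly concave along the axis for its maximum over the part of M in
    the cylinder to be attained. If the bound c failed, the maximum would lie
    off the two lines, hence be a local maximum on M. This contradicts
    [quad_max]: the tangent space of M misses at most one direction of the
    cross section, so that the convex part dominates the trace. *)
Lemma max_principle (al1 be1 al2 be2 c0 c1 c : R) :
  (forall x, M x -> Q x <= r ^+ 2 -> ~ (x 0 i0 = al1 /\ x 0 i1 = be1) ->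
     ~ (x 0 i0 = al2 /\ x 0 i1 = be2) -> \forall y \near x, M y -> Q y <= r ^+ 2) ->
  c0 ^+ 2 + c1 ^+ 2 = 1 -> c0 * al1 + c1 * be1 = c -> c0 * al2 + c1 * be2 = c ->
  forall x, M x -> Q x <= r ^+ 2 -> c0 * x 0 i0 + c1 * x 0 i1 <= c.
Proof.
move=> int c01 cal1 cal2 x Mx Qx; rewrite leNgt; apply/negP => gtc.
pose de := c0 * x 0 i0 + c1 * x 0 i1 - c.
have de0 : 0 < de by rewrite subr_gt0.
pose S (y : E) := \sum_(k | (k != i0) && (k != i1)) y 0 k ^+ 2.
have S0 y : 0 <= S y by apply: sumr_ge0 => k _; exact: sqr_ge0.
have [eta [eps [C [eta0 eps0 C1 etar [epsS epsn epsC]]]]] := max_constants c de0 (S0 x).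
pose q : E := \row_k (if (k == i0) || (k == i1) then eta else - eps).
pose Phi := quad (plane_vec i0 i1 c0 c1) q.
have q0 : q 0 i0 = eta by rewrite mxE eqxx.
have q1 : q 0 i1 = eta by rewrite mxE eqxx orbT.
have qout k : (k != i0) && (k != i1) -> q 0 k = - eps.
  by move=> /andP[k0 k1]; rewrite mxE (negbTE k0) (negbTE k1).
have PhiE y : Phi y = c0 * y 0 i0 + c1 * y 0 i1 + (eta * Q y - eps * S y).
  rewrite /Phi /quad dot_plane_vec (sum_plane i01) q0 q1 -mulrDr; congr (_ + (_ + _)).
  rewrite /S mulr_sumr -sumrN; apply: eq_bigr => k kout.
  by rewrite qout// mulNr.
have etaQ y : Q y <= r ^+ 2 -> eta * Q y <= de / 4.
  by move=> Qy; apply: le_trans etar; rewrite ler_pM2l.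
have Q0 (y : E) : 0 <= Q y by rewrite addr_ge0// sqr_ge0.
have Phix : c + 3 / 4 * de <= Phi x.
  rewrite PhiE; have : 0 <= eta * Q x := mulr_ge0 (ltW eta0) (Q0 x).
  by move: epsS; rewrite /de; lra.
have lin y : Q y <= r ^+ 2 -> c0 * y 0 i0 + c1 * y 0 i1 <= r.
  by move=> Qy; exact: max_linear.
(* the maximum over the part of M in the cylinder *)
pose B := r + `|x| + 1 + C / eps.
have C0 : 0 < C by apply: lt_trans C1; rewrite ltr_wpDr// addr_gt0// mulr_gt0.
have Ce0 : 0 < C / eps by exact: divr_gt0.
have B0 : [/\ 1 <= B, r <= B, `|x| <= B & C / eps <= B].
  by rewrite /B; have := normr_ge0 x; move: Ce0 r0; split; lra.
have [B1 rB xB CB] := B0.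
pose A := (M `&` [set y : E | `|y - 0| <= B]) `&` [set y | Q y <= r ^+ 2].
have cA : compact A.
  apply: compact_closedI; last exact: closed_cylinder.
  by apply: pM; exact: compact_cball.
have Ax : A x by split=> //; split=> //=; rewrite subr0.
have [z zA zmaxA] : exists2 z, z \in A & forall t, t \in A -> Phi t <= Phi z.
  apply: compact_EVT_max cA _; first by exists x.
  by apply: continuous_subspaceT => y; exact: quad_continuous.
have [[Mz _] Qz] : A z by rewrite inE in zA.
have Phiz : c + 3 / 4 * de <= Phi z by apply: le_trans Phix _; apply: zmaxA; rewrite inE.
have coordr (y : E) k : Q y <= r ^+ 2 -> (k == i0) || (k == i1) -> `|y 0 k| <= r.
  move=> Qy kk; rewrite -(@ler_pXn2r _ 2)// ?nnegrE ?normr_ge0 ?(ltW r0)//.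
  rewrite real_normK ?num_real//; apply: le_trans Qy; rewrite /axis_dist2.
  by case/orP: kk => /eqP->; rewrite ?lerDl ?lerDr sqr_ge0.
have far y : Q y <= r ^+ 2 -> B < `|y| -> Phi y < c + 3 / 4 * de.
  move=> Qy yB; have [k yk] : exists k, B < `|y 0 k|.
    apply: contrapT => H; move: yB; apply/negP; rewrite -leNgt.
    apply: norm_le_coord => [|k]; first by apply: le_trans B1.
    by rewrite leNgt; apply/negP => yk; apply: H; exists k.
  have kout : (k != i0) && (k != i1).
    rewrite -negb_or; apply/negP => /(coordr _ _ Qy); apply/negP; rewrite -ltNge.
    exact: le_lt_trans yk.
  have Sk : B ^+ 2 <= S y.
    apply: (@le_trans _ _ (y 0 k ^+ 2)).
      rewrite -[y 0 k ^+ 2]real_normK ?num_real// ler_pXn2r// ?nnegrE ?normr_ge0//.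
        exact: ltW.
      by apply: le_trans B1.
    rewrite /S (bigD1 k)//= lerDl; apply: sumr_ge0 => j _; exact: sqr_ge0.
  have BS : B <= S y by apply: le_trans Sk; rewrite expr2 ler_peMl// (le_trans _ B1).
  have CS : C <= eps * S y.
    by rewrite mulrC -ler_pdivrMr//; apply: le_trans BS.
  rewrite PhiE; move: (lin y Qy) (etaQ y Qy) C1 CS (ler_norm (- c)) de0 r0; rewrite normrN.
  by move: (_ + _ * y 0 i1) (eta * Q y) (eps * S y) => a b d; lra.
have zmax y : M y -> Q y <= r ^+ 2 -> Phi y <= Phi z.
  move=> My Qy; have [yB|yB] := leP `|y| B.
    by apply: zmaxA; rewrite inE; split=> //; split=> //=; rewrite subr0.
  by apply: ltW; apply: lt_le_trans Phiz; exact: far.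
have notline al be : c0 * al + c1 * be = c -> ~ (z 0 i0 = al /\ z 0 i1 = be).
  move=> cE [z0 z1]; move: Phiz; rewrite PhiE z0 z1 cE.
  move: (etaQ z Qz) (mulr_ge0 (ltW eta0) (Q0 z)) (mulr_ge0 (ltW eps0) (S0 z)) de0.
  by move: (eta * Q z) (eps * S z) => a b; lra.
have nz := int z Mz Qz (notline _ _ cal1) (notline _ _ cal2).
have [W [F [u [par Wu Fu]]]] := smM Mz; rewrite -Fu in nz Phiz zmax.
have umax : \forall v \near u, Phi (F v) <= Phi (F u).
  apply: filterS2 (param_cont par Wu nz) (param_near par (param_in par) Wu).
  by move=> v Qv Mv; apply: zmax => //; exact: Qv.
have := quad_max orN eqH par Wu umax.
have out_max : (ord_max != i0) && (ord_max != i1) by rewrite ![ord_max == _]eq_sym i0n.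
rewrite qout// plane_vec_out; [|by case/andP: out_max|by case/andP: out_max].
rewrite (sum_plane i01) q0 q1 Fu.
have N1 : dot (N z) (N z) = 1.
  by have [_ H _] := orN; apply: enorm1; exact: H.
have Q1 := axis_dist2_le1 i01 N1; rewrite /axis_dist2 in Q1.
have sumout : - (eps * n.+1%:R) <=
    \sum_(k | (k != i0) && (k != i1)) q 0 k * (1 - N z 0 k ^+ 2).
  rewrite -mulNr mulr_natr; apply: (@le_trans _ _ (\sum_(k : 'I_n.+1) - eps)).
    by rewrite sumr_const card_ord.
  rewrite (sum_plane i01); apply: (@le_trans _ _ (\sum_(k | (k != i0) && (k != i1)) - eps)).
    by rewrite gerDr -opprD oppr_le0 addr_ge0 ?ltW.
  apply: ler_sum => k kout; rewrite qout// mulNr lerN2 ler_piMr ?(ltW eps0)//.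
  by rewrite gerDl oppr_le0 sqr_ge0.
have zn : `|eps * z 0 ord_max| <= eta / 4.
  rewrite -(@ler_pXn2r _ 2)// ?nnegrE ?normr_ge0 ?divr_ge0 ?(ltW eta0)//.
  rewrite real_normK ?num_real//; apply: le_trans epsC; rewrite exprMn expr2 -mulrA ler_pM2l//.
  apply: (@le_trans _ _ (eps * S z)).
    rewrite ler_pM2l// /S (bigD1 ord_max)//= lerDl.
    by apply: sumr_ge0 => j _; exact: sqr_ge0.
  move: Phiz; rewrite Fu PhiE.
  move: (lin z Qz) (etaQ z Qz) C1 (ler_norm (- c)) de0 r0; rewrite normrN.
  by move: (_ + _ * z 0 i1) (eta * Q z) (eps * S z) => a b d; lra.
move: sumout epsn eta0 zn; rewrite ler_norml => + + + /andP[_].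
move: Q1 (\sum_(k | _) _) (eps * n.+1%:R); rewrite -mulrA mulNr.
move: (N z 0 i0 ^+ 2) (N z 0 i1 ^+ 2) (eps * z 0 ord_max) => a b d ab s t.
move=> ts te eta0' dd.
have : 0 <= eta * (1 - a - b) by rewrite mulr_ge0 ?(ltW eta0')//; lra.
by rewrite !mulrBr mulr1; lra.
Qed.

End max_principle.

(** * A graph over a half-hyperplane, outside the cylinder *)

Section euclidean_topology.
Variables (R : realType) (n : nat).
Local Notation E := 'rV[R]_n.+1.
Implicit Types (x y z q m : E).

Lemma dot_norm_le x v : `|dot x v| <= (1 + \sum_k `|v 0 k|) * `|x|.
Proof.
rewrite mulrDl mul1r ler_wpDl// mulr_suml; apply: le_trans (ler_norm_sum _ _ _) _.
apply: ler_sum => k _; rewrite normrM mulrC ler_wpM2l//; exact: coord_le_norm.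
Qed.

Lemma dot_near v (eps : R) : 0 < eps -> exists2 d : R, 0 < d &
  forall x y, `|x - y| < d -> `|dot x v - dot y v| < eps.
Proof.
move=> eps0; set c := 1 + \sum_k `|v 0 k|.
have c0 : 0 < c by rewrite ltr_pwDl// sumr_ge0.
exists (eps / c); first exact: divr_gt0.
move=> x y xy; rewrite -dotBl; apply: le_lt_trans (dot_norm_le _ _) _.
by rewrite -/c mulrC -ltr_pdivlMr.
Qed.

Lemma closureP (A : set E) x : closure A x <->
  forall eps : R, 0 < eps -> exists2 m, A m & `|m - x| < eps.
Proof.
split=> [cl eps eps0|H B /nearP[d d0 dB]].
  have [m [Am mx]] : A `&` [set y : E | `|y - x| < eps] !=set0.
    by apply: cl; apply/nearP; exists eps.
  by exists m.
by have [m Am mx] := H d d0; exists m; split=> //; exact: dB.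
Qed.

Lemma seg_ball (t d : R) x y z : 0 <= t <= 1 -> `|x - z| < d -> `|y - z| < d ->
  `|x + t *: (y - x) - z| < d.
Proof.
move=> /andP[t0 t1] xz yz.
have -> : x + t *: (y - x) - z = (1 - t) *: (x - z) + t *: (y - z).
  by apply/rowP => k; rewrite !mxE; ring.
apply: le_lt_trans (ler_normD _ _) _; rewrite !normrZ !ger0_norm// ?subr_ge0//.
have [t00|t0'] := eqVneq t 0; first by rewrite t00 subr0 mul1r mul0r addr0.
have tp : 0 < t by rewrite lt0r t0'.
have : (1 - t) * `|x - z| <= (1 - t) * d by rewrite ler_wpM2l ?subr_ge0// ltW.
have : t * `|y - z| < t * d by rewrite ltr_pM2l.
by rewrite mulrBl mul1r; lra.
Qed.

End euclidean_topology.

(** A graph over an open half-hyperplane with normal nu, bounded by the level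
    tp of the coordinate in the inward direction w, all of it outside the
    cylinder of radius r whose axis is orthogonal to nu and w. *)
Section graph_end.
Variables (R : realType) (n : nat).
Local Notation E := 'rV[R]_n.+1.
Variables (nu w : E) (tp r : R) (g : E -> R) (M1 : set E).
Hypothesis nu1 : dot nu nu = 1.
Hypothesis w1 : dot w w = 1.
Hypothesis nuw : dot nu w = 0.
Hypothesis r0 : 0 < r.
Hypothesis gC : forall z, tp < dot z w -> g y @[y --> z] --> g z.
Hypothesis g_nu : forall z a, g (z + a *: nu) = g z.
Hypothesis M1E : forall m, M1 m <-> tp < dot m w /\ dot m nu = g m.
Local Notation Q x := (dot x nu ^+ 2 + dot x w ^+ 2).
Hypothesis M1out : forall m, M1 m -> r ^+ 2 < Q m.
Implicit Types (x y z q m : E).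

Lemma graph_ivt m0 m1 (v : R) : M1 m0 -> M1 m1 -> dot m0 nu <= v <= dot m1 nu ->
  exists2 t : R, 0 <= t <= 1 &
    let z := m0 + t *: (m1 - m0) in M1 (z + (v - dot z nu) *: nu).
Proof.
move=> /M1E[m0w m0g] /M1E[m1w m1g] /andP[v0 v1].
pose line (t : R) : E := m0 + t *: (m1 - m0).
have linew (t : R) : 0 <= t <= 1 -> tp < dot (line t) w.
  move=> /andP[t0 t1]; rewrite dotDl dotZl dotBl.
  have [t00|t0'] := eqVneq t 0; first by rewrite t00 mul0r addr0.
  have tpos : 0 < t by rewrite lt0r t0'.
  have : (1 - t) * tp <= (1 - t) * dot m0 w by rewrite ler_wpM2l ?subr_ge0// ltW.
  have : t * tp < t * dot m1 w by rewrite ltr_pM2l.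
  by rewrite mulrBr !mulrBl !mul1r; lra.
have [||t] := @IVT R (g \o line) 0 1 v ler01.
- apply: continuous_in_subspaceT => t; rewrite inE/= in_itv/= => t01.
  apply: (cvg_comp line g); last exact/gC/linew.
  apply: cvgD; first exact: cvg_cst.
  by apply: cvgZr_tmp; exact: cvg_id.
- rewrite /= /line scale0r addr0 scale1r addrC subrK -m0g -m1g.
  by rewrite ge_min v0 le_max v1 orbT.
rewrite in_itv/= => t01 gt; exists t => //=; apply/M1E.
rewrite -/(line t); move: (linew t t01) gt => /=; move: (line t) => z zw gz.
by rewrite !(dotDl z) !dotZl nuw nu1 mulr0 addr0 mulr1 g_nu addrC subrK gz.
Qed.

Lemma closure_level q : closure M1 q -> tp <= dot q w.
Proof.
move=> /closureP cl; rewrite leNgt; apply/negP => lt.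
have gap : 0 < tp - dot q w by rewrite subr_gt0.
have [d d0 dP] := dot_near w gap.
have [m /M1E[mw _] /dP] := cl d d0.
by rewrite ltr_norml => /andP[_]; rewrite ltrD2r ltNge (ltW mw).
Qed.

(** A graph of a continuous function is closed over its domain. *)
Lemma closure_interior q : closure M1 q -> tp < dot q w -> M1 q.
Proof.
move=> /closureP cl qw; apply/M1E; split=> //; apply/eqP; rewrite -subr_eq0 -normr_le0.
rewrite leNgt; apply/negP => pos; set eps := `|_| in pos.
have e2 : 0 < eps / 2 by exact: divr_gt0.
have [d d0 dP] := dot_near nu e2.
have /cvg_rVP/(_ _ e2)[d' d'0 d'P] := gC qw.
have dd' : 0 < Num.min d d' by rewrite lt_min d0.
have [m /M1E[_ mg]] := cl _ dd'.
rewrite lt_min => /andP[/dP md /d'P md'].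
have : eps <= `|dot m nu - dot q nu| + `|g m - g q|.
  by apply: le_trans (ler_distD (dot m nu) _ _) _; rewrite [X in X + _]distrC [X in _ + `|X - _|]mg.
by move: md md'; lra.
Qed.

Lemma closure_cylinder q : closure M1 q -> r ^+ 2 <= Q q.
Proof.
move=> /closureP cl; rewrite leNgt; apply/negP => lt.
have dotC1 (v : E) : dot y v @[y --> q] --> dot q v.
  by apply/cvg_rVP => eps eps0; have [d d0 dP] := dot_near v eps0; exists d => // y; exact: dP.
have /cvg_rVP/(_ (r ^+ 2 - Q q)) : Q y @[y --> q] --> Q q.
  by apply: cvgD; apply: cvgM; exact: dotC1.
rewrite subr_gt0 => /(_ lt)[d d0 dP]; have [m /M1out mr /dP] := cl d d0.
by rewrite ltr_norml => /andP[_]; rewrite ltrD2r ltNge (ltW mr).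
Qed.

Lemma end_boundary q : closure M1 q -> Q q <= r ^+ 2 ->
  dot q w = tp /\ dot q nu ^+ 2 + tp ^+ 2 = r ^+ 2.
Proof.
move=> cl Qq; have qtp : dot q w = tp.
  apply/eqP; rewrite eq_le closure_level// andbT leNgt; apply/negP => gt.
  by have := M1out (closure_interior cl gt); rewrite ltNge Qq.
by split=> //; apply/eqP; rewrite eq_le -qtp Qq/= closure_cylinder.
Qed.

(** Where the graph reaches the cylinder it stays on one side of the axis: on
    a segment joining the two sides it would enter the cylinder. *)
Lemma end_one_side q q' : closure M1 q -> closure M1 q' -> Q q <= r ^+ 2 ->
  Q q' <= r ^+ 2 -> dot q nu <= dot q' nu.
Proof.
move=> cl cl' Qq Qq'; rewrite leNgt; apply/negP => lt.
have [qw qr] := end_boundary cl Qq; have [qw' qr'] := end_boundary cl' Qq'.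
have opp : dot q' nu = - dot q nu.
  have /eqP : dot q' nu ^+ 2 = dot q nu ^+ 2 by apply: (addIr (tp ^+ 2)); rewrite qr.
  by rewrite eqf_sqr => /orP[/eqP eq|/eqP//]; move: lt; rewrite eq ltxx.
have qpos : 0 < dot q nu by move: lt; rewrite opp; lra.
have tpr : `|tp| < r.
  rewrite -(@ltr_pXn2r _ 2)// ?nnegrE ?(ltW r0)// real_normK ?num_real// -qr.
  by rewrite ltrDr exprn_gt0.
have [d d0 dP] := dot_near nu qpos.
have rt : 0 < r - `|tp| by rewrite subr_gt0.
have [d' d'0 d'P] := dot_near w rt.
have dd : 0 < Num.min d d' by rewrite lt_min d0.
have [m Mm] := (closureP _ _).1 cl _ dd; have [m' Mm'] := (closureP _ _).1 cl' _ dd.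
rewrite !lt_min => /andP[/dP mn' /d'P mw'] /andP[/dP mn /d'P mw].
have [|t /andP[t0 t1] /=] := graph_ivt (v := 0) Mm' Mm.
  move: mn mn'; rewrite !ltr_norml => /andP[mn _] /andP[_ mn']; move: opp mn mn'.
  by move: (dot q nu) (dot q' nu) (dot m nu) (dot m' nu) => a b c e; lra.
set z := m' + _ => Mz; have [zw _] := (M1E _).1 Mz; have := M1out Mz.
rewrite ltNge => /negP; apply.
have zw' : dot z w = dot m' w + t * (dot m w - dot m' w) by rewrite dotDl dotZl dotBl.
move: zw; rewrite !(dotDl z) !dotZl nuw nu1 mulr1 mulr0 addr0 sub0r subrr expr0n add0r.
move=> zw; rewrite -[X in X <= _]real_normK ?num_real// ler_pXn2r// ?nnegrE ?(ltW r0)//.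
move: mw mw'; rewrite qw qw' !ltr_norml => /andP[mw2 mw1] /andP[mw2' mw1'].
have ub : dot z w <= tp + (r - `|tp|).
  rewrite zw'; have : t * (dot m w - tp) <= t * (r - `|tp|) by rewrite ler_wpM2l// ltW.
  have : (1 - t) * (dot m' w - tp) <= (1 - t) * (r - `|tp|).
    by rewrite ler_wpM2l ?subr_ge0// ltW.
  by rewrite !mulrBr !mulrBl !mul1r; lra.
rewrite ler_norml; apply/andP; split; last by have := ler_norm tp; lra.
have := ler_norm (- tp); rewrite normrN; lra.
Qed.

Lemma end_height_eq q q' : closure M1 q -> closure M1 q' -> Q q <= r ^+ 2 ->
  Q q' <= r ^+ 2 -> dot q nu = dot q' nu.
Proof. by move=> *; apply/eqP; rewrite eq_le !end_one_side. Qed.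

Hypothesis closure_out : forall m, closure M1 m -> ~ M1 m -> Q m <= r ^+ 2.

Lemma closure_height q m : closure M1 q -> Q q <= r ^+ 2 -> closure M1 m ->
  dot m w = tp -> dot m nu = dot q nu.
Proof.
move=> cl Qq clm mw; apply: end_height_eq => //; apply: closure_out => // /M1E[].
by rewrite mw ltxx.
Qed.

Local Notation P q m := (m - (dot m nu - dot q nu) *: nu).

(** Over the boundary of the half-hyperplane the closure of the graph only has
    the height of q ([closure_height]). So the graph near q does not take a
    height at distance 1 from it, and by the intermediate value theorem no
    height farther away. *)
Lemma end_bounded q : closure M1 q -> Q q <= r ^+ 2 ->
  exists2 d : R, 0 < d & forall m, M1 m -> `|P q m - q| < d ->
    `|dot m nu - dot q nu| < 1.
Proof.
move=> cl Qq; have [qw _] := end_boundary cl Qq.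
have away (s : R) : s != 0 -> exists2 d : R, 0 < d & forall m, M1 m -> d <= `|m - (q + s *: nu)|.
  move=> s0; apply: contrapT => H.
  have : closure M1 (q + s *: nu).
    apply/closureP => eps eps0; apply: contrapT => H'; apply: H; exists eps => // m Mm.
    by rewrite leNgt; apply/negP => lt; apply: H'; exists m.
  move=> /(closure_height cl Qq); rewrite !dotDl !dotZl nuw nu1 mulr0 mulr1 addr0.
  move=> /(_ qw)/eqP; rewrite -subr_eq0 addrC addrA addNr add0r; exact/negP.
have [d1 d10 d1P] := away 1 (oner_neq0 _).
have [|d2 d20 d2P] := away (- 1); first by rewrite oppr_eq0 oner_neq0.
have dd : 0 < Num.min d1 d2 by rewrite lt_min d10.
have Pq m : P q m - q = (m - q) - dot (m - q) nu *: nu.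
  by rewrite dotBl addrAC.
have [m0 Mm0 [m0P m0nu]] : exists2 m0, M1 m0 &
    `|P q m0 - q| < Num.min d1 d2 /\ `|dot m0 nu - dot q nu| < 1.
  pose c := `|nu| + 1; have c1 : 0 < c by rewrite ltr_wpDl.
  pose e := Num.min 1 (Num.min d1 d2 / (2 * c)).
  have e0 : 0 < e by rewrite lt_min ltr01 divr_gt0// mulr_gt0.
  have [d d0 dP] := dot_near nu e0.
  have e'0 : 0 < Num.min d (Num.min d1 d2 / 2) by rewrite lt_min d0 divr_gt0.
  have [m Mm] := (closureP _ _).1 cl _ e'0; rewrite lt_min => /andP[/dP md mh].
  exists m => //; move: md; rewrite lt_min => /andP[md1 md2]; split=> //.
  rewrite Pq; apply: le_lt_trans (ler_normB _ _) _; rewrite normrZ dotBl.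
  have : `|dot m nu - dot q nu| * `|nu| <= Num.min d1 d2 / 2.
    apply: (@le_trans _ _ (Num.min d1 d2 / (2 * c) * c)).
      by apply: ler_pM => //; [exact: ltW|rewrite lerDl].
    by rewrite invfM mulrA divfK// gt_eqF.
  by move: mh; lra.
exists (Num.min d1 d2) => // m Mm mP; rewrite ltNge; apply/negP => big.
have segP (t : R) a b : 0 <= t <= 1 -> `|P q a - q| < Num.min d1 d2 ->
    `|P q b - q| < Num.min d1 d2 -> `|P q (a + t *: (b - a)) - q| < Num.min d1 d2.
  move=> t01 aP bP; rewrite (_ : P q _ = P q a + t *: (P q b - P q a)); first exact: seg_ball.
  rewrite dotDl dotZl dotBl; move: (dot a nu) (dot b nu) (dot q nu) => x y z.
  by apply/rowP => k; rewrite !mxE; ring.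
move: m0nu; rewrite ltr_norml => /andP[l0 u0].
have shift (z : E) (s : R) :
    z + (dot q nu + s - dot z nu) *: nu - (q + s *: nu) = P q z - q.
  move: (dot z nu) (dot q nu) => x y.
  by apply/rowP => k; rewrite !mxE; ring.
have [mpos|mneg] := leP 1 (dot m nu - dot q nu).
  have [|t t01 /= Mz] := graph_ivt (v := dot q nu + 1) Mm0 Mm.
    by apply/andP; split; lra.
  have := d1P _ Mz; rewrite shift leNgt => /negP; apply.
  by apply: lt_le_trans (segP _ _ _ t01 m0P mP) _; rewrite ge_min lexx.
have [|t t01 /= Mz] := graph_ivt (v := dot q nu + - 1) Mm Mm0.
  have : dot m nu - dot q nu <= - 1.
    by move: big; rewrite ler_normr => /orP[]; lra.
  by move=> ?; apply/andP; split; lra.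
have := d2P _ Mz; rewrite shift leNgt => /negP; apply.
by apply: lt_le_trans (segP _ _ _ t01 mP m0P) _; rewrite ge_min lexx orbT.
Qed.

(** The heights over the points approaching q + y in the direction w are bounded
    by [end_bounded], so that they have a cluster point; [closure_height] shows
    that it is the height of q. *)
Lemma end_line q : closure M1 q -> Q q <= r ^+ 2 ->
  exists2 d : R, 0 < d & forall y, dot y nu = 0 -> dot y w = 0 -> `|y| < d ->
    closure M1 (q + y).
Proof.
move=> cl Qq; have [qw _] := end_boundary cl Qq.
have [d d0 dP] := end_bounded cl Qq.
exists (d / 2); first exact: divr_gt0.
move=> y ynu yw yd.
pose c := `|w| + 1; have c1 : 0 < c by rewrite ltr_wpDl.
pose tau k : R := d / (2 * c) * k.+1%:R^-1.
have tau0 k : 0 < tau k by rewrite mulr_gt0// ?invr_gt0 ?ltr0Sn// divr_gt0// mulr_gt0.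
have tauc k : tau k * c <= d / 2.
  rewrite /tau mulrAC [d / _ * c](_ : _ = d / 2); last by rewrite invfM mulrA divfK// gt_eqF.
  by rewrite ler_piMr ?divr_ge0 ?(ltW d0)// invf_le1 ?ltr0Sn// ler1n.
pose b k := q + y + tau k *: w.
pose s k := g (b k) - dot q nu.
pose m k := b k + s k *: nu.
have bw k : dot (b k) w = tp + tau k by rewrite !dotDl dotZl w1 mulr1 qw yw addr0.
have bnu k : dot (b k) nu = dot q nu.
  by rewrite !dotDl dotZl [dot w nu]dotC nuw mulr0 ynu !addr0.
have mnu k : dot (m k) nu - dot q nu = s k.
  by rewrite dotDl dotZl nu1 mulr1 bnu addrC addKr.
have Mm k : M1 (m k).
  apply/M1E; split; first by rewrite dotDl dotZl nuw mulr0 addr0 bw ltrDl.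
  by rewrite g_nu -[dot _ _](subrK (dot q nu)) mnu subrK.
have s1 k : `|s k| < 1.
  rewrite -mnu; apply: dP => //; rewrite mnu /m addrK /b.
  rewrite (_ : q + y + tau k *: w - q = y + tau k *: w); last first.
    by apply/rowP => i; rewrite !mxE; ring.
  apply: le_lt_trans (ler_normD _ _) _; rewrite normrZ gtr0_norm//.
  have : tau k * `|w| <= d / 2 by apply: le_trans (tauc k); rewrite ler_pM2l// lerDl.
  by move: yd; lra.
have [|sg [_ cls]] := @segment_compact R (- 1) 1 (s @ \oo).
  exists 0%N => // k _ /=; rewrite in_itv/=.
  by have := s1 k; rewrite ltr_norml => /andP[? ?]; rewrite !ltW.
have near_cluster (eps : R) : 0 < eps -> exists2 k, tau k * c < eps & `|s k - sg| < eps.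
  move=> eps0; pose K := Num.bound (d / 2 / eps).
  have [_ [[k /= Kk <-]]] : [set s k | k in [set k | (K <= k)%N]] `&` [set x | `|x - sg| < eps] !=set0.
    apply: cls; first by exists K => // k Kk; exists k.
    by apply/nbhs_ballP; exists eps => // x; rewrite /ball/= distrC.
  exists k => //; rewrite /tau mulrAC [d / _ * c](_ : _ = d / 2); last first.
    by rewrite invfM mulrA divfK// gt_eqF.
  have dk : d / 2 / eps < k.+1%:R.
    apply: lt_le_trans (archi_boundP _) _; first by rewrite !divr_ge0// ltW.
    by rewrite ler_nat ltnW.
  by rewrite ltr_pdivrMr ?ltr0Sn// [eps * _]mulrC -ltr_pdivrMr.
have clm : closure M1 (q + y + sg *: nu).
  apply/closureP => eps eps0; pose c' := `|nu| + 1; have c'1 : 0 < c' by rewrite ltr_wpDl.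
  have e2 : 0 < eps / 2 by exact: divr_gt0.
  have [|k tk sk] := near_cluster (Num.min (eps / 2) (eps / 2 / c')).
    by rewrite lt_min e2 divr_gt0.
  exists (m k) => //.
  rewrite (_ : m k - _ = tau k *: w + (s k - sg) *: nu); last first.
    by rewrite /m /b; apply/rowP => i; rewrite !mxE; ring.
  apply: le_lt_trans (ler_normD _ _) _.
  rewrite (normrZ (tau k)) (normrZ (s k - sg)) gtr0_norm//.
  move: tk sk; rewrite !lt_min => /andP[tk _] /andP[_ sk].
  have : tau k * `|w| <= tau k * c by rewrite ler_pM2l// lerDl.
  have : `|s k - sg| * `|nu| <= eps / 2.
    apply: (@le_trans _ _ (eps / 2 / c' * c')); last by rewrite divfK// gt_eqF.
    by apply: ler_pM => //; [exact: ltW|rewrite lerDl].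
  by move: tk; lra.
have : dot (q + y + sg *: nu) nu = dot q nu.
  by apply: (closure_height cl) => //; rewrite !dotDl dotZl nuw mulr0 qw yw !addr0.
rewrite !dotDl dotZl nu1 mulr1 ynu addr0 => /eqP; rewrite addrC -subr_eq0 addrK => /eqP sg0.
by move: clm; rewrite sg0 scale0r addr0.
Qed.

End graph_end.

(** * The ends of the hypersurface *)

Lemma connected_between (T : topologicalType) (A B : set T) :
  connected A -> A `<=` B -> B `<=` closure A -> connected B.
Proof.
move=> cA AB BA U [z Uz] [C1 oC1 C1E] [C2 cC2 C2E].
have AU : A `<=` U.
  suff <- : A `&` U = A by move=> x [].
  apply: cA.
  - move: Uz; rewrite C1E => -[Bz C1z].
    have [x [Ax C1x]] := BA z Bz C1 (open_nbhs_nbhs (conj oC1 C1z)).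
    by exists x; split=> //; split=> //; exact: AB.
  - by exists C1 => //; rewrite C1E setIA (setIidl AB).
  - by exists C2 => //; rewrite C2E setIA (setIidl AB).
rewrite eqEsubset; split; first by rewrite C1E => x [].
move=> x Bx; rewrite C2E; split=> //; rewrite ((closure_id C2).1 cC2).
by apply: (closureS _ (BA x Bx)) => y /AU; rewrite C2E => -[].
Qed.

Lemma component_closure (T : topologicalType) (A : set T) x z :
  A x -> closure (connected_component A x) z -> A z -> connected_component A x z.
Proof.
move=> Ax cl Az.
apply: (@connected_component_max _ _ (connected_component A x `|` [set z])).
- by left; exact: connected_component_refl.
- by move=> y [/connected_component_sub//|->].
- apply: (connected_between (component_connected (A := A) (x := x))); first by left.
  by move=> y [|->//]; exact: subset_closure.
- by right.
Qed.

Section ends.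
Variables (R : realType) (n : nat) (i0 i1 : 'I_n.+1).
Local Notation E := 'rV[R]_n.+1.
Local Notation Q := (axis_dist2 i0 i1).
Hypothesis i01 : i0 != i1.
Variable r : R.
Hypothesis r0 : 0 < r.
Local Notation C := [set x : E | Q x <= r ^+ 2].

Section half_hyperplane.
Variable H : half_hyperplane R n.
Local Notation nu := (hh_nu H).
Local Notation w := (hh_w H).
Local Notation p := (hh_pt H).

Lemma hh_setE x : hh_set H x <-> dot (x - p) nu = 0 /\ 0 < dot (x - p) w.
Proof.
have w1 := enorm1 (hh_w_unit H); have nuw := hh_orth H.
split=> [[y [t [[ynu yw] t0 ->]]]|[xnu xw]].
  by rewrite addrAC !(dotDl (y - p)) ynu yw !dotZl w1 mulr1 [dot w nu]dotC nuw mulr0 !add0r.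
exists (x - dot (x - p) w *: w), (dot (x - p) w); split=> //; last by rewrite subrK.
rewrite /hh_boundary/= addrAC; split; rewrite (dotBl (x - p)) dotZl.
  by rewrite xnu [dot w nu]dotC nuw mulr0 subr0.
by rewrite w1 mulr1 subrr.
Qed.

(** The function is extended to a half-space, constantly in the direction nu. *)
Lemma asymptotic_graph M1 : asymptotic_to 1 M1 H -> exists g : E -> R,
  [/\ (forall z, dot p w < dot z w -> g y @[y --> z] --> g z),
      (forall z a, g (z + a *: nu) = g z) &
      forall m, M1 m <-> dot p w < dot m w /\ dot m nu = g m].
Proof.
have nu1 := enorm1 (hh_nu_unit H); have nuw := hh_orth H.
move=> [phi [smooth M1E _]].
pose foot z : E := z - dot (z - p) nu *: nu.
have footnu z : dot (foot z - p) nu = 0.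
  by rewrite /foot addrAC (dotBl (z - p)) dotZl nu1 mulr1 subrr.
have footw z : dot (foot z - p) w = dot z w - dot p w.
  by rewrite /foot addrAC (dotBl (z - p)) dotZl nuw mulr0 subr0 dotBl.
have foot_nu z a : foot (z + a *: nu) = foot z.
  rewrite /foot (_ : dot (z + a *: nu - p) nu = dot (z - p) nu + a); last first.
    by rewrite !dotBl dotDl dotZl nu1 mulr1 addrAC.
  by move: (dot _ nu) => b; apply/rowP => k; rewrite !mxE; ring.
have foot_set z : dot p w < dot z w -> hh_set H (foot z).
  by move=> zw; apply/hh_setE; rewrite footnu footw subr_gt0.
exists (fun z => dot p nu + phi (foot z)); split=> [z zw|z a|m].
- apply: cvgD; first exact: cvg_cst.
  have [|+ _] := smooth [::] _ (leq0n _); first by [].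
  move=> /subspace_continuousP/(_ _ (foot_set z zw)) phiC.
  apply/cvg_rVP => eps eps0.
  have /cvgrPdist_lt/(_ eps eps0) := phiC.
  rewrite /within/= => /nearP[d d0 dP].
  have dotC1 : dot (y - p) nu @[y --> z] --> dot (z - p) nu.
    apply/cvg_rVP => e e0; have [d' d'0 d'P] := dot_near nu e0; exists d' => // y yz.
    by apply: d'P; rewrite opprB addrA subrK.
  have footC : foot y @[y --> z] --> foot z.
    by apply: cvgB; [exact: cvg_id|exact: cvgZr_tmp dotC1].
  have /cvgrPdist_lt/(_ d d0) near_foot := footC.
  have [|d2 d20 d2P] := dot_near w (eps := dot z w - dot p w); first by rewrite subr_gt0.
  have : \forall y \near z, `|phi (foot y) - phi (foot z)| < eps.
    move/nearP: near_foot => [d3 d30 d3P]; apply/nearP.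
    exists (Num.min d2 d3); first by rewrite lt_min d20.
    move=> y; rewrite lt_min => /andP[/d2P yw /d3P yf]; rewrite distrC.
    apply: dP; first by rewrite distrC.
    apply: foot_set; move: yw; rewrite ltr_norml => /andP[+ _].
    by rewrite opprB ltrD2r.
  by move=> /nearP.
- by rewrite foot_nu.
rewrite M1E; split=> [[x xH <-]|[mw mnu]].
  have /hh_setE[xnu xw] := xH; have fx : foot (x + phi x *: nu) = x.
    by rewrite foot_nu /foot xnu scale0r subr0.
  rewrite fx dotDl dotZl nuw mulr0 addr0 dotDl dotZl nu1 mulr1.
  move: xnu xw; rewrite !dotBl subr_gt0 => /eqP; rewrite subr_eq0 => /eqP <-.
  by split.
exists (foot m); first exact: foot_set.
have -> : phi (foot m) = dot (m - p) nu by rewrite dotBl mnu addrC addKr.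
by rewrite /foot subrK.
Qed.

Hypothesis bC : hh_boundary H `<=` C.

(** The boundary of the half-hyperplane contains the line through p in the
    direction y, and a line in the cylinder is parallel to its axis. *)
Lemma boundary_direction (y : E) : dot y nu = 0 -> dot y w = 0 ->
  y 0 i0 = 0 /\ y 0 i1 = 0.
Proof.
move=> ynu yw.
have line (s : R) : Q (p + s *: y) <= r ^+ 2.
  by apply: bC; split; rewrite addrAC subrr add0r dotZl ?ynu ?yw mulr0.
have zero i : (forall s : R, (p 0 i + s * y 0 i) ^+ 2 <= r ^+ 2) -> y 0 i = 0.
  move=> le; apply: contrapT => /eqP y0; have := le ((r + 1 - p 0 i) / y 0 i).
  rewrite divfK// addrC subrK; apply/negP; rewrite -ltNge.
  by rewrite ltrXn2r ?nnegrE ?addr_ge0 ?(ltW r0)// ltrDl.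
split; apply: zero => s; apply: le_trans (line s); rewrite /axis_dist2.
  by rewrite -[X in X <= _]addr0 [X in _ <= X + _](_ : _ = (p 0 i0 + s * y 0 i0) ^+ 2) ?lerD2l ?sqr_ge0// !mxE.
by rewrite -[X in X <= _]add0r [X in _ <= _ + X](_ : _ = (p 0 i1 + s * y 0 i1) ^+ 2) ?lerD2r ?sqr_ge0// !mxE.
Qed.

(** The plane of nu and w is the plane of the cross sections. *)
Lemma plane_coordinate i (x : E) : (i == i0) || (i == i1) ->
  x 0 i = nu 0 i * dot x nu + w 0 i * dot x w.
Proof.
move=> ii; have nu1 := enorm1 (hh_nu_unit H); have nuw := hh_orth H.
have w1 := enorm1 (hh_w_unit H).
pose y := stdvec R i - nu 0 i *: nu - w 0 i *: w.
have edot v : dot (stdvec R i) v = v 0 i by rewrite dotC dot_stdvec.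
have ynu : dot y nu = 0.
  by rewrite !(dotBl, dotZl) edot nu1 [dot w nu]dotC nuw mulr0 mulr1 subrr subr0.
have yw : dot y w = 0.
  by rewrite !(dotBl, dotZl) edot w1 nuw mulr0 mulr1 subr0 subrr.
have y0 : y = 0.
  apply: dot_eq0; rewrite {2}/y !(dotBr, dotZr) ynu yw !mulr0 !subr0 dot_stdvec.
  by have [] := boundary_direction ynu yw; case/orP: ii => /eqP->.
have eE : stdvec R i = nu 0 i *: nu + w 0 i *: w.
  by apply/eqP; rewrite -subr_eq0 opprD addrA; apply/eqP.
by rewrite -dot_stdvec eE dotDr !dotZr.
Qed.

Lemma plane_isometry (x : E) : Q x = dot x nu ^+ 2 + dot x w ^+ 2.
Proof.
have c0 y := plane_coordinate y (i := i0) (introT orP (or_introl (eqxx i0))).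
have c1 y := plane_coordinate y (i := i1) (introT orP (or_intror (eqxx i1))).
have edot i v : dot (stdvec R i) v = v 0 i by rewrite dotC dot_stdvec.
have e00 := c0 (stdvec R i0); have e01 := c1 (stdvec R i0); have e11 := c1 (stdvec R i1).
rewrite !edot !mxE !eqxx ?[i1 == i0]eq_sym ?(negbTE i01) in e00 e01 e11.
rewrite /axis_dist2 c0 c1.
move: (nu 0 i0) (w 0 i0) (nu 0 i1) (w 0 i1) (dot x nu) (dot x w) e00 e01 e11.
move=> a b c d S T /= /esym e00' /esym e01' /esym e11'.
have e00 : a * a + b * b = 1 := e00'.
have e01 : c * a + d * b = 0 := e01'.
have e11 : c * c + d * d = 1 := e11'.
pose D := a * d - b * c.
have D2 : D ^+ 2 = 1.
  rewrite (_ : D ^+ 2 = (a * a + b * b) * (c * c + d * d) - (c * a + d * b) ^+ 2).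
    by rewrite e00 e01 e11 expr0n subr0 mulr1.
  by rewrite /D; ring.
have dE : d = D * a.
  rewrite -[LHS]mulr1 -e00 [RHS](_ : _ = d * (a * a + b * b) - b * (c * a + d * b)).
    by rewrite e01 mulr0 subr0.
  by rewrite /D; ring.
have cE : c = - (D * b).
  rewrite -[LHS]mulr1 -e00 [RHS](_ : _ = c * (a * a + b * b) - a * (c * a + d * b)).
    by rewrite e01 mulr0 subr0.
  by rewrite /D; ring.
rewrite dE cE; rewrite (_ : _ + _ = (a * a + b * b) * S ^+ 2 + (a * a + b * b) * T ^+ 2 +
   (D ^+ 2 - 1) * (b * S - a * T) ^+ 2); last by ring.
by rewrite e00 D2 subrr mul0r addr0 !mul1r.
Qed.

Lemma graph_end_line M1 : asymptotic_to 1 M1 H -> (forall m, M1 m -> ~ C m) ->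
  (forall m, closure M1 m -> ~ M1 m -> C m) ->
  forall q, closure M1 q -> C q ->
  [/\ Q q = r ^+ 2,
      (forall x, closure M1 x -> C x -> x 0 i0 = q 0 i0 /\ x 0 i1 = q 0 i1) &
      exists2 d : R, 0 < d & forall y : E, y 0 i0 = 0 -> y 0 i1 = 0 -> `|y| < d ->
        closure M1 (q + y)].
Proof.
move=> as1 out clout q cl Cq.
have nu1 := enorm1 (hh_nu_unit H); have nuw := hh_orth H.
have w1 := enorm1 (hh_w_unit H).
have [g [gC g_nu M1E]] := asymptotic_graph as1.
have out' m : M1 m -> r ^+ 2 < dot m nu ^+ 2 + dot m w ^+ 2.
  by move=> /out; rewrite /= plane_isometry => /negP; rewrite -ltNge.
have clout' m : closure M1 m -> ~ M1 m -> dot m nu ^+ 2 + dot m w ^+ 2 <= r ^+ 2.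
  by rewrite -plane_isometry; exact: clout.
have Cq' := Cq; rewrite /= plane_isometry in Cq'.
have bd := end_boundary gC M1E out'; have [qw qr] := bd q cl Cq'.
split.
- by rewrite plane_isometry qw.
- move=> x clx Cx; rewrite /= plane_isometry in Cx; have [xw _] := bd x clx Cx.
  have xnu := end_height_eq nu1 nuw r0 gC g_nu M1E out' clx cl Cx Cq'.
  by rewrite !(plane_coordinate x, plane_coordinate q) ?eqxx ?orbT// xnu xw qw.
have [d d0 dP] := end_line nu1 w1 nuw r0 gC g_nu M1E out' clout' cl Cq'.
exists d => // y y0 y1 yd; have := plane_isometry y.
rewrite /axis_dist2 y0 y1 expr0n addr0 => /esym/eqP.
rewrite paddr_eq0 ?sqr_ge0// !sqrf_eq0 => /andP[/eqP ynu /eqP yw].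
exact: dP.
Qed.

End half_hyperplane.

(** The closure of M1 reaches the cylinder: otherwise M1 would be closed, and open
    as the complement of the closure of M2, in the connected set M. The lines
    are those of [graph_end_line], and near a point off both closures M has no
    point outside the cylinder. *)
Lemma ends (M : set E) (H1 H2 : half_hyperplane R n) : closed M -> connected M ->
  asymptotic_outside 1 C M H1 H2 ->
  exists al1 be1 al2 be2 : R, exists q : E,
  [/\ al1 ^+ 2 + be1 ^+ 2 = r ^+ 2 /\ al2 ^+ 2 + be2 ^+ 2 = r ^+ 2,
      M q /\ (q 0 i0 = al1 /\ q 0 i1 = be1),
      (forall x, M x -> C x -> ~ (x 0 i0 = al1 /\ x 0 i1 = be1) ->
        ~ (x 0 i0 = al2 /\ x 0 i1 = be2) -> \forall y \near x, M y -> C y) &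
      exists2 d : R, 0 < d & forall y : E, y 0 i0 = 0 -> y 0 i1 = 0 -> `|y| < d ->
        M (q + y)].
Proof.
move=> clM coM [b1 b2 [M1 [M2 [M12 comp as1 as2]]]].
pose A := M `\` C; have cC : closed C := closed_cylinder (r := r).
have compE (B : set E) : [set M1; M2] B -> exists2 x, A x & B = connected_component A x.
  by rewrite -comp => -[x Ax <-]; exists x.
have [x1 Ax1 M1E] := compE M1 (or_introl erefl).
have [x2 Ax2 M2E] := compE M2 (or_intror erefl).
have sub1 : M1 `<=` A by rewrite M1E; exact: connected_component_sub.
have sub2 : M2 `<=` A by rewrite M2E; exact: connected_component_sub.
have cl1 z : closure M1 z -> A z -> M1 z by rewrite M1E; exact: component_closure.
have cl2 z : closure M2 z -> A z -> M2 z by rewrite M2E; exact: component_closure.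
have cover z : A z -> M1 z \/ M2 z.
  move=> Az; have : [set M1; M2] (connected_component A z) by rewrite -comp; exists z.
  by have zz := connected_component_refl Az; move=> [] Ez; [left|right]; rewrite -Ez.
have disj z : M1 z -> ~ M2 z.
  rewrite M1E M2E => z1 z2; apply: M12.
  by rewrite M1E M2E (same_connected_component z1) (same_connected_component z2).
have clMi (B : set E) : B `<=` A -> closure B `<=` M.
  move=> BA; rewrite ((closure_id M).1 clM); apply: closureS => z.
  by move=> /BA[].
have reach : exists2 q, closure M1 q & C q.
  apply: contrapT => no; have M1cl : M1 = M `&` closure M1.
    rewrite eqEsubset; split=> z; first by move=> z1; split; [have [] := sub1 z z1|exact: subset_closure].
    by move=> [Mz clz]; apply: cl1 => //; split=> // Cz; apply: no; exists z.
  have M1op : M1 = M `&` (~` C `&` ~` closure M2).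
    rewrite eqEsubset; split=> z.
      move=> z1; have [Mz Cz] := sub1 z z1; split=> //; split=> // clz.
      by apply: (disj z z1); apply: cl2.
    move=> [Mz [Cz clz]]; have [//|z2] := cover z (conj Mz Cz).
    by case: clz; exact: subset_closure.
  have M1M : M1 = M.
    apply: coM.
    - by exists x1; rewrite M1E; exact: connected_component_refl.
    - exists (~` C `&` ~` closure M2) => //.
      by apply: openI; apply: closed_openC => //; exact: closed_closure.
    - by exists (closure M1) => //; exact: closed_closure.
  apply: (disj x2); last by rewrite M2E; exact: connected_component_refl.
  by rewrite M1M; case: Ax2.
have out1 m : M1 m -> ~ C m by move=> /sub1[].
have out2 m : M2 m -> ~ C m by move=> /sub2[].
have clout1 m : closure M1 m -> ~ M1 m -> C m.
  by move=> clm nm; apply: contrapT => nC; apply: nm; apply: cl1 => //; split=> //; exact: clMi clm.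
have clout2 m : closure M2 m -> ~ M2 m -> C m.
  by move=> clm nm; apply: contrapT => nC; apply: nm; apply: cl2 => //; split=> //; exact: clMi clm.
have [q clq Cq] := reach.
have [Qq same1 [d d0 dP]] := graph_end_line b1 as1 out1 clout1 clq Cq.
(* when M2 stays away from the cylinder, the first line serves twice *)
have [a2 [b2' [r2 same2]]] : exists a2 b2', a2 ^+ 2 + b2' ^+ 2 = r ^+ 2 /\
    forall x, closure M2 x -> C x -> x 0 i0 = a2 /\ x 0 i1 = b2'.
  have [[q2 clq2 Cq2]|no] := pselect (exists2 q2, closure M2 q2 & C q2).
    exists (q2 0 i0), (q2 0 i1).
    by have [Q2 same _] := graph_end_line b2 as2 out2 clout2 clq2 Cq2.
  by exists (q 0 i0), (q 0 i1); split=> // x clx Cx; case: no; exists x.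
exists (q 0 i0), (q 0 i1), a2, b2', q; split=> //.
- by split=> //; exact: (clMi _ sub1).
- move=> x Mx Cx n1 n2.
  have : \forall y \near x, (~` closure M1 `&` ~` closure M2) y.
    apply: open_nbhs_nbhs; split.
      by apply: openI; apply: closed_openC; exact: closed_closure.
    by split=> clx; [apply: n1; exact: same1|apply: n2; exact: same2].
  apply: filterS => y [n1y n2y] My; apply: contrapT => Cy.
  by case: (cover y (conj My Cy)) => yi; [apply: n1y|apply: n2y]; exact: subset_closure.
by exists d => // y y0 y1 yd; apply: (clMi _ sub1); exact: dP.
Qed.

End ends.

(** * Flat points *)

Lemma line_derive0 (R : realType) n (f : 'rV[R]_n -> R) x v (d e : R) :
  is_derive x v f d -> 0 < e -> (forall h : R, `|h| < e -> f (x + h *: v) = 0) -> d = 0.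
Proof.
move=> /eps_of_is_derive der e0 f0; apply: contrapT => /eqP d0.
have d20 : 0 < `|d| / 2 by rewrite divr_gt0// normr_gt0.
have [del del0 delP] := der _ d20.
pose h := Num.min e del / 2.
have h0 : 0 < h by rewrite divr_gt0// lt_min e0.
have hd : h < Num.min e del by rewrite ltr_pdivrMr// ltr_pMr ?ltr1n// lt_min e0.
move: hd; rewrite lt_min => /andP[he hdel].
have := delP h; rewrite gtr0_norm// => /(_ hdel).
have fx : f x = 0 by have := f0 0; rewrite normr0 scale0r addr0; apply.
have fh : f (x + h *: v) = 0 by apply: f0; rewrite gtr0_norm.
rewrite fh fx subrr sub0r normrN normrM gtr0_norm// mulrC ler_pM2r//.
by apply/negP; rewrite -ltNge; move: d20; lra.
Qed.

Lemma coord_cvg_near (R : realType) m n (h : 'rV[R]_m -> 'rV[R]_n) x (P : 'rV[R]_n -> Prop) :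
  (forall k, h y 0 k @[y --> x] --> h x 0 k) -> (\forall z \near h x, P z) ->
  \forall y \near x, P (h y).
Proof.
move=> hC /nearP[d d0 dP].
have : \forall y \near x, forall k, `|h y 0 k - h x 0 k| < d / 2.
  apply: near_all => k; have /cvg_rVP/(_ (d / 2)) := hC k.
  rewrite divr_gt0// => /(_ isT)[d' d'0 H].
  by apply/nearP; exists d' => // y /H.
apply: filterS => y H; apply: dP; apply: (@le_lt_trans _ _ (d / 2)); last by lra.
by apply: norm_le_coord => [|k]; [lra|rewrite !mxE ltW].
Qed.

Lemma mulmx_coord_continuous (R : realType) m n (A : 'M[R]_(m, n)) (x : 'rV[R]_m) k :
  (y *m A) 0 k @[y --> x] --> (x *m A) 0 k.
Proof.
have -> : (fun y : 'rV[R]_m => (y *m A) 0 k) = fun y => \sum_i y 0 i * A i k.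
  by apply/funext => y; rewrite mxE.
rewrite mxE; apply: cvg_sum_rV => i; apply: cvgM; last exact: cvg_cst.
by have [] := C1at_coord i x.
Qed.

Lemma affine_near (R : realType) m n (A : 'M[R]_(m, n)) (p x : 'rV[R]_m) (P : 'rV[R]_n -> Prop) :
  (\forall z \near (x - p) *m A, P z) -> \forall y \near x, P ((y - p) *m A).
Proof.
apply: (coord_cvg_near (h := fun y => (y - p) *m A)) => k.
have E y : ((y - p) *m A) 0 k = (y *m A) 0 k - (p *m A) 0 k.
  by rewrite mulmxBl mxE [X in _ + X]mxE.
rewrite E (_ : (fun y => _) = fun y => (y *m A) 0 k - (p *m A) 0 k); last exact/funext.
by apply: cvgB; [exact: mulmx_coord_continuous|exact: cvg_cst].
Qed.

Lemma ball_near (R : realType) n (x : 'rV[R]_n) (d : R) : `|x| < d ->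
  \forall y \near x, `|y| < d.
Proof.
move=> xd; apply/nearP; exists (d - `|x|); first by rewrite subr_gt0.
move=> y yx; rewrite -(subrK x y); apply: le_lt_trans (ler_normD _ _) _.
by rewrite -ltrBrDr.
Qed.

Lemma coord_near (R : realType) n (x : 'rV[R]_n) k : 0 < x 0 k ->
  \forall y \near x, 0 < (y : 'rV[R]_n) 0 k.
Proof.
move=> xk; apply/nearP; exists (x 0 k) => // y yx.
have := le_lt_trans (coord_le_norm (y - x) k) yx; rewrite !mxE ltr_norml => /andP[+ _].
by rewrite ltrBrDl subrr.
Qed.

Section plane_frame.
Variables (R : realType) (n : nat) (i0 i1 : 'I_n.+1).
Hypothesis i01 : i0 != i1.

(** The frame consists of the standard vectors outside the cross section, and of
    a vector of the cross section orthogonal to the given one. The latter is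
    put at the index k0 with lift i1 k0 = i0. *)
Lemma plane_frame (c0 c1 : R) : c0 ^+ 2 + c1 ^+ 2 = 1 ->
  exists (fr : 'M[R]_(n, n.+1)) (k0 : 'I_n),
  [/\ fr *m fr^T = 1%:M,
      plane_vec i0 i1 c0 c1 *m (plane_vec i0 i1 c0 c1)^T = 1%:M,
      fr *m (plane_vec i0 i1 c0 c1)^T = 0 &
      forall w : 'rV[R]_n, (w *m fr) 0 i0 = - c1 * w 0 k0 /\ (w *m fr) 0 i1 = c0 * w 0 k0].
Proof.
move=> c01; have i10 : i1 != i0 by rewrite eq_sym.
have [k0 k0E _] := unlift_some i10.
pose v (i : 'I_n) : 'rV[R]_n.+1 :=
  if i == k0 then plane_vec i0 i1 (- c1) c0 else stdvec R (lift i1 i).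
have lift0 i : i != k0 -> lift i1 i != i0.
  by apply: contra => /eqP E; apply/eqP/(@lift_inj _ i1); rewrite E.
have vi0 i : v i 0 i0 = - c1 * (i == k0)%:R.
  rewrite /v; have [_|ik] := eqVneq i k0; first by rewrite plane_vec_i0// mulr1.
  by rewrite mxE eqxx eq_sym (negbTE (lift0 _ ik)) mulr0.
have vi1 i : v i 0 i1 = c0 * (i == k0)%:R.
  rewrite /v; have [_|ik] := eqVneq i k0; first by rewrite plane_vec_i1// mulr1.
  by rewrite mxE eqxx (negbTE (neq_lift _ _)) mulr0.
pose fr : 'M[R]_(n, n.+1) := \matrix_i v i.
have rowfr i : row i fr = v i by rewrite rowK.
have sum_w (w : 'rV[R]_n) i c : (forall j, v j 0 i = c * (j == k0)%:R) ->
    (w *m fr) 0 i = c * w 0 k0.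
  move=> vi; rewrite mxE (bigD1 k0)//= big1 => [|j jk].
    by rewrite mxE vi eqxx mulr1 addr0 mulrC.
  by rewrite mxE vi (negbTE jk) !mulr0.
exists fr, k0; split.
- apply/matrixP => i j.
  have -> : (fr *m fr^T) i j = dot (v i) (v j).
    by rewrite -!rowfr dotE !mxE; apply: eq_bigr => k _; rewrite !mxE.
  rewrite mxE {2}/v; have [->|jk] := eqVneq j k0.
    rewrite dot_plane_vec vi0 vi1; have [_|_] := eqVneq i k0; last by rewrite !mulr0 addr0.
    by rewrite (_ : true%:R = 1 :> R)// !mulr1 mulrNN -!expr2 addrC.
  rewrite dot_stdvec /v; have [->|ik] := eqVneq i k0.
    rewrite plane_vec_out ?lift0// 1?eq_sym ?neq_lift//.
    by rewrite (negbTE jk).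
  by rewrite mxE eqxx (inj_eq lift_inj) eq_sym.
- apply/matrixP => i j; rewrite !ord1 -dotE dot_plane_vec plane_vec_i0// plane_vec_i1//.
  by rewrite -!expr2 c01 mxE.
- apply/matrixP => i j; rewrite !ord1 [RHS]mxE.
  have -> : (fr *m (plane_vec i0 i1 c0 c1)^T) i 0 = dot (v i) (plane_vec i0 i1 c0 c1).
    by rewrite -rowfr dotE !mxE; apply: eq_bigr => k _; rewrite !mxE.
  by rewrite dot_plane_vec vi0 vi1; ring.
by move=> w; split; apply: sum_w.
Qed.

End plane_frame.

Section flat_points.
Variables (R : realType) (n : nat) (i0 i1 : 'I_n.+1).
Local Notation E := 'rV[R]_n.+1.
Local Notation V := 'rV[R]_n.
Local Notation Q := (axis_dist2 i0 i1).
Hypothesis i01 : i0 != i1.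
Hypothesis i0n : i0 != ord_max.
Hypothesis i1n : i1 != ord_max.
Variables (M : set E) (N : E -> E).
Hypothesis smM : smooth_hypersurface M.
Hypothesis orN : orientation M N.
Hypothesis eqH : forall W F, local_parametrization M W F -> forall u, W u ->
  mean_curvature_vector F (N (F u)) u = normal_part (N (F u)) (stdvec R ord_max).

Lemma vertical_normal c0 c1 : dot (stdvec R ord_max) (plane_vec i0 i1 c0 c1) = 0.
Proof.
by rewrite dot_plane_vec !mxE !(negbTE i0n) !(negbTE i1n) andbF !mulr0 addr0.
Qed.

Section hyperplane.
Variables (c0 c1 c : R).
Hypothesis c01 : c0 ^+ 2 + c1 ^+ 2 = 1.
Local Notation nu := (plane_vec i0 i1 c0 c1).

Definition flat (x : E) := \forall y \near x, M y -> dot y nu = c.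

Lemma flat_limit_level (x : E) : closure (M `&` flat) x -> dot x nu = c.
Proof.
move=> /closureP cl; apply/eqP; rewrite -subr_eq0 -normr_eq0 eq_le normr_ge0 andbT.
rewrite leNgt; apply/negP => pos; have [d d0 dP] := dot_near nu pos.
have [m [Mm /nbhs_singleton/(_ Mm) mc] /dP] := cl d d0.
by rewrite mc distrC ltxx.
Qed.

Lemma flat_limit_tangent W F u i : local_parametrization M W F -> W u ->
  closure (M `&` flat) (F u) -> dot (partial F i u) nu = 0.
Proof.
move=> par Wu cl; apply: contrapT => /eqP ne.
have [/cvg_rVP/(_ `|dot (partial F i u) nu|) + _ _] := param_dC1 par nu i Wu.
rewrite normr_gt0 => /(_ ne)[d d0 dP].
pose Wn := [set v : V | \forall y \near v, W y /\ dot (partial F i y) nu != 0].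
have WnW : Wn `<=` W by move=> v /nbhs_singleton[].
have oWn : open Wn by exact: open_near_set.
have Wnu : Wn u.
  apply: filterI; first exact: (param_near par _ Wu).
  have ne_near y : `|y - u| < d -> dot (partial F i y) nu != 0.
    move=> yd; apply/eqP => y0; have := dP y yd.
    by rewrite y0 sub0r normrN ltxx.
  by apply/nearP; exists d; [exact: d0|exact: ne_near].
have [_ _ _ _ /(_ Wn oWn WnW)[U oU UE]] := par.
have [_ Uu] : (M `&` U) (F u) by rewrite -UE; exists u.
have [m [[Mm flm] Um]] := cl U (open_nbhs_nbhs (conj oU Uu)).
have : (F @` Wn) m by rewrite UE.
move=> [v Wnv Fv]; have [Wv ne'] := nbhs_singleton Wnv.
move/eqP: ne'; apply; rewrite -Fv in flm.
apply: (C1at_uniq (param_C1 par nu Wv) (C1at_cst c v)).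
apply: filterS2 (param_cont par Wv flm) (param_near par (param_in par) Wv).
by move=> y; exact.
Qed.

(** At a limit of flat points M is tangent to the hyperplane, hence locally the
    graph of a function over it that vanishes on an open set, and everywhere by
    unique continuation. *)
Lemma flat_limit (x : E) : M x -> closure (M `&` flat) x ->
  \forall y \near x, M y <-> dot y nu = c.
Proof.
move=> Mx cl; have xc := flat_limit_level cl.
have [W [F [u0 [par Wu0 Fu0]]]] := smM Mx.
have [fr [k0 [fr1 nu1 frnu _]]] := plane_frame i01 c01.
have [|G [dG [ddG [rho [K [U [[rho0 K0 oU Ux] GC pde onM graph]]]]]]] :=
    local_graph orN eqH par fr1 nu1 frnu (vertical_normal c0 c1) Wu0.
  by move=> i; apply: (flat_limit_tangent (u := u0) (F := F) (W := W)); rewrite ?Fu0.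
rewrite Fu0 in Ux onM graph.
have nn : dot nu nu = 1 by rewrite dotE nu1 mxE eqxx.
have frdot (w : V) : dot (w *m fr) nu = 0 by rewrite dotE -mulmxA frnu mulmx0 mxE.
pose pt w := x + (w *m fr + G w *: nu).
have ptc w : dot (pt w) nu = c + G w.
  by rewrite !dotDl dotZl frdot nn xc mulr1 add0r.
have ptE (w : V) k : pt w 0 k = x 0 k + ((w *m fr) 0 k + G w * nu 0 k).
  by rewrite [LHS]mxE [X in _ + X]mxE [(G w *: nu) 0 k]mxE.
have G0 w : `|w| < rho -> G w = 0.
  have [m [[Mm flm] Um]] := cl U (open_nbhs_nbhs (conj oU Ux)).
  have [w1r w1G] := graph m Mm Um; set w1 := (m - x) *m fr^T in w1r w1G.
  have ptw1 : pt w1 = m.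
    by rewrite /pt /w1 -w1G -(frame_decompose fr1 nu1 frnu) addrC subrK.
  move=> wr; apply: (weak_uc (u := G) (du := dG) (ddu := ddG) (c0 := 0) (rho := rho) K0 _ _ _ (z := w1)); rewrite ?subr0//.
  - by move=> y; rewrite subr0 => /GC[].
  - by move=> i y; rewrite subr0 => /GC[_]; exact.
  - by move=> y; rewrite subr0; exact: pde.
  have ptC k : pt y 0 k @[y --> w1] --> pt w1 0 k.
    have -> : (fun y => pt y 0 k) = fun y => x 0 k + ((y *m fr) 0 k + G y * nu 0 k).
      by apply/funext => y; exact: ptE.
    rewrite ptE.
    apply: cvgD; first exact: cvg_cst.
    apply: cvgD; first exact: mulmx_coord_continuous.
    by apply: cvgM; [have [[]] := GC w1 w1r|exact: cvg_cst].
  rewrite -ptw1 in flm.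
  apply: filterS2 (coord_cvg_near ptC flm) (ball_near w1r) => y H yr.
  have := H (onM y yr); rewrite ptc => /eqP.
  by rewrite -subr_eq0 addrC addKr => /eqP.
have near_w : \forall y \near x, `|(y - x) *m fr^T| < rho.
  apply: (affine_near (P := fun z : V => `|z| < rho)).
  rewrite subrr mul0mx; apply/nearP; exists rho => // z.
  by rewrite subr0.
apply: filterS2 near_w (open_nbhs_nbhs (conj oU Ux)) => y yr Uy; split=> [My|yc].
  have [_ ] := graph y My Uy; rewrite G0// dotBl xc => /eqP.
  by rewrite subr_eq0 => /eqP.
have := onM _ yr; rewrite G0// scale0r addr0.
have := frame_decompose fr1 nu1 frnu (y - x).
by rewrite dotBl xc yc subrr scale0r addr0 => <-; rewrite addrC subrK.
Qed.

(** Flatness is an open and closed condition on M; then M is open and closed in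
    the hyperplane. *)
Lemma flat_everywhere : closed M -> connected M -> M `&` flat !=set0 ->
  M = [set y | dot y nu = c].
Proof.
move=> clM coM Mflat.
have flM : M `&` flat = M.
  apply: coM => //.
    exists flat => //; exact: open_near_set.
  exists (closure (M `&` flat)); first exact: closed_closure.
  rewrite eqEsubset; split=> x; first by move=> [Mx fx]; split=> //; apply: subset_closure.
  by move=> [Mx cl]; split=> //; apply: filterS (flat_limit Mx cl) => y [].
have iffM x : M x -> \forall y \near x, M y <-> dot y nu = c.
  by move=> Mx; apply: flat_limit => //; rewrite flM; exact: subset_closure.
rewrite eqEsubset; split=> y.
  by move=> My; have [] := nbhs_singleton (iffM y My); move=> /(_ My).
move=> /= yc; have [x0 [Mx0 _]] := Mflat.
have x0c : dot x0 nu = c by have [] := nbhs_singleton (iffM x0 Mx0); move=> /(_ Mx0).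
pose line (t : R) : E := x0 + t *: (y - x0).
pose A := line @` `[0, 1].
have lineC t : line s @[s --> t] --> line t.
  by apply: cvgD; [exact: cvg_cst|apply: cvgZr_tmp; exact: cvg_id].
have coA : connected A.
  apply: connected_continuous_connected; first exact: segment_connected.
  by apply: continuous_subspaceT => t; exact: lineC.
have AT z : A z -> dot z nu = c.
  by move=> [t _ <-]; rewrite dotDl dotZl dotBl yc x0c subrr mulr0 addr0.
have Ax0 : A x0 by exists 0; rewrite /line ?scale0r ?addr0//= in_itv/= lexx ler01.
have Ay : A y by exists 1; rewrite /line ?scale1r 1?addrC ?subrK//= in_itv/= ler01 lexx.
have AM : A `&` M = A.
  apply: coA; first by exists x0.
    exists [set z | \forall z' \near z, M z' <-> dot z' nu = c]; first exact: open_near_set.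
    rewrite eqEsubset; split=> z [Az]; first by move=> Mz; split=> //; exact: iffM.
    by move=> /nbhs_singleton[_]; split=> //; apply: b; exact: AT.
  by exists M.
by move: Ay; rewrite -AM => -[].
Qed.

End hyperplane.

(** If M stays outside the interior of the cylinder and contains a piece of a line of the
    cylinder, then it is tangent to the cylinder along the line: as a graph
    over the tangent hyperplane it vanishes on the line to second order, and
    unique continuation across the line applies to its restriction to one
    side. *)
Lemma flat_outside (r al be d : R) (q : E) : 0 < r -> al ^+ 2 + be ^+ 2 = r ^+ 2 ->
  M q -> q 0 i0 = al -> q 0 i1 = be -> (forall x, M x -> r ^+ 2 <= Q x) ->
  0 < d -> (forall y : E, y 0 i0 = 0 -> y 0 i1 = 0 -> `|y| < d -> M (q + y)) ->
  exists c0 c1 c x, c0 ^+ 2 + c1 ^+ 2 = 1 /\ (M `&` flat c0 c1 c) x.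
Proof.
move=> r0 albe Mq q0 q1 out d0 line.
pose c0 := al / r; pose c1 := be / r.
have rn : r != 0 by rewrite gt_eqF.
have alE : al = r * c0 by rewrite mulrC divfK.
have beE : be = r * c1 by rewrite mulrC divfK.
have c01 : c0 ^+ 2 + c1 ^+ 2 = 1.
  by rewrite !expr_div_n -mulrDl albe divff// expf_neq0.
pose nu := plane_vec i0 i1 c0 c1.
have [W [F [u0 [par Wu0 Fu0]]]] := smM Mq.
have tan i : dot (partial F i u0) nu = 0.
  have FkC k : C1at (fun v => F v 0 k) (fun i v => partial F i v 0 k) u0.
    by apply: C1at_ext (param_C1 par (stdvec R k) Wu0) => [v|j v]; exact: dot_stdvec.
  have fC := C1atN (C1atD (C1atM (FkC i0) (FkC i0)) (C1atM (FkC i1) (FkC i1))).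
  have := local_max_grad _ fC i; rewrite Fu0 q0 q1 alE beE dot_plane_vec => H.
  apply: (mulfI rn); rewrite mulr0.
  have /eqP : - (2 * (r * (c0 * partial F i u0 0 i0 + c1 * partial F i u0 0 i1))) = 0.
    rewrite -[RHS]H; first by ring.
    apply: filterS (param_near par (param_in par) Wu0) => v /out.
    by rewrite lerN2 -!expr2 -/(axis_dist2 i0 i1 (F v)) -alE -beE albe.
  by rewrite oppr_eq0 mulf_eq0 pnatr_eq0/= => /eqP.
have [fr [k0 [fr1 nu1 frnu frw]]] := plane_frame i01 c01.
have [G [dG [ddG [rho [K [U [[rho0 K0 oU Uq] GC pde onM graph]]]]]]] :=
    local_graph orN eqH par fr1 nu1 frnu (vertical_normal c0 c1) Wu0 tan.
rewrite Fu0 in Uq onM graph.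
have GCw w (wr : `|w| < rho) := (GC w wr).1; have dGC w (wr : `|w| < rho) := (GC w wr).2.
have outG w : `|w| < rho -> r ^+ 2 <= (r + G w) ^+ 2 + w 0 k0 ^+ 2.
  move=> wr; apply: le_trans (out _ (onM w wr)) _; rewrite /axis_dist2.
  have [w0 w1] := frw w.
  have E0 : (q + (w *m fr + G w *: nu)) 0 i0 = al - c1 * w 0 k0 + c0 * G w.
    rewrite mxE q0 [X in _ + X]mxE w0 [X in _ + (_ + X)]mxE plane_vec_i0//.
    by rewrite mulNr addrA [G w * _]mulrC.
  have E1 : (q + (w *m fr + G w *: nu)) 0 i1 = be + c0 * w 0 k0 + c1 * G w.
    rewrite mxE q1 [X in _ + X]mxE w1 [X in _ + (_ + X)]mxE plane_vec_i1//.
    by rewrite addrA [G w * _]mulrC.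
  rewrite E0 E1 alE beE.
  rewrite (_ : _ + _ = (c0 ^+ 2 + c1 ^+ 2) * ((r + G w) ^+ 2 + w 0 k0 ^+ 2)); last by ring.
  by rewrite c01 mul1r.
have frdot (w : V) : dot (w *m fr) nu = 0 by rewrite dotE -mulmxA frnu mulmx0 mxE.
have frfr (w : V) : w *m fr *m fr^T = w by rewrite -mulmxA fr1 mulmx1.
have [rho2 rho20 small] : exists2 rho2 : R, 0 < rho2 & forall w : V, `|w| < rho2 ->
    [/\ `|w| < rho, U (q + w *m fr) & w 0 k0 = 0 -> G w = 0].
  have : \forall w \near (0 : V), `|(w - 0) *m fr| < d /\ U (q + (w - 0) *m fr).
    apply: (affine_near (P := fun z : E => `|z| < d /\ U (q + z))); rewrite subrr mul0mx.
    have /nearP[d' d'0 d'P] := open_nbhs_nbhs (conj oU Uq).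
    apply/nearP; exists (Num.min d d'); first by rewrite lt_min d0.
    move=> z; rewrite subr0 lt_min => /andP[zd zd']; split=> //.
    by apply: d'P; rewrite addrC addKr.
  move=> /nearP[d' d'0 d'P]; exists (Num.min rho d'); first by rewrite lt_min rho0.
  move=> w; rewrite lt_min => /andP[wr wd]; have := d'P w; rewrite subr0 => /(_ wd)[wfd Uw].
  split=> // wk0; have [w0 w1] := frw w.
  have Mw : M (q + w *m fr) by apply: line; rewrite ?w0 ?w1 ?wk0 ?mulr0.
  have [_] := graph _ Mw Uw.
  by rewrite [q + _]addrC addrK frfr frdot.
have grad0 l (w : V) : `|w| < rho2 -> w 0 k0 = 0 -> dG l w = 0.
  move=> wr2 wk; have [wr _ /(_ wk) Gw] := small w wr2.
  have rG := C1atD (C1at_cst r w) (GCw w wr).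
  have fC := C1atN (C1atD (C1atM rG rG) (C1atM (C1at_coord k0 w) (C1at_coord k0 w))).
  have := local_max_grad _ fC l; rewrite wk Gw !(mulr0, mul0r, addr0, add0r) => H.
  apply: (mulfI rn); rewrite mulr0.
  have /eqP : - (2 * (r * dG l w)) = 0.
    rewrite -[RHS]H; first by ring.
    apply: filterS (ball_near wr) => y /outG.
    by rewrite lerN2 !expr2.
  by rewrite oppr_eq0 mulf_eq0 pnatr_eq0/= => /eqP.
have hess0 l m (w : V) : `|w| < rho2 -> w 0 k0 = 0 -> ddG l m w = 0.
  move=> wr2 wk; have [wr _ _] := small w wr2.
  have off l' m' : m' != k0 -> ddG l' m' w = 0.
    move=> mk; have [_ /(_ m') der _] := dGC w wr l'.
    apply: (line_derive0 der (e := rho2 - `|w|)); first by rewrite subr_gt0.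
    move=> h hr; apply: grad0.
      apply: le_lt_trans (ler_normD _ _) _; rewrite normrZ.
      have : `|h| * `|stdvec R m'| <= `|h| by rewrite ler_piMr//; exact: stdvec_norm.
      by move: hr; lra.
    by rewrite !mxE wk eqxx eq_sym (negbTE mk) mulr0 addr0.
  have [mk|] := eqVneq m k0; last exact: off.
  have [lk|lk] := eqVneq l k0; last first.
    rewrite (C2_sym (f := G) (df := dG) (ddf := ddG)); first exact: off.
      by apply: filterS (ball_near wr) => y /GC[].
    by move=> i; apply: filterS (ball_near wr) => y /GC[].
  have := pde w wr; rewrite [X in _ * X]big1 => [|i _]; last by rewrite grad0// expr0n.
  rewrite mulr0 (bigD1 k0)//= big1 => [|i ik]; last exact: off.
  rewrite addr0 mk lk => le0; apply/eqP; rewrite -sqrf_eq0 eq_le le0/=.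
  exact: sqr_ge0.
(* the restriction of G to one side of the line, extended by zero *)
pose b (w : V) := 0 < w 0 k0.
have bneg (w : V) : w 0 k0 < 0 -> \forall y \near w, ~~ b y.
  move=> wk; have : 0 < (- w) 0 k0 by rewrite mxE oppr_gt0.
  move=> /coord_near/nearP[e e0 eP]; apply/nearP; exists e => // y yw.
  rewrite /b -leNgt; have := eP (- y); rewrite mxE oppr_gt0 -opprD normrN => /(_ yw).
  exact: ltW.
have bcases f (df : 'I_n -> V -> R) (w : V) : C1at f df w ->
    (w 0 k0 = 0 -> f w = 0 /\ forall i, df i w = 0) ->
    C1at (cutoff b f) (fun i => cutoff b (df i)) w.
  move=> fC f0; apply: C1at_cutoff; have [pos|neg|zero] := ltrgtP 0 (w 0 k0).
  - by apply: Or31; split=> //; exact: coord_near.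
  - by apply: Or32; exact: bneg.
  - by have [fw dfw] := f0 (esym zero); apply: Or33.
have zk (t : R) : (t *: stdvec R k0) 0 k0 = t by rewrite !mxE !eqxx mulr1.
have zr (t : R) : `|t| < rho2 -> `|t *: stdvec R k0 : V| < rho2.
  move=> tr; rewrite normrZ; apply: le_lt_trans tr.
  by rewrite ler_piMr//; exact: stdvec_norm.
have r2 : 0 < rho2 / 2 by exact: divr_gt0.
have G0 (w : V) : `|w| < rho2 -> 0 < w 0 k0 -> G w = 0.
  move=> wr2 wk; have : cutoff b G w = 0; last by rewrite /cutoff /b wk.
  apply: (weak_uc (du := fun i => cutoff b (dG i)) (ddu := fun i j => cutoff b (ddG i j))
    (c0 := 0) (rho := rho2) K0 _ _ _ (z := (- (rho2 / 2)) *: stdvec R k0)); rewrite ?subr0//.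
  - move=> y; rewrite subr0 => yr; have [yr' _ Gy] := small y yr.
    apply: bcases (GCw y yr') _ => yk; split; first exact: Gy.
    by move=> i; exact: grad0.
  - move=> i y; rewrite subr0 => yr; have [yr' _ _] := small y yr.
    apply: bcases (dGC y yr' i) _ => yk; split; first exact: grad0.
    by move=> j; exact: hess0.
  - move=> y; rewrite subr0 => yr; have [yr' _ _] := small y yr.
    rewrite /cutoff; case: (b y); first exact: pde.
    rewrite big1// expr0n big1 ?mulr0// => i _; exact: expr0n.
  - by apply: zr; rewrite normrN gtr0_norm//; lra.
  have zneg : (- (rho2 / 2) *: stdvec R k0) 0 k0 < 0 by rewrite zk oppr_lt0.
  by apply: filterS (bneg _ zneg) => y; rewrite /cutoff => /negbTE ->.
pose w1 : V := (rho2 / 2) *: stdvec R k0.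
have w1r : `|w1| < rho2 by apply: zr; rewrite gtr0_norm//; lra.
have w1k : 0 < w1 0 k0 by rewrite zk.
have [w1r' Uw1 _] := small w1 w1r.
exists c0, c1, r, (q + w1 *m fr); split=> //; split.
  by have := onM w1 w1r'; rewrite G0// scale0r addr0.
have near_w1 : \forall y \near q + w1 *m fr, `|(y - q) *m fr^T| < rho2 /\ 0 < ((y - q) *m fr^T) 0 k0.
  apply: (affine_near (P := fun z : V => `|z| < rho2 /\ 0 < z 0 k0)).
  rewrite [q + _]addrC addrK frfr.
  by apply: filterI; [exact: ball_near|exact: coord_near].
apply: filterS2 near_w1 (open_nbhs_nbhs (conj oU Uw1)) => y [yr yk] Uy My.
have [_] := graph y My Uy; rewrite G0// dotBl => /eqP; rewrite subr_eq0 => /eqP ->.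
by rewrite dot_plane_vec q0 q1 alE beE -[RHS]mul1r -c01; ring.
Qed.

End flat_points.

(** * Rigidity *)

Lemma plane_normal (R : realType) (x y : R) :
  exists c0 c1 : R, c0 ^+ 2 + c1 ^+ 2 = 1 /\ c0 * x + c1 * y = 0.
Proof.
have [xy0|xy0] := eqVneq (x ^+ 2 + y ^+ 2) 0.
  exists 1, 0; split; first by rewrite expr1n expr0n addr0.
  move/eqP: xy0; rewrite paddr_eq0 ?sqr_ge0// !sqrf_eq0 => /andP[/eqP-> _].
  by rewrite mulr0 mul0r addr0.
have s0 : 0 <= x ^+ 2 + y ^+ 2 by rewrite addr_ge0 ?sqr_ge0.
pose s := Num.sqrt (x ^+ 2 + y ^+ 2).
exists (- y / s), (x / s); split; last by rewrite mulNr mulNr mulrAC [x / s * y]mulrAC [y * x]mulrC addNr.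
by rewrite !expr_div_n sqrrN -mulrDl sqr_sqrtr// [y ^+ 2 + _]addrC divff.
Qed.

Theorem theorem3p1 (R : realType) (n : nat) (hn : (2 <= n)%N)
    (M : set 'rV[R]_n.+1)
    (Msol : translating_soliton M)
    (Mcomplete : complete_hypersurface M)
    (Mconn : connected M)
    (Mproper : properly_embedded M)
    (Masym : exists2 r : R, 0 < r &
       exists H1 H2 : half_hyperplane R n,
         asymptotic_outside 1 (cylinder r) M H1 H2) :
  vertical_hyperplane M.
Proof.
pose i0 : 'I_n.+1 := ord0; pose i1 : 'I_n.+1 := inord n.-1.
have i1E : i1 = n.-1 :> nat by rewrite inordK// ltnS leq_pred.
have i01 : i0 != i1 by rewrite -val_eqE/= i1E; case: n hn {i0 i1 i1E M Msol Mcomplete Mconn Mproper Masym} => [|[|]].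
have i0n : i0 != ord_max by rewrite -val_eqE/=; case: n hn {i0 i1 i1E i01 M Msol Mcomplete Mconn Mproper Masym}.
have i1n : i1 != ord_max.
  rewrite -val_eqE/= i1E; case: n hn {i0 i1 i1E i01 i0n M Msol Mcomplete Mconn Mproper Masym} => // k _.
  by rewrite /= neq_ltn ltnSn.
have [smM [N orN eqH]] := Msol.
have clM := proper_closed Mproper.
have [r r0 [H1 [H2 as12]]] := Masym.
have CE : cylinder r = [set x : 'rV[R]_n.+1 | axis_dist2 i0 i1 x <= r ^+ 2].
  by apply/seteqP; split=> x; rewrite /cylinder/= !dot_stdvec.
rewrite CE in as12.
have [al1 [be1 [al2 [be2 [q [[ab1 ab2] [Mq [q0 q1]] int [d d0 line]]]]]]] :=
  ends i01 r0 clM Mconn as12.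
suff [c0 [c1 [c [x [c01 flx]]]]] : exists c0 c1 c x, c0 ^+ 2 + c1 ^+ 2 = 1 /\
    (M `&` flat i0 i1 M c0 c1 c) x.
  have ME : M = [set y | dot y (plane_vec i0 i1 c0 c1) = c].
    apply: (flat_everywhere i01 i0n i1n smM orN eqH c01 clM Mconn).
    by exists x.
  exists x, (plane_vec i0 i1 c0 c1); split.
  - rewrite /enorm dot_plane_vec plane_vec_i0// plane_vec_i1//.
    by rewrite -!expr2 c01 sqrtr1.
  - exact: vertical_normal.
  have xc : dot x (plane_vec i0 i1 c0 c1) = c by have := flx.1; rewrite {1}ME.
  rewrite {1}ME; apply/seteqP; split=> y /=; rewrite dotBl xc.
    by move=> ->; rewrite subrr.
  by move=> /eqP; rewrite subr_eq0 => /eqP.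
(* at a point of the cylinder off the two lines M is flat at once *)
have [[x [Mx Cx n1 n2]]|no] := pselect (exists x, [/\ M x, axis_dist2 i0 i1 x <= r ^+ 2,
    ~ (x 0 i0 = al1 /\ x 0 i1 = be1) & ~ (x 0 i0 = al2 /\ x 0 i1 = be2)]).
  have [c0 [c1 [c01 c12]]] := plane_normal (al1 - al2) (be1 - be2).
  pose c := c0 * al1 + c1 * be1.
  have c2 : c0 * al2 + c1 * be2 = c.
    by apply/eqP; rewrite eq_sym -subr_eq0 -[X in _ == X]c12 /c; apply/eqP; ring.
  have le1 := max_principle i01 i0n i1n smM orN eqH Mproper r0 int c01 erefl c2.
  have le2 : forall x, M x -> axis_dist2 i0 i1 x <= r ^+ 2 -> - c0 * x 0 i0 + - c1 * x 0 i1 <= - c.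
    apply: (max_principle i01 i0n i1n smM orN eqH Mproper r0 int).
    - by rewrite !sqrrN.
    - by rewrite /c !mulNr -opprD.
    - by rewrite -c2 !mulNr -opprD.
  exists c0, c1, c, x; split=> //; split=> //.
  apply: filterS (int x Mx Cx n1 n2) => y Cy My; rewrite dot_plane_vec.
  apply/eqP; rewrite eq_le le1 ?Cy//=.
  by have := le2 y My (Cy My); rewrite !mulNr -opprD lerN2.
apply: (flat_outside i01 i0n i1n smM orN eqH r0 ab1 Mq q0 q1 _ d0 line) => x Mx.
rewrite leNgt; apply/negP => lt; apply: no; exists x; split=> //; first exact: ltW.
  by move=> [x0 x1]; move: lt; rewrite /axis_dist2 x0 x1 ab1 ltxx.
by move=> [x0 x1]; move: lt; rewrite /axis_dist2 x0 x1 ab2 ltxx.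
Qed.
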